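(* Let $Q\subset\mathbb C$ be a convex set with nonempty interior that has a countable basis of neighbourhoods consisting of convex domains, and suppose $\omega:=Q\cap\partial Q\neq\emptyset$. Let $K\subset\mathbb C$ be a convex compact set and let $\mu\in A(K)'\setminus\{0\}$. Suppose that the convolution operator $T_\mu:A(Q+K)\to A(Q)$ is surjective. Then for every compact set $A\subset R_Q$ the function $\widehat\mu$ is slowly decreasing on $\Gamma(A)$.
   Context: Notation: $B(t,r)=\{z\in\mathbb C: |z-t|<r\}$, $S=\{z\in\mathbb C:|z|=1\}$, $\mathbb N=\{1,2,\dots\}$. For $M\subset\mathbb C$, $H_M(z)=\sup_{t\in M}\mathrm{Re}(zt)$, $z\in\mathbb C$, is the support function of $M$ (possibly taking the value $+\infty$). For $B\subset\mathbb C$, $\Gamma(B)=\{\lambda b:\lambda\ge 0,\ b\in B\}$. Spaces. For open $G\subset\mathbb C$, $A(G)$ is the Fréchet space of all analytic functions on $G$ with the topology of uniform convergence on compact subsets. Put $\widetilde Q_n=(\mathrm{int}\,Q)\cup(\omega+B(0,1/n))$ and $Q_n=\mathrm{conv}\,\widetilde Q_n$, $n\in\mathbb N$. The sequence $(Q_n)$ is a basis of neighbourhoods of $Q$, and $(Q_n+K)$ is a basis of neighbourhoods of $Q+K$. $A(Q)$ is the space of germs of all functions analytic on (a neighbourhood of) $Q$, so $A(Q)=\bigcup_n A(Q_n)$, with the locally convex inductive limit topology $A(Q)=\mathrm{ind}_{n\to}A(Q_n)$; similarly $A(Q+K)=\mathrm{ind}_{n\to}A(Q_n+K)$. For the convex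 compact set $K$, $A(K)$ is the space of germs of all functions analytic on $K$ with its natural inductive limit topology $A(K)=\mathrm{ind}_{n\to}A(K+B(0,1/n))$; $A(K)'$ is its topological dual. Convolution operator: $T_\mu(f)(z)=\mu_t(f(t+z))$ (the functional $\mu$ acts in the variable $t$). It maps each $A(Q_n+K)$ linearly and continuously into $A(Q_n)$, hence $A(Q+K)$ linearly and continuously into $A(Q)$. $\widehat\mu(\lambda)=\mu(e_\lambda)$ with $e_\lambda(z)=\exp(\lambda z)$ is the Laplace transform of $\mu$, an entire function of exponential type. The set $R_Q$: $E_Q$ is the set of all $b\in S$ with $H_Q(b)<+\infty$; $N_Q$ is the set of all $b\in S$ that have no open neighbourhood (in $\mathbb C$) in which $H_Q$ is harmonic; $R_Q:=E_Q\cap N_Q$. Slow decrease: for a closed set $A\subset S$, $\widehat\mu$ is called slowly decreasing on $\Gamma(A)$ if for every $k\in\mathbb N$ there is $R>0$ such that for every $z\in\Gamma(A)$ with $|z|\ge R$ there is $w\in\mathbb C$ with $|w-z|\le|z|/k$ and $|\widehat\mu(w)|\ge\exp(H_K(w)-|w|/k)$. *)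

(* Defs.v *)
From HB Require Import structures.
From mathcomp Require Import all_boot all_order all_algebra.
From mathcomp Require Import ring_quotient.
From mathcomp Require Import all_classical all_reals all_analysis.
From mathcomp Require Import complex.

Set Implicit Arguments.
Unset Strict Implicit.
Unset Printing Implicit Defensive.

Import Order.TTheory GRing.Theory Num.Theory.
Import numFieldNormedType.Exports.

Local Open Scope classical_set_scope.
Local Open Scope ring_scope.
Local Open Scope complex_scope.

(* The complex plane, as a normed space over itself. Its norm and its order take
   values in [Cx R]; [modulus] is the real-valued modulus. *)
Definition Cx (R : realType) : Type := R[i].
HB.instance Definition _ (R : realType) := Num.ClosedField.copy (Cx R) R[i].
HB.instance Definition _ (R : realType) := NormedModule.copy (Cx R) ((Cx R)^o).

Section PlaneGeometry.
Variable R : realType.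
Local Notation C := (Cx R).
Implicit Types (M Q K B U : set C) (z w : C).

Definition modulus z : R := complex.Re `|z|.

Definition unit_circle : set C := [set z | modulus z = 1].

Definition disc z (r : R) : set C := [set w | modulus (w - z) < r].

Definition minkowski M B : set C := [set x + y | x in M & y in B].

(* The scalars of the convex combinations range over the p in [Cx R]
   with 0 <= p <= 1, that is, over the real interval [0, 1]. *)
Definition is_convex M : Prop :=
  convex_set (M : set (convex_lmodType (C : lmodType C))).

Definition convex_domain U : Prop :=
  [/\ open U, U !=set0, connected U & is_convex U].

Definition has_countable_convex_basis Q : Prop :=
  exists U : nat -> set C,
    [/\ forall n, convex_domain (U n),
        forall n, Q `<=` U n &
        forall V, set_nbhs Q V -> exists n, U n `<=` V].

Definition omega Q : set C := Q `&` (closure Q `\` interior Q).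

(* The sequence is indexed from 0: [Qn Q n] is $Q_{n+1}$. *)
Definition Qn Q (n : nat) : set C :=
  smallest is_convex
    (interior Q `|` minkowski (omega Q) (disc 0 n.+1%:R^-1)).

Definition support_fun M z : \bar R :=
  ereal_sup [set (complex.Re (z * t))%:E | t in M].

Definition cone B : set C :=
  [set z | exists2 l : R, 0 <= l & exists2 b, B b & z = l%:C * b].

Definition shift_x (u : C -> R) z : R^o -> R^o := fun s => u (z + s%:C).
Definition shift_y (u : C -> R) z : R^o -> R^o := fun s => u (z + s *i).
Definition dx (u : C -> R) : C -> R := fun z => derive1 (shift_x u z) 0.
Definition dy (u : C -> R) : C -> R := fun z => derive1 (shift_y u z) 0.

Definition C1_on U (u : C -> R) : Prop :=
  forall z, U z ->
    [/\ derivable (shift_x u z) 0 1, derivable (shift_y u z) 0 1,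
        {for z, continuous (dx u)} & {for z, continuous (dy u)}].

Definition harmonic_on U (u : C -> R) : Prop :=
  [/\ C1_on U u, C1_on U (dx u), C1_on U (dy u) &
      forall z, U z -> dx (dx u) z + dy (dy u) z = 0].

Definition E_set Q : set C :=
  [set b | unit_circle b /\ (support_fun Q b < +oo)%E].

Definition N_set Q : set C :=
  [set b | unit_circle b /\
    ~ exists U : set C,
        [/\ open U, U b,
            forall z, U z -> support_fun Q z \is a fin_num &
            harmonic_on U (fun z => fine (support_fun Q z))]].

Definition R_set Q : set C := E_set Q `&` N_set Q.

Definition slowly_decreasing K (g : C -> C) (G : set C) : Prop :=
  forall k : nat, (0 < k)%N ->
    exists2 r : R, 0 < r & forall z, G z -> r <= modulus z ->
      exists w, modulus (w - z) <= modulus z / k%:R /\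
        (expeR (support_fun K w - (modulus w / k%:R)%:E) <= (modulus (g w))%:E)%E.

Definition cexp z : C :=
  (expR (complex.Re z) * cos (complex.Im z)) +i*
  (expR (complex.Re z) * sin (complex.Im z)).

End PlaneGeometry.

(* Locked only to keep failing conversions from unfolding it; [analytic_on.unlock]
   gives the definition back. *)
HB.lock Definition analytic_on (R : realType) (G : set (Cx R))
    (f : Cx R -> Cx R) : Prop :=
  forall z, G z -> exists a : nat -> Cx R,
    \forall w \near z, series (fun n => a n * (w - z) ^+ n) @ \oo --> f w.
Canonical analytic_on_unlockable := Unlockable analytic_on.unlock.

Section AnalyticGerms.
Variable R : realType.
Local Notation C := (Cx R).
Implicit Types (M G : set C) (f g : C -> C).

Definition near_analytic M : {pred (C -> C)} :=
  fun f => `[< exists G, [/\ open G, M `<=` G & analytic_on G f] >].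

Lemma near_analytic_submod M : submod_closed (near_analytic M).
Proof.
split.
  apply/asboolP; exists setT; split => //; first exact: openT.
  rewrite unlock => z _; exists (fun=> 0); apply: filterE => w.
  rewrite (_ : series _ = fun=> 0); first exact: cvg_cst.
  by apply/funext => n; rewrite /series /= big1 // => i _; rewrite mul0r.
move=> c f g /asboolP[G [oG MG aG]] /asboolP[H [oH MH aH]].
apply/asboolP; exists (G `&` H); split; [exact: openI| |].
  by move=> x Mx; split; [exact: MG|exact: MH].
move: aG aH; rewrite unlock => aG aH z [/aG[a az] /aH[b bz]]; exists (fun n => c * a n + b n).
apply: filterS2 az bz => w fa gb.
rewrite (_ : series _ = (fun n => c * series (fun n => a n * (w - z) ^+ n) n)
   \+ series (fun n => b n * (w - z) ^+ n)); last first.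
  apply/funext => n; rewrite /series /= mulr_sumr -big_split /=.
  by apply: eq_bigr => i _; rewrite mulrDl mulrA.
exact: (cvgD (cvgM (cvg_cst c) fa) gb).
Qed.

HB.instance Definition _ M :=
  GRing.isSubmodClosed.Build C (C -> C) (near_analytic M)
    (near_analytic_submod M).

Record nearfun M := NearFun {
  nearfun_val :> C -> C;
  nearfunP : nearfun_val \in near_analytic M }.

HB.instance Definition _ M := [isSub for @nearfun_val M].
HB.instance Definition _ M := [Choice of nearfun M by <:].
HB.instance Definition _ M :=
  [SubChoice_isSubLmodule of nearfun M by <:].

Definition null_germ M : {pred nearfun M} :=
  fun h : nearfun M => `[< set_nbhs M [set z | h z = 0] >].

Lemma null_germ_submod M : submod_closed (@null_germ M).
Proof.
split; first by apply/asboolP; exact: filterE.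
move=> c h k /asboolP hM /asboolP kM; apply/asboolP.
apply: filterS2 hM kM => z hz kz.
change (c * h z + k z = 0).
by rewrite (hz : h z = 0) (kz : k z = 0) mulr0 addr0.
Qed.

HB.instance Definition _ M :=
  GRing.isSubmodClosed.Build C (nearfun M) (@null_germ M) (null_germ_submod M).

(* The space of germs on M of the functions that are analytic on a neighbourhood
   of M: two such functions have the same germ when they agree near M. *)
Definition germ M : Type := Quotient.quot (@null_germ M).
HB.instance Definition _ M := GRing.Zmodule.on (germ M).

Section GermModule.
Variable M : set C.

Definition germ_pi (h : nearfun M) : germ M :=
  (\pi_(Quotient.quot (@null_germ M)) h)%qT.

Definition germ_repr (x : germ M) : nearfun M :=
  repr (x : Quotient.quot (@null_germ M)).

Lemma germ_reprK x : germ_pi (germ_repr x) = x.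
Proof. exact: reprK. Qed.

Lemma germ_pi_eq h k : (germ_pi h = germ_pi k) <-> (h - k \in @null_germ M).
Proof.
rewrite Quotient.idealrBE; split => [|/eqP //].
by move=> /(@eqP (Quotient.quot (@null_germ M))).
Qed.

Lemma germ_piD h k : germ_pi (h + k) = germ_pi h + germ_pi k.
Proof. exact: (raddfD (\pi_(Quotient.quot (@null_germ M)))%qT). Qed.

Definition germ_scale (c : C) (x : germ M) : germ M :=
  germ_pi (c *: germ_repr x).

Lemma germ_pi_scale c h : germ_pi (c *: h) = germ_scale c (germ_pi h).
Proof.
apply/germ_pi_eq; rewrite -scalerBr rpredZ //; apply/germ_pi_eq.
by rewrite germ_reprK.
Qed.

Fact germ_scaleA a b x : germ_scale a (germ_scale b x) = germ_scale (a * b) x.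
Proof. by rewrite -[x]germ_reprK -!germ_pi_scale scalerA. Qed.

Fact germ_scale1 : left_id 1 germ_scale.
Proof. by move=> x; rewrite -[x]germ_reprK -germ_pi_scale scale1r. Qed.

Fact germ_scaleDr : right_distributive germ_scale +%R.
Proof.
move=> c x y; rewrite -[x]germ_reprK -[y]germ_reprK.
by rewrite -germ_piD -!germ_pi_scale scalerDr germ_piD.
Qed.

Fact germ_scaleDl x : {morph germ_scale^~ x : a b / a + b}.
Proof.
move=> a b; rewrite -[x]germ_reprK.
by rewrite -!germ_pi_scale scalerDl germ_piD.
Qed.

HB.instance Definition _ := GRing.Zmodule_isLmodule.Build C (germ M)
  germ_scaleA germ_scale1 germ_scaleDr germ_scaleDl.

(* The germ on M of f; it is 0 when f is analytic on no neighbourhood of M. *)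
Definition germ_of f : germ M := germ_pi (insubd 0 f).

End GermModule.

(* An element of A(G) is represented by any function on the plane that extends it;
   the topology of uniform convergence on the compact subsets of G does not see
   the values outside G. *)
Definition nbhs0_A G : set_system (C -> C) :=
  within (analytic_on G)
    (nbhs ((fun=> 0) : {family [set L | compact L /\ L `<=` G], C -> C})).

Definition absolutely_convex (E : lmodType C) (U : set E) : Prop :=
  forall (a b : C) (x y : E), `|a| + `|b| <= 1 -> U x -> U y -> U (a *: x + b *: y).

(* [ind_germ M G] is the space of germs on M with the locally convex inductive limit
   topology of the spaces A(G n), with respect to the linear maps
   [germ_of : A(G n) -> germ M]. The absolutely convex sets whose preimages in
   every A(G n) are zero neighbourhoods form a base of its zero neighbourhoods. *)
Definition ind_germ M (G : nat -> set C) : Type := germ M.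

Section InductiveLimit.
Variables (M : set C) (G : nat -> set C).

HB.instance Definition _ := GRing.Lmodule.on (ind_germ M G).

Definition ind_nbhs0 (U : set (germ M)) : Prop :=
  absolutely_convex U /\ forall n, nbhs0_A (G n) [set f | U (germ_of M f)].

Definition ind_open (W : set (ind_germ M G)) : Prop :=
  forall x, W x -> exists2 U : set (germ M), ind_nbhs0 U &
    forall u, U u -> W (x + u).

Let ind_openT : ind_open setT.
Proof.
move=> x _; exists setT => //; split => // n.
by apply: filterE.
Qed.

Let ind_openI : setI_closed ind_open.
Proof.
move=> V W oV oW x [/oV[U1 [c1 n1] s1] /oW[U2 [c2 n2] s2]].
exists (U1 `&` U2); last by move=> u [/s1 ? /s2 ?].
split; last by move=> n; apply: filterI; [exact: n1|exact: n2].
by move=> a b u v ab [u1 u2] [v1 v2]; split; [exact: c1|exact: c2].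
Qed.

Let ind_open_bigU (I : Type) (F : I -> set (ind_germ M G)) :
  (forall i, ind_open (F i)) -> ind_open (\bigcup_i F i).
Proof.
move=> oF x [i _ /oF[U U0 sU]]; exists U => // u Uu.
by exists i => //; exact: sU.
Qed.

HB.instance Definition _ := isOpenTopological.Build (ind_germ M G)
  ind_openT ind_openI ind_open_bigU.

End InductiveLimit.
End AnalyticGerms.

Section ConvolutionOperator.
Variable R : realType.
Local Notation C := (Cx R).

Definition A_Q (Q : set C) := ind_germ Q (Qn Q).
Definition A_QK (Q K : set C) :=
  ind_germ (minkowski Q K) (fun n => minkowski (Qn Q n) K).
Definition A_K (K : set C) :=
  ind_germ K (fun n => minkowski K (disc 0 n.+1%:R^-1)).

Variables (Q K : set C) (mu : A_K K -> C).

(* The outer [germ_of] never takes its default value when mu is continuous, since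
   the function of z is then analytic near Q. *)
Definition conv_op (f : A_QK Q K) : A_Q Q :=
  germ_of Q (fun z => mu (germ_of K (fun t => germ_repr f (t + z)))).

Definition laplace (l : C) : C := mu (germ_of K (fun z => cexp (l * z))).

End ConvolutionOperator.

(* Main.v *)
(* Suppose slow decrease fails on Gamma(A). By compactness of A there are b in A, delta > 0
   and arbitrarily large r such that |mu^(w)| <= exp(H_K(w) - delta |w|) whenever
   |w - r b| <= delta r.

   Since H_Q is not harmonic near b, there are points of Q at which Re(b t) is almost maximal
   and whose imaginary parts Im(b t) differ by much more than their defects H_Q(b) - Re(b t);
   otherwise H_Q would be linear near b. Shrunk towards an interior point of Q, they span a
   segment [t - d, t + d] with a neighbourhood in Q. A high power of a hyperbolic cosine gives
   an exponential sum F_r with frequencies t_k in this segment that is exponentially larger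
   than exp(r H_Q(b)) at r b and bounded by exp(H_[t-d,t+d](w) + eps |w|) off the disc
   |w - r b| <= delta r. Hence F_r mu^ is bounded by exp(H_{[t-d,t+d]+K}(w) + eps |w|)
   uniformly in r, and a Polya type argument (approximation by Cauchy kernels, each of them a
   superposition of exponentials) bounds the functionals f |-> sum_k a_k mu(f(. + t_k)),
   for every fixed f analytic near Q + K, uniformly in r.

   For a lacunary series g(z) = sum_l exp(- r_l (H_Q(b) + eta D)) exp(r_l b z), analytic on a
   half-plane containing Q, a solution f of T_mu f = g would turn this into a bound on
   sum_k a_k g(t_k), which is at least exp(r_j eta D) - O(1). *)
Require Import Defs.
From HB Require Import structures.
From mathcomp Require Import all_boot all_order all_algebra.
From mathcomp Require Import all_classical all_reals all_analysis.
From mathcomp Require Import complex zify ring lra.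

Set Implicit Arguments.
Unset Strict Implicit.
Unset Printing Implicit Defensive.

Import Order.TTheory GRing.Theory Num.Theory.
Import numFieldNormedType.Exports.

Local Open Scope classical_set_scope.
Local Open Scope ring_scope.
Local Open Scope complex_scope.

(** Three quantities, all multiples of [eta * D], have to be balanced: the defect of the segment,
    the radius [4 * (kap * eta * D)] of its neighbourhood in [Q], and the exponential gain of the
    test sum. The ratio [kap] comes from the geometry before [eta], so [eta] can still be adapted to
    [dl]. Let [N] be the power of the hyperbolic cosine and [q] the scale at which its contraction
    is measured. The gain is about [q ^+ 2 * N], and localisation in the disc of radius [dl * r]
    asks for [q * N] small against [dl * r * D]. The cosine is periodic in the imaginary direction,
    so far away the excess [q ^+ 2 * N] must be absorbed by [kap * eta * D * modulus w]; this makes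
    [N * kap] of order [r * D]. Hence [q] is of order [kap * dl] and [eta] of order [kap * dl ^+ 2].
    All integrals are discrete: the Cauchy-Pompeiu formula is a summation by parts on a lattice, the
    Laplace integral of a Cauchy kernel a geometric series. The error of an approximation may be
    multiplied by a constant depending on the test sum, since it tends to 0; only the total mass of
    the kernels has to stay bounded. *)

Local Notation Re z := (@complex.Re _ (z : Cx _)).
Local Notation Im z := (@complex.Im _ (z : Cx _)).

Ltac pos := repeat match goal with
  | |- _ => assumption
  | |- is_true (0 <= _%:R) => rewrite ler0n
  | |- is_true (0 < _%:R) => rewrite ltr0n; done
  | |- is_true (0 <= _ * _) => apply: mulr_ge0
  | |- is_true (0 < _ * _) => apply: mulr_gt0
  | |- is_true (0 <= _^-1) => rewrite invr_ge0
  | |- is_true (0 < _^-1) => rewrite invr_gt0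
  | |- is_true (0 <= _ ^+ _) => apply: exprn_ge0
  | |- is_true (0 < _ ^+ _) => apply: exprn_gt0
  | |- is_true (0 <= _ + _) => apply: addr_ge0
  | |- is_true (0 < _ + _) => apply: addr_gt0
  | |- is_true (0 <= expR _) => apply: expR_ge0
  | |- is_true (0 < expR _) => apply: expR_gt0
  | |- _ => first [done | by apply: ltW]
  end.


(** * Arithmetic of the modulus and neighbourhoods in the plane *)

Section Modulus.
Variable R : realType.
Local Notation C := (Cx R).
Implicit Types (z w : C) (x y : R).

Definition rC x : C := x%:C.
Definition iC : C := 'i%C.

Lemma modulus_def z : modulus z = Num.sqrt (Re z ^+ 2 + Im z ^+ 2).
Proof. by rewrite /modulus normc_def. Qed.

Lemma norm_modulus z : `|z| = rC (modulus z).
Proof. by rewrite /modulus normc_def. Qed.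

Lemma CxP z w : Re z = Re w -> Im z = Im w -> z = w.
Proof. by case: z => a b; case: w => c d /= -> ->. Qed.

Lemma ReD z w : Re (z + w) = Re z + Re w. Proof. by case: z; case: w. Qed.
Lemma ImD z w : Im (z + w) = Im z + Im w. Proof. by case: z; case: w. Qed.
Lemma ReN z : Re (- z) = - Re z. Proof. by case: z. Qed.
Lemma ImN z : Im (- z) = - Im z. Proof. by case: z. Qed.
Lemma ReM z w : Re (z * w) = Re z * Re w - Im z * Im w.
Proof. by case: z; case: w. Qed.
Lemma ImM z w : Im (z * w) = Re z * Im w + Im z * Re w.
Proof. by case: z; case: w. Qed.
Lemma Re0 : Re (0 : C) = 0. Proof. by []. Qed.
Lemma Im0 : Im (0 : C) = 0. Proof. by []. Qed.
Lemma Re1 : Re (1 : C) = 1. Proof. by []. Qed.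
Lemma Im1 : Im (1 : C) = 0. Proof. by []. Qed.
Lemma RerC x : Re (rC x) = x. Proof. by []. Qed.
Lemma ImrC x : Im (rC x) = 0. Proof. by []. Qed.
Lemma ReiC : Re iC = 0. Proof. by []. Qed.
Lemma ImiC : Im iC = 1. Proof. by []. Qed.
Definition ReImE := (ReD, ImD, ReN, ImN, ReM, ImM, Re0, Im0, Re1, Im1, RerC, ImrC, ReiC, ImiC).

Lemma rCD x y : rC (x + y) = rC x + rC y. Proof. by rewrite /rC rmorphD. Qed.
Lemma rCM x y : rC (x * y) = rC x * rC y. Proof. by rewrite /rC rmorphM. Qed.
Lemma rCN x : rC (- x) = - rC x. Proof. by rewrite /rC rmorphN. Qed.
Lemma rCV x : rC x^-1 = (rC x)^-1. Proof. by rewrite /rC fmorphV. Qed.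
Lemma rC1 : rC 1 = 1. Proof. by []. Qed.
Lemma rCX x n : rC (x ^+ n) = rC x ^+ n. Proof. by rewrite /rC rmorphXn. Qed.
Lemma rC_nat n : rC n%:R = n%:R. Proof. by rewrite /rC rmorph_nat. Qed.
Lemma rC_inj : injective rC. Proof. by move=> x y []. Qed.
Lemma Re_sum (I : Type) (r : seq I) (F : I -> C) : Re (\sum_(i <- r) F i) = \sum_(i <- r) Re (F i).
Proof. by elim/big_ind2 : _ => // a b c d; rewrite ReD => <- <-. Qed.
Lemma Im_sum (I : Type) (r : seq I) (F : I -> C) : Im (\sum_(i <- r) F i) = \sum_(i <- r) Im (F i).
Proof. by elim/big_ind2 : _ => // a b c d; rewrite ImD => <- <-. Qed.

Lemma iC2 : iC * iC = -1.
Proof. by apply: CxP; rewrite !ReImE; ring. Qed.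

Lemma complexRI z : z = rC (Re z) + iC * rC (Im z).
Proof. by apply: CxP; rewrite !ReImE; ring. Qed.

Lemma modulus_ge0 z : 0 <= modulus z.
Proof. by rewrite modulus_def sqrtr_ge0. Qed.
Hint Resolve modulus_ge0 : core.

Lemma modulusM z w : modulus (z * w) = modulus z * modulus w.
Proof. by apply: rC_inj; rewrite rCM -!norm_modulus normrM. Qed.

Lemma modulusV z : modulus z^-1 = (modulus z)^-1.
Proof. by apply: rC_inj; rewrite rCV -!norm_modulus normfV. Qed.

Lemma modulusX z n : modulus (z ^+ n) = modulus z ^+ n.
Proof. by apply: rC_inj; rewrite rCX -!norm_modulus normrX. Qed.

Lemma modulusN z : modulus (- z) = modulus z.
Proof. by apply: rC_inj; rewrite -!norm_modulus normrN. Qed.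

Lemma modulus_distC z w : modulus (z - w) = modulus (w - z).
Proof. by rewrite -modulusN opprB. Qed.

Lemma modulusD z w : modulus (z + w) <= modulus z + modulus w.
Proof.
have := ler_normD z w.
by rewrite !norm_modulus -rCD lecE /= eqxx.
Qed.

Lemma modulusB z w : modulus (z - w) <= modulus z + modulus w.
Proof. by rewrite -(modulusN w) modulusD. Qed.

Lemma modulus_triangle z w u : modulus (z - u) <= modulus (z - w) + modulus (w - u).
Proof. by rewrite (_ : z - u = (z - w) + (w - u)) ?modulusD // addrA subrK. Qed.

Lemma modulus_subl z w : modulus z - modulus w <= modulus (z - w).
Proof. by rewrite lerBlDr -{1}(subrK w z) modulusD. Qed.

Lemma modulus_addl z w : modulus z - modulus w <= modulus (z + w).
Proof. by rewrite -(modulusN w) -{2}(opprK w) modulus_subl. Qed.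

Lemma modulus0 : modulus (0 : C) = 0.
Proof. by apply: rC_inj; rewrite -norm_modulus normr0. Qed.

Lemma modulus1 : modulus (1 : C) = 1.
Proof. by apply: rC_inj; rewrite -norm_modulus normr1. Qed.

Lemma modulus_eq0 z : (modulus z == 0) = (z == 0).
Proof.
apply/eqP/eqP => [h|->]; last exact: modulus0.
by apply/eqP; rewrite -normr_eq0 norm_modulus h.
Qed.

Lemma modulus_gt0 z : (0 < modulus z) = (z != 0).
Proof. by rewrite lt0r modulus_ge0 andbT modulus_eq0. Qed.

Lemma modulus_rC x : modulus (rC x) = `|x|.
Proof. by rewrite modulus_def !ReImE expr0n addr0 sqrtr_sqr. Qed.

Lemma modulus_iC : modulus iC = 1.
Proof. by rewrite modulus_def !ReImE expr0n expr1n add0r sqrtr1. Qed.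

Lemma modulus_sum (I : Type) (r : seq I) (P : pred I) (F : I -> C) :
  modulus (\sum_(i <- r | P i) F i) <= \sum_(i <- r | P i) modulus (F i).
Proof.
elim/big_ind2 : _ => [|a b c d ab cd|//]; first by rewrite modulus0.
by apply: le_trans (modulusD _ _) _; rewrite lerD.
Qed.

Lemma normRe_le z : `|Re z| <= modulus z.
Proof. by rewrite modulus_def -sqrtr_sqr ler_wsqrtr // lerDl sqr_ge0. Qed.
Lemma normIm_le z : `|Im z| <= modulus z.
Proof. by rewrite modulus_def -sqrtr_sqr ler_wsqrtr // lerDr sqr_ge0. Qed.
Lemma Re_le z : Re z <= modulus z.
Proof. exact: le_trans (ler_norm _) (normRe_le _). Qed.
Lemma modulus_le z : modulus z <= `|Re z| + `|Im z|.
Proof.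
rewrite {1}(complexRI z); apply: le_trans (modulusD _ _) _.
by rewrite modulusM modulus_iC mul1r !modulus_rC.
Qed.

Lemma modulus_sqr z : modulus z ^+ 2 = Re z ^+ 2 + Im z ^+ 2.
Proof. by rewrite modulus_def sqr_sqrtr // addr_ge0 // sqr_ge0. Qed.

Lemma modulus_le_sqr z x : 0 <= x -> Re z ^+ 2 + Im z ^+ 2 <= x ^+ 2 -> modulus z <= x.
Proof.
by move=> x0 h; rewrite modulus_def -(ger0_norm x0) -sqrtr_sqr ler_wsqrtr.
Qed.

Definition cconj z : C := (Re z) +i* (- Im z).
Lemma mul_cconj z : z * cconj z = rC (modulus z ^+ 2).
Proof. by rewrite modulus_sqr; apply: CxP; rewrite !ReImE /=; ring. Qed.
Lemma modulus_conj z : modulus (cconj z) = modulus z.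
Proof. by rewrite !modulus_def /= sqrrN. Qed.

Lemma Cx_ltE z w : (z < w) = (Im w == Im z) && (Re z < Re w).
Proof. exact: ltcE. Qed.
Lemma Cx_leE z w : (z <= w) = (Im w == Im z) && (Re z <= Re w).
Proof. exact: lecE. Qed.

Lemma nbhs_discP z (A : set C) :
  nbhs z A <-> exists2 r : R, 0 < r & disc z r `<=` A.
Proof.
split => [/nbhs_ballP[e /= e0 eA]|[r r0 rA]].
  (* The norm is complex-valued, so a ball has a complex radius; positivity makes its imaginary part
     vanish. *)
  have [er ei] : 0 < Re e /\ Im e = 0.
    by move: e0; rewrite Cx_ltE => /andP[/eqP].
  exists (Re e) => // w zw; apply: eA; rewrite -ball_normE /=.
  by rewrite norm_modulus Cx_ltE /= ei eqxx /= modulus_distC.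
apply/nbhs_ballP; exists (rC r); first by rewrite /= Cx_ltE /= eqxx.
move=> w; rewrite -ball_normE /= norm_modulus Cx_ltE => /andP[_ /=].
by rewrite modulus_distC => /rA.
Qed.

Lemma nbhs_disc z (r : R) : 0 < r -> nbhs z (disc z r).
Proof. by move=> r0; apply/nbhs_discP; exists r. Qed.

Lemma open_discP (A : set C) :
  open A <-> forall z, A z -> exists2 r : R, 0 < r & disc z r `<=` A.
Proof.
rewrite openE; split => h z /h; first by move=> /nbhs_discP.
by move=> ?; apply/nbhs_discP.
Qed.

Lemma cvgCP (u : nat -> C) (l : C) :
  u @ \oo --> l <->
  forall e : R, 0 < e -> exists N, forall n, (N <= n)%N -> modulus (u n - l) < e.
Proof.
split => [ul e e0|h].
  have := ul _ (nbhs_disc l e0).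
  by move=> [N _ hN]; exists N => n Nn; exact: (hN n Nn).
move=> A /nbhs_discP[e e0 eA]; have [N hN] := h e e0.
by exists N => // n /= Nn; apply: eA; exact: hN.
Qed.

End Modulus.
#[export] Hint Extern 0 (is_true (0 <= modulus _)) => exact: modulus_ge0 : core.

(** * Taylor estimates for the complex exponential *)

Section Cexp.
Variable R : realType.
Local Notation C := (Cx R).
Implicit Types (z w : C) (x y : R).

Lemma Re_cexp z : Re (cexp z) = expR (Re z) * cos (Im z). Proof. by []. Qed.
Lemma Im_cexp z : Im (cexp z) = expR (Re z) * sin (Im z). Proof. by []. Qed.

Lemma cexpD z w : cexp (z + w) = cexp z * cexp w.
Proof.
apply: (@CxP R); rewrite !(ReM, ImM, Re_cexp, Im_cexp, ReD, ImD) expRD ?cosD ?sinD /=; ring.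
Qed.

Lemma cexp0 : cexp 0 = 1 :> C.
Proof. by apply: (@CxP R); rewrite ?(Re_cexp, Im_cexp) !ReImE ?expR0 ?cos0 ?sin0 ?mul1r. Qed.

Lemma modulus_cexp z : modulus (cexp z) = expR (Re z).
Proof.
rewrite modulus_def Re_cexp Im_cexp !exprMn -mulrDr cos2Dsin2 mulr1 sqrtr_sqr.
by rewrite ger0_norm // expR_ge0.
Qed.

Lemma cexp_natM n z : cexp (n%:R * z) = cexp z ^+ n.
Proof.
elim: n => [|n ih]; first by rewrite mul0r cexp0 expr0.
by rewrite -natr1 mulrDl mul1r cexpD ih exprSr.
Qed.

Definition cexp_sum (N : nat) z : C := \sum_(0 <= n < N) z ^+ n / (n`!)%:R.



Lemma is_derive_mulr (f g : R -> R) (df dg t : R) : is_derive t 1 f df -> is_derive t 1 g dg ->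
  is_derive t 1 (fun s : R => f s * g s) (df * g t + f t * dg).
Proof.
move=> hf hg; apply: (is_derive_eq (is_deriveM hf hg)).
by rewrite /GRing.scale /= addrC [g t * _]mulrC.
Qed.

Lemma is_derive_subr (f g : R -> R) (df dg t : R) : is_derive t 1 f df -> is_derive t 1 g dg ->
  is_derive t 1 (fun s : R => f s - g s) (df - dg).
Proof. exact: is_deriveB. Qed.

Lemma is_derive_mulc (a : R) (g : R -> R) (dg t : R) : is_derive t 1 g dg ->
  is_derive t 1 (fun s : R => a * g s) (a * dg).
Proof.
move=> hg; apply: (is_derive_eq (is_derive_mulr (is_derive_cst a _ _) hg)).
by rewrite mul0r add0r.
Qed.

Lemma is_derive_scale (a t : R) : is_derive t 1 (fun s : R => s * a) a.
Proof.
have h := @is_deriveM R R id (cst a) t 1 1 0 (is_derive_id _ _) (is_derive_cst _ _ _).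
apply: (is_derive_eq h); by rewrite scaler0 add0r /GRing.scale /= mulr1.
Qed.

Lemma is_derive_expRM (a t : R) : is_derive t 1 (fun s : R => expR (s * a)) (a * expR (t * a)).
Proof.
have h := is_derive_scale a t.
by rewrite mulrC; exact: (is_derive1_comp (f := expR)).
Qed.

Lemma is_derive_cosM (a t : R) : is_derive t 1 (fun s : R => cos (s * a)) (- a * sin (t * a)).
Proof.
have h := is_derive_scale a t.
rewrite mulNr mulrC -mulNr; exact: (is_derive1_comp (f := cos)).
Qed.

Lemma is_derive_sinM (a t : R) : is_derive t 1 (fun s : R => sin (s * a)) (a * cos (t * a)).
Proof.
have h := is_derive_scale a t.
rewrite mulrC; exact: (is_derive1_comp (f := sin)).
Qed.

Lemma is_derive_expn (n : nat) (a t : R) :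
  is_derive t 1 (fun s : R => a * s ^+ n) (a * (n%:R * t ^+ n.-1)).
Proof.
have h := @is_deriveX R R id n t 1 1 (is_derive_id _ _).
have h2 := @is_deriveM R R (cst a) (id ^+ n) t 1 0 _ (is_derive_cst _ _ _) h.
rewrite (_ : (fun s : R => _) = cst a * id ^+ n); last first.
  by apply/funext => s; rewrite /= fctE /= exprfctE.
by apply: (is_derive_eq h2); rewrite scaler0 addr0 /GRing.scale /= mulr1.
Qed.

Lemma is_derive_polyn N (c : nat -> R) (t : R) :
  is_derive t 1 (fun s : R => \sum_(0 <= n < N.+1) c n / (n`!)%:R * s ^+ n)
    (\sum_(0 <= n < N) c n.+1 / (n`!)%:R * t ^+ n).
Proof.
elim: N => [|N ih].
  rewrite big_geq //.
  rewrite (_ : (fun s : R => _) = cst (c 0%N)); first exact: is_derive_cst.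
  by apply/funext => s; rewrite big_nat1 expr0 mulr1 divr1.
have h := is_deriveD ih (is_derive_expn N.+1 (c N.+1 / (N.+1`!)%:R) t).
rewrite (_ : (fun s : R => _) = (fun s : R => \sum_(0 <= n < N.+1) c n / (n`!)%:R * s ^+ n)
   \+ (fun s : R => (c N.+1 / (N.+1`!)%:R) * s ^+ N.+1)); last first.
  by apply/funext => s; rewrite big_nat_recr.
apply: (is_derive_eq h); rewrite big_nat_recr //=; congr (_ + _).
rewrite mulrA; congr (_ * _); rewrite -mulrA; congr (_ * _).
rewrite factS natrM invfM mulrC mulrA divff ?mul1r //.
Qed.

(** Monotonicity of [g - f]; this comparison takes the place of an integral remainder in
    [cexp_sum_bound]. *)
Lemma mvt_le (f g : R -> R) (df dg : R -> R) :
  (forall t : R, 0 <= t -> is_derive t 1 f (df t)) ->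
  (forall t : R, 0 <= t -> is_derive t 1 g (dg t)) ->
  (forall t : R, 0 <= t -> df t <= dg t) -> f 0 <= g 0 -> forall t : R, 0 <= t -> f t <= g t.
Proof.
move=> hf hg le0 le1 t t0.
have hD (s : R) : 0 <= s -> is_derive s 1 (g - f) (dg s - df s).
  by move=> s0; apply: is_deriveB; [exact: hg|exact: hf].
have h : (g - f) 0 <= (g - f) t.
  apply: (@ger0_derive1_ndecry _ (g - f) 0) => //.
  - move=> x; rewrite in_itv /= andbT => x0.
    exact: (@ex_derive _ _ _ _ _ _ _ (hD x (ltW x0))).
  - move=> x; rewrite in_itv /= andbT => x0; rewrite derive1E.
    rewrite (@derive_val _ _ _ _ _ _ _ (hD x (ltW x0))) subr_ge0.
    by apply: le0; exact: ltW.
  - apply: derivable_within_continuous => x; rewrite in_itv /= andbT => x0.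
    exact: (@ex_derive _ _ _ _ _ _ _ (hD x x0)).
move: h; rewrite /GRing.add /GRing.opp /= => h.
by rewrite -subr_ge0; apply: le_trans h; rewrite subr_ge0.
Qed.

(** Take for [u] the normalised conjugate of [z]. Complex estimates are thereby reduced to real
    functions, to which [mvt_le] applies. *)
Lemma modulus_le_Re z (b : R) :
  (forall u : C, modulus u = 1 -> Re (u * z) <= b) -> modulus z <= b.
Proof.
have [->|z0] := eqVneq z 0 => h.
  by have := h 1 (modulus1 R); rewrite modulus0 mulr0.
have m0 : 0 < modulus z by rewrite modulus_gt0.
have := h (rC (modulus z)^-1 * cconj z).
rewrite modulusM modulus_rC modulus_conj ger0_norm ?invr_ge0 // mulVf ?gt_eqF //.
move=> /(_ erefl); rewrite -mulrA [cconj z * z]mulrC mul_cconj -rCM RerC.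
by rewrite expr2 mulrA mulVf ?gt_eqF // mul1r.
Qed.

(** Induction on [N] along the ray from 0 to [z]: the derivative in [t] of the remainder of order
    [N.+1] at [t z] is [z] times the remainder of order [N]. *)
Lemma cexp_sum_bound N z :
  modulus (cexp z - cexp_sum N z) <= modulus z ^+ N / (N`!)%:R * expR (modulus z).
Proof.
elim: N z => [|N ih] z.
  rewrite /cexp_sum big_geq // subr0 expr0 divr1 mul1r modulus_cexp ler_expR.
  exact: Re_le.
apply: modulus_le_Re => u u1.
set x := modulus z; have x0 : 0 <= x := modulus_ge0 z.
have key : forall t : R, 0 <= t ->
  Re (u * (cexp (rC t * z))) - \sum_(0 <= n < N.+1) Re (u * z ^+ n) / (n`!)%:R * t ^+ n <=
  x ^+ N.+1 / (N.+1`!)%:R * t ^+ N.+1 * expR (t * x).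
  apply: (@mvt_le _ _ (fun t => Re (u * (z * cexp (rC t * z))) -
      \sum_(0 <= n < N) Re (u * z ^+ n.+1) / (n`!)%:R * t ^+ n)
    (fun t => x ^+ N.+1 / (N.+1`!)%:R * (N.+1%:R * t ^+ N) * expR (t * x) +
      x ^+ N.+1 / (N.+1`!)%:R * t ^+ N.+1 * (x * expR (t * x)))).
  - move=> t t0; apply: is_deriveB; last exact: is_derive_polyn.
    have -> : (fun t : R => Re (u * cexp (rC t * z))) =
      (fun t : R => expR (t * Re z) * (Re u * cos (t * Im z) - Im u * sin (t * Im z))).
      by apply/funext => s; rewrite ReM Re_cexp Im_cexp !ReImE !mul0r subr0 addr0; ring.
    have h := is_derive_mulr (is_derive_expRM (Re z) t)
      (is_derive_subr (is_derive_mulc (Re u) (is_derive_cosM (Im z) t)) (is_derive_mulc (Im u) (is_derive_sinM (Im z) t))).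
    apply: (is_derive_eq h); rewrite !ReM ImM Re_cexp Im_cexp !ReImE !mul0r subr0 addr0.
    ring.
  - move=> t t0; apply: is_derive_mulr; last exact: is_derive_expRM.
    exact: is_derive_expn.
  - move=> t t0.
    have -> : Re (u * (z * cexp (rC t * z))) - \sum_(0 <= n < N) Re (u * z ^+ n.+1) / (n`!)%:R * t ^+ n
        = Re (u * z * (cexp (rC t * z) - cexp_sum N (rC t * z))).
      rewrite mulrBr ReD ReN mulrA; congr (_ - _).
      rewrite /cexp_sum mulr_sumr Re_sum; apply: eq_bigr => n _.
      rewrite exprMn -rCX -rC_nat -rCV exprS.
      rewrite (_ : u * z * (rC (t ^+ n) * z ^+ n * rC (n`!%:R)^-1) =
        rC (t ^+ n * (n`!%:R)^-1) * (u * (z * z ^+ n))); last by rewrite rCM; ring.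
      by rewrite [RHS]ReM !ReImE mul0r subr0; ring.
    apply: le_trans (Re_le _) _; rewrite !modulusM u1 mul1r -/x.
    apply: (@le_trans _ _ (x * (modulus (rC t * z) ^+ N / (N`!)%:R * expR (modulus (rC t * z))))).
      exact: (ler_wpM2l x0 (ih _)).
    rewrite modulusM modulus_rC ger0_norm // -/x.
    rewrite -[leLHS]addr0; apply: lerD; last first.
      by rewrite !mulr_ge0 ?invr_ge0 ?exprn_ge0 ?expR_ge0.
    rewrite le_eqVlt; apply/orP; left; apply/eqP.
    rewrite factS natrM invfM exprMn exprS.
    have n0 : (N.+1%:R : R) != 0 by rewrite pnatr_eq0.
    have f0 : (N`!%:R : R) != 0 by rewrite pnatr_eq0 -lt0n fact_gt0.
    move: n0 f0; move: (N.+1%:R : R) (N`!%:R : R) => a b a0 b0.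
    by field; rewrite a0 b0.
  - rewrite mul0r cexp0 mulr1 big_nat_recl //= big1 ?addr0; last first.
      by move=> i _; rewrite expr0n mulr0.
    by rewrite expr0 fact0 divr1 !mulr1 subrr !mul0r expR0 expr0n /= mulr0 mulr1.
have := key 1 ler01; rewrite !mul1r expr1n mulr1 => h.
apply: le_trans h.
rewrite mulrBr ReD ReN lerD2l lerN2 /cexp_sum mulr_sumr Re_sum le_eqVlt; apply/orP; left; apply/eqP.
apply: eq_bigr => n _; rewrite expr1n mulr1 -rC_nat -rCV mulrA [RHS]ReM !ReImE mulr0 subr0 //.
Qed.

Lemma expn_fact_le_exp (x : R) N : 0 <= x -> x ^+ N / (N`!)%:R <= expR x.
Proof.
move=> x0; case: N => [|N]; first by rewrite expr0 divr1 -[leLHS]expR0 ler_expR.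
by apply: le_trans (expR_ge1Dxn N x0); rewrite lerDr.
Qed.

(** Since [(2 x) ^ N / N!] is at most [exp(2 x)], a geometric factor in [N] is gained for every [z],
    at the price of the constant 3 in the exponent. *)
Lemma cexp_sum_bound2 N z :
  modulus (cexp z - cexp_sum N z) <= (2%:R^-1) ^+ N * expR (3 * modulus z).
Proof.
apply: le_trans (cexp_sum_bound N z) _; set x := modulus z.
have x0 : 0 <= x by exact: modulus_ge0.
have h := @expn_fact_le_exp (2 * x) N.
have -> : 3 * x = 2 * x + x by ring.
rewrite expRD mulrA ler_wpM2r ?expR_ge0 //.
have := h (mulr_ge0 _ x0) => /(_ ltac:(by [])).
rewrite exprMn exprVn -mulrA => h2.
by rewrite -ler_pdivrMl ?invr_gt0 ?exprn_gt0 // invrK.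
Qed.

Lemma cexp_bound2 z : modulus (cexp z - 1 - z) <= modulus z ^+ 2 * expR (modulus z).
Proof.
have := cexp_sum_bound 2 z; rewrite /cexp_sum !big_nat_recr //= big_geq // add0r expr0 expr1.
rewrite divr1 invr1 mulr1 opprD addrA => h; apply: le_trans h _.
by rewrite ler_wpM2r ?expR_ge0 // ler_pdivrMr // ler_peMr ?exprn_ge0 // ler1n.
Qed.

End Cexp.

(** * Power series, analytic functions and uniform expansions of order two *)

Section Analytic.
Variable R : realType.
Local Notation C := (Cx R).
Implicit Types (z w : C) (x y : R) (G K : set C) (f g : C -> C).

Definition psum (u : nat -> C) (n : nat) : C := \sum_(0 <= k < n) u k.

Lemma cvgC_unique (u : nat -> C) (l m : C) : u @ \oo --> l -> u @ \oo --> m -> l = m.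
Proof.
move=> /cvgCP ul /cvgCP um; apply/eqP; rewrite -subr_eq0 -modulus_eq0.
apply/negPn/negP => n0.
have e0 : 0 < modulus (l - m) / 2 by rewrite divr_gt0 // lt0r n0 modulus_ge0.
have [N hN] := ul _ e0; have [M hM] := um _ e0.
have h1 := hN (maxn N M) (leq_maxl _ _); have h2 := hM (maxn N M) (leq_maxr _ _).
have := modulus_triangle l (u (maxn N M)) m; rewrite (modulus_distC l (u _)) => h.
by have := le_lt_trans h (ltrD h1 h2); rewrite -splitr ltxx.
Qed.

Lemma cvgC_le (u : nat -> C) (l m : C) (B : R) :
  u @ \oo --> l -> (forall n, modulus (u n - m) <= B) -> modulus (l - m) <= B.
Proof.
move=> /cvgCP ul hB; apply/ler_addgt0Pr => e e0.
have [N hN] := ul _ e0; have h := modulus_triangle l (u N) m.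
apply: le_trans h _; rewrite addrC lerD //; rewrite modulus_distC; apply/ltW; exact: hN.
Qed.

Lemma cvgC_lin (u v : nat -> C) (l m c : C) :
  u @ \oo --> l -> v @ \oo --> m -> (fun n => c * u n + v n) @ \oo --> c * l + m.
Proof.
move=> /cvgCP ul /cvgCP vm; apply/cvgCP => e e0.
have c0 : 0 < modulus c + 1 by rewrite ltr_wpDl.
have [N hN] := ul (e / 2 / (modulus c + 1)) ltac:(by rewrite !divr_gt0).
have [M hM] := vm (e / 2) ltac:(by rewrite divr_gt0).
exists (maxn N M) => n; rewrite geq_max => /andP[Nn Mn].
rewrite (_ : _ - _ = c * (u n - l) + (v n - m)); last by ring.
apply: le_lt_trans (modulusD _ _) _; rewrite [ltRHS]splitr modulusM.
apply: ler_ltD; last exact: hM.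
apply: (@le_trans _ _ ((modulus c + 1) * (e / 2 / (modulus c + 1)))).
  by apply: ler_pM => //; [rewrite lerDl|apply/ltW/hN].
by rewrite mulrC divfK // gt_eqF.
Qed.

Lemma cvgC_cst (c : C) : (fun _ : nat => c) @ \oo --> c.
Proof. exact: cvg_cst. Qed.

Lemma cvgC_squeeze (u : nat -> C) (l : C) (v : nat -> R) :
  (forall n, modulus (u n - l) <= v n) -> v @ \oo --> (0 : R) -> u @ \oo --> l.
Proof.
move=> h hv; apply/cvgCP => e e0.
have /cvgrPdist_lt/(_ e e0)[N _ hN] := hv.
exists N => n Nn; apply: le_lt_trans (h n) _; apply: le_lt_trans (ler_norm _) _.
by rewrite -normrN -sub0r; exact: hN.
Qed.

Lemma psum_abs_cvg (u : nat -> C) (b : nat -> R) (B : R) :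
  (forall n, modulus (u n) <= b n) -> (forall n, \sum_(0 <= k < n) b k <= B) ->
  exists2 l : C, psum u @ \oo --> l & modulus l <= B.
Proof.
move=> ub bB.
have cv (v : nat -> R) : (forall n, `|v n| <= b n) -> cvgn (series v).
  move=> vb; apply: normed_cvg; apply: nondecreasing_is_cvgn.
    apply: nondecreasing_series => *; exact: normr_ge0.
  exists B => _ [n _ <-]; apply: le_trans (bB n).
  by rewrite /series /=; apply: ler_sum_nat => k _; exact: vb.
have /cvg_ex[/= lr hr] := cv (fun n => Re (u n)) (fun n => le_trans (normRe_le _) (ub n)).
have /cvg_ex[/= li hi] := cv (fun n => Im (u n)) (fun n => le_trans (normIm_le _) (ub n)).
have cvg : psum u @ \oo --> (rC lr + iC R * rC li : C).
  apply/cvgCP => e e0.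
  have e2 : 0 < e / 2 by rewrite divr_gt0.
  have /cvgrPdist_lt/(_ _ e2)[N _ hN] := hr.
  have /cvgrPdist_lt/(_ _ e2)[M _ hM] := hi.
  exists (maxn N M) => n; rewrite geq_max => /andP[Nn Mn].
  apply: le_lt_trans (modulus_le _) _; rewrite [ltRHS]splitr.
  have := hN n Nn; have := hM n Mn; rewrite /series /psum /= => h1 h2.
  rewrite ReD ImD !ReN !ImN Re_sum Im_sum !ReImE.
  apply: ltrD; first by rewrite distrC !mul0r !mulr0 !subr0 addr0.
  by rewrite distrC !mul0r mul1r !add0r.
exists (rC lr + iC R * rC li) => //.
rewrite -[rC lr + _]subr0; apply: (cvgC_le cvg) => n; rewrite subr0.
apply: le_trans (modulus_sum _ _ _) _; apply: le_trans (bB n).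
by apply: ler_sum_nat => k _; exact: ub.
Qed.

Lemma geo_half_sum (n : nat) : \sum_(0 <= k < n) (2^-1 : R) ^+ k <= 2.
Proof.
have -> : \sum_(0 <= k < n) (2^-1 : R) ^+ k = 2 - 2 * 2^-1 ^+ n.
  elim: n => [|n ih]; first by rewrite big_geq // expr0 mulr1 subrr.
  by rewrite big_nat_recr //= ih exprS; field.
by rewrite lerBlDr lerDl mulr_ge0 // exprn_ge0 // invr_ge0.
Qed.

Lemma psum_half_cvg (u : nat -> C) (M : R) :
  (forall n, modulus (u n) <= M * 2^-1 ^+ n) ->
  exists2 l : C, psum u @ \oo --> l & modulus l <= 2 * M.
Proof.
move=> h; have M0 : 0 <= M.
  by have := h 0%N; rewrite expr0 mulr1; apply: le_trans.
apply: (psum_abs_cvg h) => n; rewrite -mulr_sumr mulrC ler_wpM2r //.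
exact: geo_half_sum.
Qed.

Lemma half_exp_cvg (M : R) : (fun n => M * 2^-1 ^+ n) @ \oo --> (0 : R).
Proof.
rewrite -[X in _ --> X](mulr0 M); apply: cvgM; first exact: cvg_cst.
by apply: cvg_expr; rewrite ger0_norm ?invf_lt1 ?ltr1n // invr_ge0.
Qed.

Definition pow_series (a : nat -> C) (h : C) : nat -> C := psum (fun k => a k * h ^+ k).

Lemma analytic_onP G f : analytic_on G f <->
  forall z, G z -> exists a : nat -> C, exists2 r : R, 0 < r &
    forall h, modulus h < r -> pow_series a h @ \oo --> f (z + h).
Proof.
rewrite unlock; split=> hf z Gz; have [a] := hf z Gz.
  move=> /nbhs_discP[r r0 hr]; exists a; exists r => // h hh.
  have := hr (z + h); rewrite /disc /= addrAC subrr add0r => /(_ hh).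
  by [].
move=> [r r0 hr]; exists a; apply/nbhs_discP; exists r => // w /hr.
by rewrite (addrC z) subrK.
Qed.

Lemma analytic_sub G H f : G `<=` H -> analytic_on H f -> analytic_on G f.
Proof. by move=> GH /analytic_onP hf; apply/analytic_onP => z /GH; exact: hf. Qed.

Lemma analytic_lin G f g c : analytic_on G f -> analytic_on G g ->
  analytic_on G (fun z => c * f z + g z).
Proof.
move=> /analytic_onP hf /analytic_onP hg; apply/analytic_onP => z Gz.
have [a [r r0 ha]] := hf z Gz; have [b [s s0 hb]] := hg z Gz.
exists (fun n => c * a n + b n); exists (Num.min r s); first by rewrite lt_min r0.
move=> h; rewrite lt_min => /andP[hr hs].
rewrite (_ : pow_series _ _ = fun n => c * pow_series a h n + pow_series b h n).
  by apply: cvgC_lin; [exact: ha|exact: hb].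
apply/funext => n; rewrite /pow_series /psum mulr_sumr -big_split /=.
by apply: eq_bigr => k _; ring.
Qed.

Lemma analytic_cst G c : analytic_on G (fun=> c).
Proof.
apply/analytic_onP => z _; exists (fun n => if n is 0 then c else 0); exists 1 => // h _.
apply/cvgCP => e e0; exists 1%N => -[//|n] _.
rewrite /pow_series /psum big_nat_recl // expr0 mulr1 big1 ?addr0 ?subrr ?modulus0 //.
by move=> i _; rewrite mul0r.
Qed.

Lemma analytic_translate G f (t : C) : analytic_on G f ->
  analytic_on [set z | G (z + t)] (fun z => f (z + t)).
Proof.
move=> /analytic_onP hf; apply/analytic_onP => z /= Gz.
have [a [r r0 ha]] := hf _ Gz; exists a; exists r; first exact: r0.
by move=> h hr; rewrite addrAC; exact: ha.
Qed.

Lemma analytic_cexp G (l : C) : analytic_on G (fun z => cexp (l * z)).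
Proof.
apply/analytic_onP => z _; exists (fun n => cexp (l * z) * (l ^+ n / (n`!)%:R)).
exists 1 => // h _.
apply: (@cvgC_squeeze _ _ (fun n => modulus (cexp (l * z)) * expR (3 * modulus (l * h)) * 2^-1 ^+ n)); last first.
  exact: half_exp_cvg.
move=> n; rewrite mulrDr cexpD.
have -> : pow_series (fun n => cexp (l * z) * (l ^+ n / (n`!)%:R)) h n =
    cexp (l * z) * cexp_sum n (l * h).
  rewrite /pow_series /psum /cexp_sum mulr_sumr; apply: eq_bigr => k _.
  by rewrite exprMn; ring.
rewrite -mulrBr [leLHS]modulusM modulus_distC -mulrA ler_wpM2l //.
by rewrite [leRHS]mulrC; exact: cexp_sum_bound2.
Qed.

Lemma analytic_inv G (p : C) : (forall z, G z -> z != p) -> analytic_on G (fun z => (p - z)^-1).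
Proof.
move=> hp; apply/analytic_onP => z /hp zp; set d := p - z.
have d0 : d != 0 by rewrite subr_eq0 eq_sym.
have md0 : 0 < modulus d by rewrite modulus_gt0.
exists (fun n => d ^- n.+1); exists (modulus d / 2); first by rewrite divr_gt0.
move=> h hh.
have dh0 : d - h != 0.
  rewrite -modulus_gt0; apply: lt_le_trans (modulus_subl _ _).
  by rewrite subr_gt0; apply: lt_trans hh _; rewrite ltr_pdivrMr // ltr_pMr // ltr1n.
apply: (@cvgC_squeeze _ _ (fun n => modulus (d - h)^-1 * 2^-1 ^+ n)); last exact: half_exp_cvg.
move=> n; rewrite opprD addrA -/d.
have -> : pow_series (fun n => d ^- n.+1) h n - (d - h)^-1 = - ((d - h)^-1 * (h / d) ^+ n).
  apply: (mulfI dh0); rewrite mulrN mulrA divff // mul1r mulrBr divff //.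
  elim: n => [|n ih]; first by rewrite /pow_series /psum big_geq // mulr0 sub0r expr0.
  rewrite /pow_series /psum big_nat_recr //= -/(psum _ n) -/(pow_series _ _ n) mulrDr.
  rewrite addrAC ih !exprMn !exprVn !exprS; field; by rewrite d0 expf_neq0.
rewrite modulusN modulusM modulusX ler_wpM2l // lerXn2r ?nnegrE ?invr_ge0 //.
by rewrite modulusM modulusV ler_pdivrMr // mulrC ltW.
Qed.


(** The coefficients are existential, so no complex derivative has to be introduced. The degree
    matches [Dh], which sees only the cubic remainder; a single [B] bounds everything, so
    compactness can make it uniform. *)
Definition taylor2 f z (r B : R) := exists c0 c1 c2 : C,
  [/\ modulus c0 <= B, modulus c1 <= B, modulus c2 <= B &
   forall h, modulus h < r -> modulus (f (z + h) - (c0 + c1 * h + c2 * h ^+ 2)) <= B * modulus h ^+ 3].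

Lemma taylor2_le f z (r s B D : R) : s <= r -> B <= D -> taylor2 f z r B -> taylor2 f z s D.
Proof.
move=> sr BD [c0 [c1 [c2 [h0 h1 h2 hh]]]]; exists c0, c1, c2; split.
- exact: le_trans BD.
- exact: le_trans BD.
- exact: le_trans BD.
- move=> h hs; apply: le_trans (hh h (lt_le_trans hs sr)) _.
  by rewrite ler_wpM2r // exprn_ge0.
Qed.

(** Multiplying an expansion by [x + h] gives recursions for the three coefficients and the
    remainder. Growth by [3 * rho] per step, instead of [rho], leaves room for the terms handed from
    one coefficient to the next and avoids binomial coefficients. *)
Lemma expn_taylor2 (x : C) (rho : R) : 0 < rho -> modulus x < rho ->
  exists al be ga : nat -> C, exists e : nat -> C -> C,
    [/\ forall n, modulus (al n) <= (3 * rho) ^+ n,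
        forall n, modulus (be n) <= (3 * rho) ^+ n / rho,
        forall n, modulus (ga n) <= (3 * rho) ^+ n / rho ^+ 2 &
        forall n h, modulus h < rho -> modulus (e n h) <= (3 * rho) ^+ n / rho ^+ 3 * modulus h ^+ 3 /\
          (x + h) ^+ n = al n + be n * h + ga n * h ^+ 2 + e n h].
Proof.
move=> r0 xr.
have r3 n : 0 <= (3 * rho) ^+ n by rewrite exprn_ge0 // mulr_ge0 // ltW.
have rn : rho != 0 by rewrite gt_eqF.
pose fix al n : C := if n is m.+1 then x * al m else 1.
pose fix be n : C := if n is m.+1 then x * be m + al m else 0.
pose fix ga n : C := if n is m.+1 then x * ga m + be m else 0.
pose fix e n : C -> C := if n is m.+1 then fun h => (x + h) * e m h + ga m * h ^+ 3 else fun=> 0.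
have hal n : modulus (al n) <= (3 * rho) ^+ n.
  elim: n => [|n ih] /=; first by rewrite modulus1 expr0.
  rewrite modulusM exprS; apply: ler_pM => //.
  by apply: le_trans (ltW xr) _; rewrite ler_peMl ?ltW // ltr1n.
have hbe n : modulus (be n) <= (3 * rho) ^+ n / rho.
  elim: n => [|n ih] /=; first by rewrite modulus0 expr0 mul1r invr_ge0 ltW.
  apply: le_trans (modulusD _ _) _; rewrite modulusM exprS.
  have -> : 3 * rho * (3 * rho) ^+ n / rho = rho * ((3 * rho) ^+ n / rho) + (3 * rho) ^+ n + (3 * rho) ^+ n.
    by field.
  rewrite -[leLHS]addr0; apply: lerD => //; apply: lerD => //.
  by apply: ler_pM => //; exact: ltW.
have hga n : modulus (ga n) <= (3 * rho) ^+ n / rho ^+ 2.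
  elim: n => [|n ih] /=; first by rewrite modulus0 expr0 mul1r invr_ge0 exprn_ge0 // ltW.
  apply: le_trans (modulusD _ _) _; rewrite modulusM exprS.
  have -> : 3 * rho * (3 * rho) ^+ n / rho ^+ 2 =
     rho * ((3 * rho) ^+ n / rho ^+ 2) + (3 * rho) ^+ n / rho + (3 * rho) ^+ n / rho.
    by field.
  rewrite -[leLHS]addr0; apply: lerD; last by rewrite divr_ge0 // ltW.
  by apply: lerD => //; apply: ler_pM => //; exact: ltW.
exists al, be, ga, e; split => // n h hr; split.
  elim: n => [|n ih] /=; first by rewrite modulus0 expr0 mul1r mulr_ge0 ?invr_ge0 ?exprn_ge0 // ltW.
  apply: le_trans (modulusD _ _) _; rewrite modulusM [modulus (ga n * _)]modulusM modulusX [_ ^+ n.+1]exprS.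
  have -> : 3 * rho * (3 * rho) ^+ n / rho ^+ 3 * modulus h ^+ 3 =
     (rho + rho) * ((3 * rho) ^+ n / rho ^+ 3 * modulus h ^+ 3) + (3 * rho) ^+ n / rho ^+ 2 * modulus h ^+ 3.
    by field.
  apply: lerD; last by rewrite ler_wpM2r // exprn_ge0.
  apply: ler_pM => //; apply: le_trans (modulusD _ _) _.
  by apply: lerD; exact: ltW.
elim: n => [|n ih] /=; first by rewrite expr0; ring.
rewrite exprS ih; ring.
Qed.

Lemma ler_half_pow (a b : R) n : 0 <= b -> a * (2 * b) ^+ n <= 1 -> a * b ^+ n <= 2^-1 ^+ n.
Proof.
move=> b0; rewrite exprMn exprVn => h.
rewrite -[leRHS]mul1r ler_pdivlMr ?exprn_gt0 //.
by rewrite -mulrA [b ^+ n * _]mulrC.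
Qed.

Lemma pow_series_coef_bound (a : nat -> C) (h l : C) : pow_series a h @ \oo --> l ->
  exists2 M, 0 < M & forall n, modulus (a n) * modulus h ^+ n <= M.
Proof.
move=> /cvgCP/(_ 1 ltr01)[N hN].
have [B hB] : exists B, forall n, (n < N)%N -> modulus (a n) * modulus h ^+ n <= B.
  elim: (N) => [|m [B hB]]; first by exists 0.
  exists (Num.max B (modulus (a m) * modulus h ^+ m)) => n.
  rewrite ltnS leq_eqVlt => /orP[/eqP ->|/hB hn]; rewrite le_max ?lexx ?orbT //.
  by rewrite hn.
exists (Num.max B 2); first by rewrite lt_max ltr0n orbT.
move=> n; rewrite le_max; have [Nn|nN] := leqP N n; last by rewrite hB.
apply/orP; right; rewrite -modulusX -modulusM.
have h1 := hN n Nn; have h2 := hN n.+1 (leqW Nn).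
have -> : a n * h ^+ n = (pow_series a h n.+1 - l) - (pow_series a h n - l).
  by rewrite /pow_series /psum big_nat_recr //=; ring.
apply: le_trans (modulusB _ _) _; rewrite (_ : 2 = 1 + 1 :> R) //.
by apply: lerD; exact: ltW.
Qed.

Lemma cvgCD (u v : nat -> C) (l m : C) :
  u @ \oo --> l -> v @ \oo --> m -> (fun n => u n + v n) @ \oo --> l + m.
Proof.
move=> hu hv; rewrite -[l]mul1r (_ : (fun n => _) = fun n => 1 * u n + v n).
  exact: cvgC_lin.
by apply/funext => n; rewrite mul1r.
Qed.

Lemma cvgCZ (u : nat -> C) (l c : C) : u @ \oo --> l -> (fun n => u n * c) @ \oo --> l * c.
Proof.
move=> hu; rewrite -[l * c]addr0 mulrC (_ : (fun n => _) = fun n => c * u n + 0).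
  exact: (@cvgC_lin u (fun=> 0) l 0 c hu (@cvgC_cst 0)).
by apply/funext => n; rewrite mulrC addr0.
Qed.

Lemma analytic_taylor2 G f z : analytic_on G f -> G z ->
  exists2 rho : R, 0 < rho & exists B : R, forall w, modulus (w - z) < rho -> taylor2 f w rho B.
Proof.
move=> /analytic_onP hf /hf [a [r r0 ha]].
have r20 : 0 < r / 2 by rewrite divr_gt0.
have [M M0 hM] : exists2 M, 0 < M & forall n, modulus (a n) * (r / 2) ^+ n <= M.
  have hr : modulus (rC (r / 2)) < r.
    by rewrite modulus_rC ger0_norm ?(ltW r20) // ltr_pdivrMr // ltr_pMr // ltr1n.
  have [M M0 hM] := pow_series_coef_bound (ha _ hr).
  by exists M => // n; have := hM n; rewrite modulus_rC ger0_norm // ltW.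
(* Chosen so that [2 * (3 * rho) = r / 2]: the coefficients weighted by [(3 * rho) ^+ n] then decay
   like [2^-1 ^+ n], and the re-expanded series converge. *)
pose rho := r / 12; have rho0 : 0 < rho by rewrite divr_gt0.
have e3 : 2 * (3 * rho) = r / 2 by rewrite /rho; field.
have haM n : modulus (a n) * (3 * rho) ^+ n <= M * 2^-1 ^+ n.
  have h1 : modulus (a n) / M * (2 * (3 * rho)) ^+ n <= 1.
    by rewrite e3 mulrAC ler_pdivrMr // mul1r.
  have h2 := ler_half_pow (mulr_ge0 (ler0n _ 3) (ltW rho0)) h1.
  by rewrite mulrAC ler_pdivrMr // in h2; rewrite [leRHS]mulrC.
exists rho => //.
exists (Num.max (2 * M) (Num.max (2 * (M / rho)) (Num.max (2 * (M / rho ^+ 2)) (2 * (M / rho ^+ 3))))).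
move=> w wz; have [al [be [ga [e [hal hbe hga he]]]]] := expn_taylor2 rho0 wz.
have hsum (u : nat -> C) (k : R) : 0 <= k -> (forall n, modulus (u n) <= (3 * rho) ^+ n * k) ->
    exists2 l : C, psum (fun n => a n * u n) @ \oo --> l & modulus l <= 2 * (M * k).
  move=> k0 hu; apply: psum_half_cvg => n; rewrite modulusM mulrAC.
  apply: le_trans (_ : modulus (a n) * ((3 * rho) ^+ n * k) <= _).
    by rewrite ler_wpM2l.
  by rewrite mulrA ler_wpM2r.
have i1 : 0 <= rho^-1 by rewrite invr_ge0 ltW.
have i2 : 0 <= (rho ^+ 2)^-1 by rewrite invr_ge0 exprn_ge0 // ltW.
have i3 : 0 <= (rho ^+ 3)^-1 by rewrite invr_ge0 exprn_ge0 // ltW.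
have [c0 cv0 b0] := hsum al 1 ler01 (fun n => ltac:(by rewrite mulr1; exact: hal)).
have [c1 cv1 b1] := hsum be _ i1 hbe.
have [c2 cv2 b2] := hsum ga _ i2 hga.
exists c0, c1, c2; rewrite !le_max; split.
- by rewrite mulr1 in b0; rewrite b0.
- by rewrite b1 orbT.
- by rewrite b2 !orbT.
move=> h hr.
have k0 : 0 <= (rho ^+ 3)^-1 * modulus h ^+ 3 by rewrite mulr_ge0 // exprn_ge0.
have he1 n : modulus (e n h) <= (3 * rho) ^+ n * ((rho ^+ 3)^-1 * modulus h ^+ 3).
  by rewrite mulrA; have [] := he n h hr.
have [c3 cv3 b3] := hsum (e ^~ h) _ k0 he1.
have wzh : modulus (w - z + h) < r.
  apply: le_lt_trans (modulusD _ _) _; apply: lt_trans (ltrD wz hr) _.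
  by rewrite /rho; lra.
have cv := ha _ wzh; rewrite addrA (addrC z) subrK in cv.
have cv' : pow_series a (w - z + h) @ \oo --> c0 + c1 * h + c2 * h ^+ 2 + c3.
  rewrite (_ : pow_series _ _ = fun n => psum (fun n => a n * al n) n + psum (fun n => a n * be n) n * h +
    psum (fun n => a n * ga n) n * h ^+ 2 + psum (fun n => a n * e n h) n).
    exact: (cvgCD (cvgCD (cvgCD cv0 (@cvgCZ _ _ h cv1)) (@cvgCZ _ _ (h ^+ 2) cv2)) cv3).
  apply/funext => n; rewrite /pow_series /psum !mulr_suml -!big_split /=; apply: eq_bigr => k _.
  by have [_ ->] := he k h hr; ring.
rewrite (cvgC_unique cv cv') addrAC subrr add0r; apply: le_trans b3 _.
rewrite (_ : 2 * _ = 2 * (M / rho ^+ 3) * modulus h ^+ 3); last by ring.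
by rewrite ler_wpM2r ?exprn_ge0 // !le_max lexx !orbT.
Qed.

Lemma taylor2_uniform G K f : open G -> compact K -> K `<=` G -> analytic_on G f ->
  exists2 rho : R, 0 < rho /\ rho <= 1 & exists2 B : R, 1 <= B & forall w, K w -> taylor2 f w rho B.
Proof.
move=> oG cK KG aG.
have := cK; rewrite compact_near_coveringP.
(* One index carries both the radius [1 / (n + 1)] and the bound [n + 1]; by [taylor2_le] the
   property persists as [n] grows, which is what the covering form of compactness needs. *)
move=> /(_ nat \oo (fun n w => taylor2 f w n.+1%:R^-1 n.+1%:R) _).
case.
  move=> z Kz; have [rho rho0 [B hB]] := analytic_taylor2 aG (KG z Kz).
  have [N hN] : exists N : nat, forall n, (N <= n)%N -> n.+1%:R^-1 <= rho /\ B <= n.+1%:R.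
    have [n1 h1] : exists n1 : nat, rho^-1 <= n1%:R.
      by exists (Num.truncn rho^-1).+1; exact/ltW/truncnS_gt.
    have [n2 h2] : exists n2 : nat, B <= n2%:R.
      by exists (Num.truncn B).+1; exact/ltW/truncnS_gt.
    exists (maxn n1 n2) => n; rewrite geq_max => /andP[nn1 nn2]; split.
      rewrite -[leRHS]invrK lef_pV2 ?posrE ?invr_gt0 //; apply: le_trans h1 _.
      by rewrite ler_nat leqW.
    by apply: le_trans h2 _; rewrite ler_nat leqW.
  exists (disc z rho, [set n | (N <= n)%N]).
    by split; [exact: nbhs_disc|exists N].
  move=> [w n] /= [wz /hN[h1 h2]]; exact: taylor2_le h1 h2 (hB _ wz).
move=> N _ hN; exists N.+1%:R^-1.
  by rewrite invr_gt0 ltr0n invf_le1 ?ltr0n // ler1n.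
by exists N.+1%:R; [rewrite ler1n|move=> w Kw; exact: (hN N (leqnn N))].
Qed.

Lemma taylor2_val f z (r B : R) : 0 < r -> taylor2 f z r B -> modulus (f z) <= B.
Proof.
move=> r0 [c0 [c1 [c2 [h0 _ _ hh]]]].
have := hh 0; rewrite modulus0 => /(_ r0); rewrite expr0n /= mulr0 addr0 expr0n /= !mulr0 !addr0.
move=> h; have : modulus (f z - c0) = 0 by apply/le_anti; rewrite h modulus_ge0.
by move/eqP; rewrite modulus_eq0 subr_eq0 => /eqP ->.
Qed.

Lemma taylor2_lip f z (r B : R) : 0 < r -> r <= 1 -> taylor2 f z r B ->
  forall h, modulus h < r -> modulus (f (z + h) - f z) <= 3 * B * modulus h.
Proof.
move=> r0 r1 [c0 [c1 [c2 [h0 h1 h2 hh]]]] h hr.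
have B0 : 0 <= B := le_trans (modulus_ge0 _) h0.
have m1 : modulus h <= 1 by apply/ltW/(lt_le_trans hr).
have fz : f z = c0.
  have := hh 0; rewrite modulus0 => /(_ r0); rewrite expr0n /= mulr0 addr0 expr0n /= !mulr0 !addr0.
  move=> k; have : modulus (f z - c0) = 0 by apply/le_anti; rewrite k modulus_ge0.
  by move/eqP; rewrite modulus_eq0 subr_eq0 => /eqP.
have -> : f (z + h) - f z = (f (z + h) - (c0 + c1 * h + c2 * h ^+ 2)) + (c1 * h + c2 * h ^+ 2).
  by rewrite fz; ring.
apply: le_trans (modulusD _ _) _; have -> : 3 * B * modulus h = B * modulus h + (B * modulus h + B * modulus h) by ring.
apply: lerD.
  apply: le_trans (hh h hr) _; rewrite ler_wpM2l // -[leRHS]expr1.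
  by apply: ler_wiXn2l.
apply: le_trans (modulusD _ _) _; rewrite modulusM [modulus (c2 * _)]modulusM modulusX; apply: lerD.
  by rewrite ler_wpM2r.
apply: ler_pM => //; first by rewrite exprn_ge0.
by rewrite -[leRHS]expr1; apply: ler_wiXn2l.
Qed.

End Analytic.

(** * Discrete d-bar calculus on a square lattice *)

Section Lattice.
Variable R : realType.
Local Notation C := (Cx R).
Implicit Types (z w : C) (x y : R) (f g : C -> C).

Lemma eq_leR x y : x = y -> x <= y. Proof. by move=> ->. Qed.

Definition latt (c : C) (a b : R) : C := c + rC a + iC R * rC b.

(* A discrete d-bar operator, scaled by [4 h]; it annihilates the polynomials of degree at most 2. *)
Definition Dh (h : R) g z : C :=
  g (z + rC h) - g (z - rC h) + iC R * (g (z + iC R * rC h) - g (z - iC R * rC h)).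

Lemma lattD c a b a' b' : latt (latt c a b) a' b' = latt c (a + a') (b + b').
Proof. by rewrite /latt !rCD; ring. Qed.

Lemma latt_re c a b h : latt c a b + rC h = latt c (a + h) b.
Proof. by rewrite /latt !rCD; ring. Qed.
Lemma latt_reN c a b h : latt c a b - rC h = latt c (a - h) b.
Proof. by rewrite /latt !rCD rCN; ring. Qed.
Lemma latt_im c a b h : latt c a b + iC R * rC h = latt c a (b + h).
Proof. by rewrite /latt !rCD; ring. Qed.
Lemma latt_imN c a b h : latt c a b - iC R * rC h = latt c a (b - h).
Proof. by rewrite /latt !rCD rCN; ring. Qed.
Definition lattE := (latt_re, latt_reN, latt_im, latt_imN).

Lemma Re_latt c a b : Re (latt c a b) = Re c + a.
Proof. by rewrite /latt !ReImE; ring. Qed.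
Lemma Im_latt c a b : Im (latt c a b) = Im c + b.
Proof. by rewrite /latt !ReImE; ring. Qed.

Lemma latt_sub c a b : latt c a b - c = latt 0 a b.
Proof. by rewrite /latt; ring. Qed.

Lemma taylor2_Dh g z (r B h : R) : 0 < h -> h < r -> taylor2 g z r B ->
  modulus (Dh h g z) <= 4 * B * h ^+ 3.
Proof.
move=> h0 hr [c0 [c1 [c2 [_ _ _ hh]]]].
have mh : modulus (rC h) = h by rewrite modulus_rC ger0_norm // ltW.
have e1 := hh (rC h); rewrite mh in e1; have {}e1 := e1 hr.
have e2 := hh (- rC h); rewrite modulusN mh in e2; have {}e2 := e2 hr.
have e3 := hh (iC R * rC h); rewrite modulusM modulus_iC mul1r mh in e3; have {}e3 := e3 hr.
have e4 := hh (- (iC R * rC h)); rewrite modulusN modulusM modulus_iC mul1r mh in e4; have {}e4 := e4 hr.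
set q := fun x : C => c0 + c1 * x + c2 * x ^+ 2.
have -> : Dh h g z = (g (z + rC h) - q (rC h)) - (g (z + - rC h) - q (- rC h)) +
   iC R * ((g (z + iC R * rC h) - q (iC R * rC h)) - (g (z + - (iC R * rC h)) - q (- (iC R * rC h)))).
  rewrite /Dh /q.
  set A := g _; set B1 := g _; set C1 := g _; set D1 := g _.
  have i2 := iC2 R; ring: i2.
apply: le_trans (modulusD _ _) _; rewrite modulusM modulus_iC mul1r.
have -> : 4 * B * h ^+ 3 = (B * h ^+ 3 + B * h ^+ 3) + (B * h ^+ 3 + B * h ^+ 3) by ring.
by apply: lerD; (apply: le_trans (modulusB _ _) _; apply: lerD).
Qed.

(** The constant is 3 + 3 + 3 + 1: the terms of degree at least three of the product of the two
    polynomials, each polynomial times the other remainder, and the product of the remainders. *)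
Lemma taylor2_mul f g z (r B D : R) : r <= 1 -> 0 < r ->
  taylor2 f z r B -> taylor2 g z r D -> taylor2 (fun x : C => f x * g x) z r (10 * (B * D)).
Proof.
move=> r1 r0 [a0 [a1 [a2 [ha0 ha1 ha2 ha]]]] [b0 [b1 [b2 [hb0 hb1 hb2 hb]]]].
have B0 : 0 <= B by exact: le_trans ha0.
have D0 : 0 <= D by exact: le_trans hb0.
have BD0 : 0 <= B * D by rewrite mulr_ge0.
have hM (x y : C) : modulus x <= B -> modulus y <= D -> modulus (x * y) <= B * D.
  by move=> hx hy; rewrite modulusM; apply: ler_pM.
exists (a0 * b0), (a0 * b1 + a1 * b0), (a0 * b2 + a1 * b1 + a2 * b0); split.
- by apply: le_trans (hM _ _ ha0 hb0) _; lra.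
- apply: le_trans (modulusD _ _) _.
  by have := hM _ _ ha0 hb1; have := hM _ _ ha1 hb0; lra.
- apply: le_trans (modulusD _ _) _.
  have := modulusD (a0 * b2) (a1 * b1).
  by have := hM _ _ ha0 hb2; have := hM _ _ ha1 hb1; have := hM _ _ ha2 hb0; lra.
move=> h hr; set k := modulus h.
have k0 : 0 <= k := modulus_ge0 h.
have k1 : k <= 1 by apply/ltW/(lt_le_trans hr).
have k3 : 0 <= k ^+ 3 by rewrite exprn_ge0.
have k31 : k ^+ 3 <= 1 by rewrite exprn_ile1.
set p := a0 + a1 * h + a2 * h ^+ 2; set q := b0 + b1 * h + b2 * h ^+ 2.
set u := f (z + h) - p; set v := g (z + h) - q.
have hu : modulus u <= B * k ^+ 3 := ha h hr.
have hv : modulus v <= D * k ^+ 3 := hb h hr.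
have pol (c0 c1 c2 : C) (E : R) : modulus c0 <= E -> modulus c1 <= E -> modulus c2 <= E ->
    modulus (c0 + c1 * h + c2 * h ^+ 2) <= 3 * E.
  move=> h0 h1 h2; apply: le_trans (modulusD _ _) _.
  have := modulusD c0 (c1 * h); rewrite !modulusM -/k => j1.
  have E0 : 0 <= E := le_trans (modulus_ge0 _) h0.
  have : modulus c1 * k <= E * 1 by apply: ler_pM.
  have : modulus c2 * (k * k) <= E * 1.
    by apply: ler_pM => //; [rewrite mulr_ge0|rewrite mulr_ile1].
  lra.
have hp : modulus p <= 3 * B by exact: pol.
have hq : modulus q <= 3 * D by exact: pol.
have -> : f (z + h) * g (z + h) - (a0 * b0 + (a0 * b1 + a1 * b0) * h + (a0 * b2 + a1 * b1 + a2 * b0) * h ^+ 2)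
   = (a1 * b2 + a2 * b1 + a2 * b2 * h) * h ^+ 3 + p * v + q * u + u * v.
  by rewrite /u /v /p /q; ring.
have j1 : modulus ((a1 * b2 + a2 * b1 + a2 * b2 * h) * h ^+ 3) <= 3 * (B * D) * k ^+ 3.
  rewrite modulusM modulusX -/k ler_wpM2r //.
  apply: le_trans (modulusD _ _) _; have := modulusD (a1 * b2) (a2 * b1).
  have := hM _ _ ha1 hb2; have := hM _ _ ha2 hb1.
  have : modulus (a2 * b2 * h) <= B * D * 1 by rewrite modulusM; apply: ler_pM => //; exact: hM.
  lra.
have j2 : modulus (p * v) <= 3 * B * (D * k ^+ 3) by rewrite modulusM; apply: ler_pM.
have j3 : modulus (q * u) <= 3 * D * (B * k ^+ 3) by rewrite modulusM; apply: ler_pM.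
have j4 : modulus (u * v) <= B * (D * k ^+ 3).
  rewrite modulusM; apply: ler_pM => //; apply: le_trans hu _.
  by rewrite ler_piMr.
apply: le_trans (modulusD _ _) _; have := modulusD ((a1 * b2 + a2 * b1 + a2 * b2 * h) * h ^+ 3 + p * v) (q * u).
have := modulusD ((a1 * b2 + a2 * b1 + a2 * b2 * h) * h ^+ 3) (p * v).
lra.
Qed.

(** The remainder of the geometric expansion is exactly [- h ^+ 3 / (x ^+ 3 * (x + h))] with
    [x = z - p], and [x + h] stays at distance [s / 2] from 0. *)
Lemma taylor2_inv (p : C) z (s : R) : 0 < s -> s <= 1 -> s <= modulus (z - p) ->
  taylor2 (fun x : C => (x - p)^-1) z (s / 2) (2 / s ^+ 4).
Proof.
move=> s0 s1 hz; set x := z - p.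
have x0 : x != 0 by rewrite -modulus_gt0; apply: lt_le_trans hz.
have ix : modulus x^-1 <= s^-1 by rewrite modulusV lef_pV2 ?posrE // modulus_gt0.
have s10 : 1 <= s^-1 by rewrite invf_ge1.
have e4 n : (n <= 4)%N -> s^-1 ^+ n <= 2 / s ^+ 4.
  move=> n4; apply: (@le_trans _ _ (s^-1 ^+ 4)); first by apply: ler_weXn2l.
  by rewrite exprVn; apply: ler_peMl; [rewrite invr_ge0 exprn_ge0 // ltW|rewrite ler1n].
have hn n : (n <= 4)%N -> modulus (x^-1 ^+ n) <= 2 / s ^+ 4.
  move=> n4; apply: le_trans (e4 n n4); by rewrite modulusX lerXn2r // nnegrE ?invr_ge0 ?(ltW s0).
exists (x^-1), (- x^-1 ^+ 2), (x^-1 ^+ 3); rewrite modulusN; split.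
- by have := hn 1%N isT; rewrite expr1.
- exact: hn.
- exact: hn.
move=> h hs; rewrite addrAC -/x.
have xh : s / 2 <= modulus (x + h).
  apply: le_trans (modulus_addl _ _); rewrite lerBrDr; apply: le_trans hz.
  by rewrite [leRHS]splitr lerD2l ltW.
have xh0 : x + h != 0 by rewrite -modulus_gt0; apply: lt_le_trans xh; rewrite divr_gt0.
have -> : (x + h)^-1 - (x^-1 + - x^-1 ^+ 2 * h + x^-1 ^+ 3 * h ^+ 2) = - (x^-1 ^+ 3 * (x + h)^-1 * h ^+ 3).
  by field; rewrite x0 xh0.
rewrite modulusN modulusM [modulus (h ^+ 3)]modulusX ler_wpM2r ?exprn_ge0 // modulusM modulusX.
rewrite (_ : 2 / s ^+ 4 = s^-1 ^+ 3 * (s / 2)^-1); last by field; rewrite gt_eqF.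
apply: ler_pM; rewrite ?exprn_ge0 //; first by rewrite lerXn2r // nnegrE ?invr_ge0 ?(ltW s0).
by rewrite modulusV lef_pV2 ?posrE ?divr_gt0 // modulus_gt0.
Qed.

Lemma sum_window (F : nat -> C) a L n : (a + L <= n)%N ->
  \sum_(0 <= i < n) (if (a <= i < a + L)%N then F i else 0) = \sum_(0 <= i < L) F (a + i)%N.
Proof.
move=> aLn; rewrite (big_cat_nat (leq0n a)) ?(leq_trans (leq_addr _ _) aLn) //=.
rewrite [X in X + _]big_nat_cond [X in X + _]big1 ?add0r; last first.
  by move=> i; rewrite andbT => /andP[_ ia]; rewrite leqNgt ia.
rewrite (big_cat_nat (leq_addr L a)) //= [X in _ + X]big_nat_cond [X in _ + X]big1 ?addr0; last first.
  by move=> i; rewrite andbT => /andP[ia _]; rewrite [(i < _)%N]ltnNge ia andbF.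
rewrite -{1}(add0n a) big_addn addnC addnK big_nat_cond [RHS]big_nat_cond.
apply: eq_bigr => i; rewrite andbT => /andP[_ iL].
by rewrite leq_addl ltn_add2r iL addnC.
Qed.

(** A central difference skips a node, so two boundary terms survive at each end; this is why
    [contour] has two layers. *)
Lemma tele2 (phi : R -> C) (a h : R) (n : nat) :
  \sum_(0 <= i < n) (phi (a + h * i%:R + h) - phi (a + h * i%:R - h)) =
  phi (a + h * n%:R) + phi (a + h * n%:R - h) - phi a - phi (a - h).
Proof.
elim: n => [|n ih]; first by rewrite big_geq // mulr0 addr0; ring.
rewrite big_nat_recr //= ih -natr1.
have -> : a + h * (n%:R + 1) = a + h * n%:R + h by ring.
have -> : a + h * n%:R + h - h = a + h * n%:R by ring.
by ring.
Qed.

(** The two sums together telescope, and the four vanishing conditions kill the two boundary layers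
    at both ends. *)
Lemma parts1 (phi psi : R -> C) (h : R) (n : nat) :
  phi (- h) = 0 -> phi 0 = 0 -> phi (h * n%:R - h) = 0 -> phi (h * n%:R) = 0 ->
  \sum_(0 <= i < n) phi (h * i%:R) * (psi (h * i%:R + h) - psi (h * i%:R - h)) =
  - \sum_(0 <= i < n) (phi (h * i%:R + h) - phi (h * i%:R - h)) * psi (h * i%:R).
Proof.
move=> h1 h2 h3 h4; apply/eqP; rewrite -subr_eq0 opprK -big_split /=.
suff -> : \sum_(0 <= i < n) (phi (h * i%:R) * (psi (h * i%:R + h) - psi (h * i%:R - h)) +
     (phi (h * i%:R + h) - phi (h * i%:R - h)) * psi (h * i%:R)) =
   phi (h * n%:R - h) * psi (h * n%:R) + phi (h * n%:R) * psi (h * n%:R - h)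
   - phi (- h) * psi 0 - phi 0 * psi (- h).
  by rewrite h1 h2 h3 h4 !mul0r !subr0 addr0.
elim: {h3 h4} n => [|n ih]; first by rewrite big_geq // mulr0 sub0r; ring.
rewrite big_nat_recr //= ih -natr1.
have -> : h * (n%:R + 1) = h * n%:R + h by ring.
have -> : h * n%:R + h - h = h * n%:R by ring.
by ring.
Qed.

Lemma Dh_latt h g c a b : Dh h g (latt c a b) =
  (g (latt c (a + h) b) - g (latt c (a - h) b)) + iC R * (g (latt c a (b + h)) - g (latt c a (b - h))).
Proof. by rewrite /Dh !lattE. Qed.

(** This is [parts1] in each of the two lattice directions; the support condition supplies its
    vanishing conditions. *)
Lemma Dh_parts (chi g : C -> C) (c : C) (h : R) (n : nat) :
  (forall a b, chi (latt c a b) != 0 -> 0 < a < h * n%:R - h /\ 0 < b < h * n%:R - h) -> 0 < h ->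
  \sum_(0 <= i < n) \sum_(0 <= j < n) chi (latt c (h * i%:R) (h * j%:R)) * Dh h g (latt c (h * i%:R) (h * j%:R)) =
  - \sum_(0 <= i < n) \sum_(0 <= j < n) Dh h chi (latt c (h * i%:R) (h * j%:R)) * g (latt c (h * i%:R) (h * j%:R)).
Proof.
move=> hchi h0.
have z1 a b : ~~ (0 < a < h * n%:R - h) -> chi (latt c a b) = 0.
  by move=> hn; apply/eqP/negPn/negP => /hchi[ha _]; rewrite ha in hn.
have z2 a b : ~~ (0 < b < h * n%:R - h) -> chi (latt c a b) = 0.
  by move=> hn; apply/eqP/negPn/negP => /hchi[_ ha]; rewrite ha in hn.
have c1 : ~~ (0 < - h < h * n%:R - h) by rewrite oppr_gt0 ltNge (ltW h0).
have c2 : ~~ (0 < (0 : R) < h * n%:R - h) by rewrite ltxx.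
have c3 : ~~ (0 < h * n%:R - h < h * n%:R - h) by rewrite ltxx andbF.
have c4 : ~~ (0 < h * n%:R < h * n%:R - h) by rewrite andbC ltNge gerBl (ltW h0).
transitivity (\sum_(0 <= i < n) \sum_(0 <= j < n)
   chi (latt c (h * i%:R) (h * j%:R)) * (g (latt c (h * i%:R + h) (h * j%:R)) - g (latt c (h * i%:R - h) (h * j%:R))) +
   iC R * \sum_(0 <= i < n) \sum_(0 <= j < n)
   chi (latt c (h * i%:R) (h * j%:R)) * (g (latt c (h * i%:R) (h * j%:R + h)) - g (latt c (h * i%:R) (h * j%:R - h)))).
  rewrite mulr_sumr -big_split /=; apply: eq_bigr => i _; rewrite mulr_sumr -big_split /=.
  by apply: eq_bigr => j _; rewrite Dh_latt; ring.
transitivity (- (\sum_(0 <= i < n) \sum_(0 <= j < n)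
   (chi (latt c (h * i%:R + h) (h * j%:R)) - chi (latt c (h * i%:R - h) (h * j%:R))) * g (latt c (h * i%:R) (h * j%:R))) +
   iC R * - \sum_(0 <= i < n) \sum_(0 <= j < n)
   (chi (latt c (h * i%:R) (h * j%:R + h)) - chi (latt c (h * i%:R) (h * j%:R - h))) * g (latt c (h * i%:R) (h * j%:R))).
  congr (_ + _ * _).
    rewrite exchange_big [in RHS]exchange_big -sumrN /=; apply: eq_bigr => j _.
    by apply: (@parts1 (fun a => chi (latt c a (h * j%:R))) (fun a => g (latt c a (h * j%:R))) h n); apply: z1.
  rewrite -sumrN /=; apply: eq_bigr => i _.
  by apply: (@parts1 (fun a => chi (latt c (h * i%:R) a)) (fun a => g (latt c (h * i%:R) a)) h n); apply: z2.
rewrite mulrN -opprD; congr (- _).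
rewrite mulr_sumr -big_split /=; apply: eq_bigr => i _; rewrite mulr_sumr -big_split /=.
by apply: eq_bigr => j _; rewrite Dh_latt; ring.
Qed.

(** A discrete analogue of [-2i / h] times the counterclockwise integral of [g] over a square about
    [c], each side being taken on the two layers at distances [a] and [b]. *)
Definition contour (c : C) (h : R) (m : nat) g : C :=
  let a := h * m%:R in let b := h * m.+1%:R in
  \sum_(0 <= j < m.*2.+1) (g (latt c b (h * j%:R - a)) + g (latt c a (h * j%:R - a))
     - g (latt c (- a) (h * j%:R - a)) - g (latt c (- b) (h * j%:R - a))) +
  iC R * \sum_(0 <= i < m.*2.+1) (g (latt c (h * i%:R - a) b) + g (latt c (h * i%:R - a) a)
     - g (latt c (h * i%:R - a) (- a)) - g (latt c (h * i%:R - a) (- b))).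

Lemma contourE c h m g :
  \sum_(0 <= i < m.*2.+1) \sum_(0 <= j < m.*2.+1) Dh h g (latt c (h * i%:R - h * m%:R) (h * j%:R - h * m%:R)) =
  contour c h m g.
Proof.
set a := h * m%:R; set b := h * m.+1%:R.
have e1 : - a + h * m.*2.+1%:R = b by rewrite /a /b -!natr1 -muln2 natrM; ring.
have e2 : b - h = a by rewrite /a /b -natr1; ring.
have e3 : - a - h = - b by rewrite -e2; ring.
transitivity (\sum_(0 <= i < m.*2.+1) \sum_(0 <= j < m.*2.+1)
   (g (latt c (h * i%:R - a + h) (h * j%:R - a)) - g (latt c (h * i%:R - a - h) (h * j%:R - a))) +
   iC R * \sum_(0 <= i < m.*2.+1) \sum_(0 <= j < m.*2.+1)
   (g (latt c (h * i%:R - a) (h * j%:R - a + h)) - g (latt c (h * i%:R - a) (h * j%:R - a - h)))).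
  rewrite mulr_sumr -big_split /=; apply: eq_bigr => i _; rewrite mulr_sumr -big_split /=.
  by apply: eq_bigr => j _; rewrite Dh_latt.
rewrite /contour -/a -/b; congr (_ + _ * _).
  rewrite exchange_big /=; apply: eq_bigr => j _.
  have := @tele2 (fun x => g (latt c x (h * j%:R - a))) (- a) h m.*2.+1.
  rewrite e1 e2 e3 => <-; apply: eq_bigr => i _.
  by rewrite (addrC (- a)).
apply: eq_bigr => i _.
have := @tele2 (fun x => g (latt c (h * i%:R - a) x)) (- a) h m.*2.+1.
rewrite e1 e2 e3 => <-; apply: eq_bigr => j _.
by rewrite (addrC (- a)).
Qed.

Lemma latt_bd (a b lo hi : R) : lo <= `|a| <= hi -> `|b| <= hi ->
  lo <= modulus (latt 0 a b) <= 2 * hi /\ lo <= modulus (latt 0 b a) <= 2 * hi.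
Proof.
move=> /andP[la ah] bh.
have e1 x y : Re (latt 0 x y) = x by rewrite Re_latt Re0 add0r.
have e2 x y : Im (latt 0 x y) = y by rewrite Im_latt Im0 add0r.
have n1 := normRe_le (latt 0 a b); rewrite e1 in n1.
have n2 := normIm_le (latt 0 b a); rewrite e2 in n2.
have n3 := modulus_le (latt 0 a b); rewrite e1 e2 in n3.
have n4 := modulus_le (latt 0 b a); rewrite e1 e2 in n4.
split; apply/andP; split; lra.
Qed.

(** All nodes of both layers lie in the annulus of the hypothesis; each of the two sums has four
    terms per index, whence 8. *)
Lemma contour_dist c h m g1 g2 (A : R) : 0 < h ->
  (forall z, h * m%:R <= modulus (z - c) <= 2 * (h * m.+1%:R) -> modulus (g1 z - g2 z) <= A) ->
  modulus (contour c h m g1 - contour c h m g2) <= 8 * m.*2.+1%:R * A.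
Proof.
move=> h0 hA; rewrite /contour; set a := h * m%:R; set b := h * m.+1%:R.
have a0 : 0 <= a by rewrite mulr_ge0 // ltW.
have ab : a <= b by rewrite ler_wpM2l ?ler_nat // ltW.
have sumB n (F G : nat -> C) : (forall i, (i < n)%N -> modulus (F i - G i) <= 4 * A) ->
    modulus (\sum_(0 <= i < n) F i - \sum_(0 <= i < n) G i) <= 4 * n%:R * A.
  move=> hFG; rewrite -sumrB; apply: le_trans (modulus_sum _ _ _) _.
  apply: (@le_trans _ _ (\sum_(0 <= i < n) 4 * A)).
    by rewrite big_nat_cond [leRHS]big_nat_cond; apply: ler_sum => i; rewrite andbT => /andP[_ /hFG].
  by rewrite sumr_const_nat subn0 -mulr_natr; apply: eq_leR; ring.
have four (x1 x2 x3 x4 y1 y2 y3 y4 : C) : modulus (x1 - y1) <= A -> modulus (x2 - y2) <= A ->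
   modulus (x3 - y3) <= A -> modulus (x4 - y4) <= A ->
   modulus ((x1 + x2 - x3 - x4) - (y1 + y2 - y3 - y4)) <= 4 * A.
  move=> k1 k2 k3 k4.
  rewrite (_ : _ - _ = ((x1 - y1) + (x2 - y2)) - ((x3 - y3) + (x4 - y4))); last by ring.
  apply: le_trans (modulusB _ _) _.
  have := modulusD (x1 - y1) (x2 - y2); have := modulusD (x3 - y3) (x4 - y4); lra.
have bd i : (i < m.*2.+1)%N -> `|h * i%:R - a| <= b.
  move=> im; rewrite ler_norml; apply/andP; split.
    by rewrite lerNl opprB lerBlDr; apply: le_trans ab _; rewrite lerDl mulr_ge0 ?ler0n ?(ltW h0).
  rewrite lerBlDr -mulrDr ler_wpM2l ?(ltW h0) // -natrD ler_nat addSn addnn.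
  exact: ltnW.
have nb : a <= `|b| <= b by rewrite ger0_norm ?(le_trans a0) // ab lexx.
have nbN : a <= `|- b| <= b by rewrite normrN.
have na : a <= `|a| <= b by rewrite ger0_norm // ab lexx.
have naN : a <= `|- a| <= b by rewrite normrN.
have pt x y : a <= `|x| <= b -> `|y| <= b -> modulus (g1 (latt c x y) - g2 (latt c x y)) <= A /\
    modulus (g1 (latt c y x) - g2 (latt c y x)) <= A.
  by move=> hx hy; have [k1 k2] := latt_bd hx hy; split; apply: hA; rewrite latt_sub.
rewrite opprD addrACA -mulrBr; apply: le_trans (modulusD _ _) _.
rewrite modulusM modulus_iC mul1r (_ : 8 * _ * A = 4 * m.*2.+1%:R * A + 4 * m.*2.+1%:R * A); last by ring.
apply: lerD; apply: sumB => i im; apply: four.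
- by have [] := pt _ _ nb (bd i im).
- by have [] := pt _ _ na (bd i im).
- by have [] := pt _ _ naN (bd i im).
- by have [] := pt _ _ nbN (bd i im).
- by have [] := pt _ _ nb (bd i im).
- by have [] := pt _ _ na (bd i im).
- by have [] := pt _ _ naN (bd i im).
- by have [] := pt _ _ nbN (bd i im).
Qed.

Lemma invC_conj z : z^-1 = rC (modulus z ^+ 2)^-1 * cconj z.
Proof.
have [->|z0] := eqVneq z 0.
  by rewrite invr0; apply: CxP; rewrite !ReImE /=; ring.
apply: (mulfI z0); rewrite divff // mulrCA mul_cconj -rCM mulVf //.
by rewrite expf_neq0 // modulus_eq0.
Qed.

Lemma Re_inv z : Re z^-1 = Re z / modulus z ^+ 2.
Proof. by rewrite invC_conj !ReImE /= mul0r subr0 mulrC. Qed.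
Lemma Im_inv z : Im z^-1 = - Im z / modulus z ^+ 2.
Proof. by rewrite invC_conj !ReImE /= mul0r addr0 mulrC. Qed.

(* The normalising constant of the discrete Cauchy formula, a substitute for [2 pi i]. *)
Lemma contour_inv_ge1 c h m : 0 < h -> (0 < m)%N ->
  1 <= Re (rC h * contour c h m (fun z => (z - c)^-1)).
Proof.
move=> h0 m0; rewrite /contour; set a := h * m%:R; set b := h * m.+1%:R.
have a0 : 0 < a by rewrite mulr_gt0 // ltr0n.
have b0 : 0 < b by rewrite mulr_gt0 // ltr0n.
pose q (x y : R) := x / (x ^+ 2 + y ^+ 2).
have q0 x y : 0 <= x -> 0 <= q x y.
  by move=> x0; rewrite /q divr_ge0 // addr_ge0 // sqr_ge0.
have rq x y : Re ((latt c x y - c)^-1) = q x y.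
  by rewrite latt_sub Re_inv modulus_sqr Re_latt Im_latt Re0 Im0 !add0r.
have iq x y : Im ((latt c x y - c)^-1) = - q y x.
  by rewrite latt_sub Im_inv modulus_sqr Re_latt Im_latt Re0 Im0 !add0r /q mulNr addrC.
have qN x y : q (- x) y = - q x y by rewrite /q sqrrN mulNr.
rewrite !(ReM, ImM, ReD, RerC, ImrC, ReiC, ImiC) mul0r mul0r subr0 mul1r sub0r Re_sum Im_sum -sumrN -big_split /=.
(* All contributions to the real part are nonnegative. Those of one side on the inner layer suffice:
   there [a / (a ^+ 2 + y ^+ 2)] is at least [1 / (2 * a)], and the [2m + 1] nodes give
   [(2m + 1) / (2m)]. *)
apply: (@le_trans _ _ (h * \sum_(0 <= i < m.*2.+1) (2 * a)^-1)).
  have -> : h * \sum_(0 <= i < m.*2.+1) (2 * a)^-1 = 2^-1 * (m.*2.+1%:R / m%:R).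
    have mn : (m%:R : R) != 0 by rewrite pnatr_eq0 -lt0n.
    rewrite sumr_const_nat subn0 -[_ *+ m.*2.+1]mulr_natr /a; move: (m.*2.+1%:R : R) => M.
    by move: mn; move: (m%:R : R) => k k0; field; rewrite k0 gt_eqF.
  have -> : (m.*2.+1%:R : R) = 2 * m%:R + 1 by rewrite -addn1 natrD -muln2 natrM mulrC.
  have mn : (m%:R : R) != 0 by rewrite pnatr_eq0 -lt0n.
  have -> : (2 * m%:R + 1) / m%:R = 2 + (m%:R : R)^-1.
    by move: mn; move: (m%:R : R) => k k0; field.
  have : 0 <= (m%:R : R)^-1 by rewrite invr_ge0 ler0n.
  lra.
rewrite (ler_pM2l h0); apply: ler_sum_nat => i /andP[_ im].
rewrite !(ReD, ImD, ReN, ImN) !rq !iq !qN.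
have qa : (2 * a)^-1 <= q a (h * i%:R - a).
  have hy : (h * i%:R - a) ^+ 2 <= a ^+ 2.
    rewrite -real_normK ?num_real // lerXn2r ?nnegrE ?(ltW a0) // ler_norml; apply/andP; split.
      by rewrite lerBrDr addNr mulr_ge0 // ltW.
    rewrite lerBlDr -mulrDr ler_wpM2l ?(ltW h0) // -natrD ler_nat addnn.
    by rewrite -ltnS.
  rewrite /q; apply: (@le_trans _ _ (a / (a ^+ 2 + a ^+ 2))).
    have ea x : x != 0 -> (2 * x)^-1 = x / (x ^+ 2 + x ^+ 2).
      by move=> x0; rewrite (_ : x ^+ 2 + x ^+ 2 = 2 * x * x); [field|ring].
    by rewrite ea // gt_eqF.
  rewrite ler_wpM2l ?(ltW a0) // lef_pV2 ?posrE ?lerD2l //.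
    by rewrite addr_gt0 // exprn_gt0.
  by apply: ltr_wpDr; rewrite ?sqr_ge0 // exprn_gt0.
have := q0 b (h * i%:R - a) (ltW b0); have := q0 a (h * i%:R - a) (ltW a0).
lra.
Qed.

End Lattice.

(** * A discrete Cauchy-Pompeiu formula with error bound *)

Lemma window_end (v m : nat) : (m <= v)%N -> (v - m + m.*2.+1 = v + m + 1)%N.
Proof. by lia. Qed.

Lemma leq_addsub (v m k : nat) : (v - m <= k)%N -> (v <= k + m)%N.
Proof. by lia. Qed.

Lemma ltn_addsub (v m k : nat) : (k < v - m)%N -> (k + m + 1 <= v)%N.
Proof. by lia. Qed.

Section Cauchy.
Variable R : realType.
Local Notation C := (Cx R).
Implicit Types (z w p c : C) (x y h s e B : R) (f g : C -> C) (P G : set C).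

Lemma ler_sum_cst (F : nat -> R) (x : R) n : (forall i, F i <= x) -> \sum_(0 <= i < n) F i <= n%:R * x.
Proof.
move=> h; elim: n => [|n ih]; first by rewrite big_geq // mul0r.
by rewrite big_nat_recr //= -natr1 mulrDl mul1r lerD.
Qed.

Definition dist P z : R := inf [set modulus (z - p) | p in P].

Lemma dist_le P z p : P p -> dist P z <= modulus (z - p).
Proof.
move=> Pp; apply: ge_inf; last by exists p.
by exists 0 => _ [q _ <-].
Qed.

Lemma dist_lt P z x : P !=set0 -> dist P z < x -> exists2 p, P p & modulus (z - p) < x.
Proof.
move=> [p0 Pp0] dx.
have hi : has_inf [set modulus (z - p) | p in P].
  by split; [exists (modulus (z - p0)), p0|exists 0 => _ [q _ <-]].
have e0 : 0 < x - dist P z by rewrite subr_gt0.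
have [_ [p Pp <-]] := inf_adherent e0 hi.
move=> pl; exists p => //; move: pl; rewrite -/(dist P z); lra.
Qed.

Lemma dist_lip P z w : P !=set0 -> dist P z <= dist P w + modulus (z - w).
Proof.
move=> P0; apply/ler_addgt0Pr => x x0.
have [p Pp pw] : exists2 p, P p & modulus (w - p) < dist P w + x.
  by apply: dist_lt => //; rewrite ltrDl.
apply: le_trans (dist_le z Pp) _; apply: le_trans (modulus_triangle z w p) _.
by rewrite addrC addrAC lerD2r ltW.
Qed.

Lemma latt_continuous : continuous (fun q : C * (R * R) => latt q.1 q.2.1 q.2.2).
Proof.
move=> [p [x y]] A /nbhs_discP[e e0 eA].
have e3 : 0 < e / 3 by rewrite divr_gt0.
exists (disc p (e / 3), [set q : R * R | `|x - q.1| < e / 3 /\ `|y - q.2| < e / 3]).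
  split; first exact: nbhs_disc.
  exists ([set u | `|x - u| < e / 3], [set u | `|y - u| < e / 3]).
    by split; apply: (@nbhsx_ballx R R _ _ e3).
  by move=> [u v].
move=> [q [u v]] /= [pq [xu yv]]; apply: eA; rewrite /disc /=.
have -> : latt q u v - latt p x y = (q - p) + (rC (u - x) + iC R * rC (v - y)).
  by rewrite /latt !rCD !rCN; ring.
apply: le_lt_trans (modulusD _ _) _; have := modulusD (rC (u - x)) (iC R * rC (v - y)).
rewrite modulusM modulus_iC mul1r !modulus_rC => h.
rewrite distrC in xu; rewrite distrC in yv.
by move: pq; rewrite /disc /=; lra.
Qed.

Lemma thicken_compact P s : compact P ->
  compact [set latt q.1 q.2.1 q.2.2 | q in P `*` (`[- s, s]%classic `*` `[- s, s]%classic)].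
Proof.
move=> cP; apply: continuous_compact.
  by apply: continuous_subspaceT; exact: latt_continuous.
by apply: compact_setX => //; apply: compact_setX; exact: segment_compact.
Qed.

Definition clamp x : R := Num.max 0 (Num.min 1 x).

Lemma clamp_lip x y : `|clamp x - clamp y| <= `|x - y|.
Proof.
wlog xy : x y / y <= x.
  move=> H; case/orP: (le_total y x) => [/H //|/H].
  by move=> h; rewrite (distrC (clamp x)) (distrC x).
rewrite (ger0_norm (_ : 0 <= x - y)) ?subr_ge0 // ler_norml /clamp.
rewrite !(minEle, maxEle).
by do ?case: ifPn; rewrite -?ltNge => *; apply/andP; split; lra.
Qed.

Lemma clamp_bd x : 0 <= clamp x <= 1.
Proof.
by rewrite /clamp le_max lexx /= ge_max ler01 ge_min lexx.
Qed.

Lemma clamp1 x : 1 <= x -> clamp x = 1.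
Proof. by move=> x1; rewrite /clamp (min_idPl x1) (max_idPr ler01). Qed.

Lemma clamp0 x : x <= 0 -> clamp x = 0.
Proof.
by move=> x0; rewrite /clamp; apply/max_idPl; rewrite ge_min x0 orbT.
Qed.

(** Equal to 1 up to distance [9/4 * e] and to 0 from [5/2 * e] on. With a mesh of at most [e / 10]
    its discrete d-bar lives between [2 * e] and [13/5 * e]: the poles stay [2 * e] away from [P].
    Lipschitz regularity suffices, as [Dh] of it need only be of order [h]. *)
Definition cutoff P e z : C := rC (clamp (10 - 4 * dist P z / e)).

Lemma cutoff1 P e z : 0 < e -> dist P z <= 9 / 4 * e -> cutoff P e z = 1.
Proof.
move=> e0 dz; rewrite /cutoff clamp1 //.
have : dist P z / e <= 9 / 4 by rewrite ler_pdivrMr.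
by move: (dist P z) dz => d _; lra.
Qed.

Lemma cutoff_neq0 P e z : 0 < e -> cutoff P e z != 0 -> dist P z < 5 / 2 * e.
Proof.
move=> e0; apply: contraNT; rewrite -leNgt => dz; rewrite /cutoff clamp0 //.
have : 5 / 2 <= dist P z / e by rewrite ler_pdivlMr.
by move: (dist P z) dz => d _; lra.
Qed.

Lemma cutoff_lip P e z w : 0 < e -> P !=set0 ->
  modulus (cutoff P e z - cutoff P e w) <= 4 / e * modulus (z - w).
Proof.
move=> e0 P0; rewrite /cutoff -rCN -rCD modulus_rC; apply: le_trans (clamp_lip _ _) _.
have -> : 10 - 4 * dist P z / e - (10 - 4 * dist P w / e) = 4 / e * (dist P w - dist P z).
  by ring.
rewrite normrM ger0_norm ?divr_ge0 ?(ltW e0) // ler_wpM2l ?divr_ge0 ?(ltW e0) //.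
rewrite ler_norml lerNl opprB lerBlDr lerBlDr addrC dist_lip //=.
by rewrite addrC modulus_distC dist_lip.
Qed.

Lemma cutoff_Dh P e h z : 0 < e -> P !=set0 -> 0 < h ->
  modulus (Dh h (cutoff P e) z) <= 16 / e * h.
Proof.
move=> e0 P0 h0; rewrite /Dh; apply: le_trans (modulusD _ _) _.
rewrite modulusM modulus_iC mul1r.
have mh : modulus (rC h) = h by rewrite modulus_rC ger0_norm // ltW.
have := cutoff_lip (z + rC h) (z - rC h) e0 P0.
have := cutoff_lip (z + iC R * rC h) (z - iC R * rC h) e0 P0.
have -> : z + iC R * rC h - (z - iC R * rC h) = iC R * rC (h + h) by rewrite rCD; ring.
have -> : z + rC h - (z - rC h) = rC (h + h) by rewrite rCD; ring.
rewrite modulusM modulus_iC mul1r modulus_rC ger0_norm ?addr_ge0 ?(ltW h0) //.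
lra.
Qed.

Lemma cutoff_Dh_neq0 P e h z : 0 < e -> P !=set0 -> 0 < h -> h <= e / 10 ->
  Dh h (cutoff P e) z != 0 -> 2 * e <= dist P z <= 13 / 5 * e.
Proof.
move=> e0 P0 h0 he.
have mh : modulus (rC h) = h by rewrite modulus_rC ger0_norm // ltW.
have k1 (d : C) : modulus d = h -> dist P (z + d) <= dist P z + h /\ dist P z <= dist P (z + d) + h.
  move=> md; have := dist_lip (z + d) z P0; have := dist_lip z (z + d) P0.
  rewrite (_ : z + d - z = d); last by ring.
  by rewrite (_ : z - (z + d) = - d) ?modulusN ?md //; ring.
have mi : modulus (iC R * rC h) = h by rewrite modulusM modulus_iC mul1r.
have [a1 a2] := k1 (rC h) mh.
have [b1 b2] := k1 (- rC h) (etrans (modulusN _) mh).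
have [c1 c2] := k1 (iC R * rC h) mi.
have [d1 d2] := k1 (- (iC R * rC h)) (etrans (modulusN _) mi).
apply: contraNT; rewrite negb_and -!ltNge => /orP[dz|dz].
  by rewrite /Dh !cutoff1 //; [rewrite !subrr mulr0 addr0|(clear -dz d1 he e0 c1 b1 a1; lra)..].
have c0 w : 5 / 2 * e <= dist P w -> cutoff P e w = 0.
  by move=> hw; apply/eqP; apply: contraTT hw => /(cutoff_neq0 e0); rewrite ltNge.
by rewrite /Dh !c0; [rewrite !subrr mulr0 addr0|(clear -dz d2 he c2 b2 a2; lra)..].
Qed.

Lemma contour_inv_transl c h m :
  contour c h m (fun z => (z - c)^-1) = contour 0 h m (fun z => z^-1).
Proof.
rewrite /contour; congr (_ + _ * _); apply: eq_bigr => i _;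
  by rewrite !latt_sub.
Qed.

Lemma contourZ c h m (k : C) g : contour c h m (fun z => k * g z) = k * contour c h m g.
Proof.
rewrite /contour mulrDr [k * (iC R * _)]mulrCA; congr (_ + _ * _);
  rewrite mulr_sumr; apply: eq_bigr => i _; ring.
Qed.

(* The Cauchy-Pompeiu formula for [cutoff P e * f] on a square lattice of mesh [h]. *)
Definition cauchy_sum P e f (p0 : C) h (n : nat) z : C :=
  \sum_(0 <= i < n) \sum_(0 <= j < n)
    Dh h (cutoff P e) (latt p0 (h * i%:R) (h * j%:R)) *
    (f (latt p0 (h * i%:R) (h * j%:R)) * (latt p0 (h * i%:R) (h * j%:R) - z)^-1).

(** Summation by parts moves [Dh] from the cutoff to [f w / (w - z)]. In a box of half-side about
    [s] around a node near [z] the cutoff is 1 and the sum telescopes to a contour; outside it [Dh]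
    is of order [h ^+ 3] at each node. The three errors come from the variation of [f] on the
    contour, from replacing [z] by the node, and from the nodes outside the box. *)
Lemma cauchy_error P e f (rho B B0 h s : R) (n m : nat) z :
  P !=set0 -> 0 < e -> (forall p, P p -> modulus p <= B0) ->
  0 < rho -> rho <= 1 -> 1 <= B ->
  (forall w, dist P w <= 13 / 5 * e -> taylor2 f w rho B) ->
  0 < h -> 0 < s -> s <= e / 2 -> 8 * s <= rho -> 16 * h <= s ->
  s / 2 <= h * m%:R -> h * m%:R <= s -> h * n%:R = 2 * (B0 + 3 * e) -> dist P z <= e ->
  modulus (rC h * cauchy_sum P e f (latt 0 (- (B0 + 3 * e)) (- (B0 + 3 * e))) h n z +
    rC h * contour 0 h m (fun z => z^-1) * f z) <=
  72 * B * s + 384 * B * h / s + 320 * (4 / s) ^+ 4 * (B0 + 3 * e) ^+ 2 * B * h ^+ 2.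
Proof.
move=> P0 e0 hB0 rho0 rho1 B1 hT h0 s0 se sr hs ms1 ms2 hn dz.
set Bd := B0 + 3 * e; set p0 := latt _ _ _.
have modB w (x : R) : dist P w < x -> modulus w < B0 + x.
  move=> /(dist_lt P0)[p Pp pw]; rewrite -(subrK p w).
  by apply: le_lt_trans (modulusD _ _) _; rewrite addrC; apply: ler_ltD => //; exact: hB0.
have zB : modulus z <= B0 + e.
  by apply/ler_addgt0Pr => x x0; rewrite -addrA; apply/ltW/modB; rewrite ltr_pwDr.
have B00 : 0 <= B0 by have [p Pp] := P0; exact: le_trans (hB0 p Pp).
have Rp a b : Re (latt p0 a b) = a - Bd by rewrite Re_latt /p0 Re_latt Re0 add0r addrC.
have Ip a b : Im (latt p0 a b) = b - Bd by rewrite Im_latt /p0 Im_latt Im0 add0r addrC.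
have Rz := normRe_le z; have Iz := normIm_le z.
rewrite !ler_norml in Rz Iz; have /andP[Rz1 Rz2] := Rz; have /andP[Iz1 Iz2] := Iz.
(* A node coordinate next to [t] whose window of [2m + 1] nodes still fits into the grid. *)
have idx (t : R) : - (B0 + e) <= t -> t <= B0 + e -> exists v : nat,
    [/\ (m <= v)%N, (v - m + m.*2.+1 <= n)%N & `|t - (h * v%:R - Bd)| <= h].
  move=> t1 t2; have q0 : 0 <= (t + Bd) / h by rewrite divr_ge0 ?(ltW h0) // /Bd; lra.
  exists (Num.truncn ((t + Bd) / h)).
  have := truncn_le ((t + Bd) / h); rewrite q0 ler_pdivlMr // mulrC => l1.
  have := truncnS_gt ((t + Bd) / h); rewrite ltr_pdivrMr // mulrC -natr1 mulrDr mulr1 => l2.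
  move: (Num.truncn _) l1 l2 => v l1 l2.
  have mv : (m <= v)%N.
    rewrite -(ler_nat R) -(ler_pM2l h0); move: l2; rewrite /Bd; lra.
  split=> //.
    rewrite window_end //.
    rewrite -(ler_nat R) -(ler_pM2l h0) hn !natrD !mulrDr mulr1.
    by move: l1; rewrite /Bd; (clear -t2 ms2 hs se e0; lra).
  by rewrite ler_norml; apply/andP; split; (clear -l1 h0 l2; lra).
have [v1 [mv1 vn1 hv1]] := idx (Re z) ltac:((clear -Rz zB; lra)) ltac:((clear -Rz zB; lra)).
have [v2 [mv2 vn2 hv2]] := idx (Im z) ltac:((clear -Iz zB; lra)) ltac:((clear -Iz zB; lra)).
pose zv := latt p0 (h * v1%:R) (h * v2%:R).
have zzv : modulus (z - zv) <= 2 * h.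
  apply: le_trans (modulus_le _) _; rewrite ReD ImD ReN ImN /zv Rp Ip; (clear -hv2 hv1; lra).
pose g w := f w * (w - z)^-1.
pose a1 := (v1 - m)%N; pose a2 := (v2 - m)%N.
pose pt i j := latt p0 (h * i%:R) (h * j%:R).
pose box i j := ((a1 <= i < a1 + m.*2.+1) && (a2 <= j < a2 + m.*2.+1))%N.
have he : h <= e / 10 by (clear -hs se e0; lra).
have Sparts : cauchy_sum P e f p0 h n z =
   - \sum_(0 <= i < n) \sum_(0 <= j < n) cutoff P e (pt i j) * Dh h g (pt i j).
  rewrite (@Dh_parts R (cutoff P e) g p0 h n) ?opprK // => a b /(cutoff_neq0 e0) dab.
  have mab := modB _ _ dab.
  have h1 := normRe_le (latt p0 a b); have h2 := normIm_le (latt p0 a b).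
  rewrite Rp in h1; rewrite Ip in h2; rewrite hn; rewrite !ler_norml in h1 h2.
  have /andP[u1 u2] := h1; have /andP[u3 u4] := h2; rewrite /Bd in u1 u2 u3 u4.
  by split; apply/andP; split; (clear -u1 mab e0 u2 hs se u3 u4; lra).
have natv (v i : nat) : (m <= v)%N -> h * (v - m + i)%:R = h * v%:R + (h * i%:R - h * m%:R).
  by move=> mv; rewrite natrD natrB //; ring.
have boxsum : \sum_(0 <= i < n) \sum_(0 <= j < n) (if box i j then Dh h g (pt i j) else 0) =
    contour zv h m g.
  rewrite -contourE.
  transitivity (\sum_(0 <= i < n) (if (a1 <= i < a1 + m.*2.+1)%N then
      \sum_(0 <= j < n) (if (a2 <= j < a2 + m.*2.+1)%N then Dh h g (pt i j) else 0) else 0)).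
    apply: eq_bigr => i _; rewrite /box; case: ifP => _ //=.
    by rewrite big1.
  rewrite sum_window //; apply: eq_bigr => i _.
  rewrite sum_window //; apply: eq_bigr => j _.
  by rewrite /pt /zv lattD !natv.
pose s' := s / 4.
pose E := 4 * (10 * (B * (2 / s' ^+ 4))) * h ^+ 3.
have E0 : 0 <= E.
  by rewrite /E !mulr_ge0 ?invr_ge0 ?exprn_ge0 ?(ltW h0) // ?(le_trans ler01 B1) // /s'; (clear -s0; lra).
(* In the box the cutoff is 1 and nothing remains. Outside, either the cutoff vanishes or [f] has
   its expansion at a node that is far enough from the pole [z]. *)
have hII i j : modulus (cutoff P e (pt i j) * Dh h g (pt i j) - (if box i j then Dh h g (pt i j) else 0)) <= E.
  have [Re1 Im1] : Re (pt i j - zv) = h * i%:R - h * v1%:R /\ Im (pt i j - zv) = h * j%:R - h * v2%:R.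
    by rewrite ReD ReN ImD ImN /pt /zv !Rp !Ip; split; ring.
  case: ifPn => [|nb].
    rewrite /box /a1 /a2 => /andP[/andP[i1 i2] /andP[j1 j2]].
    rewrite cutoff1 ?mul1r ?subrr ?modulus0 //.
    have bnd (v k : nat) : (m <= v)%N -> (v - m <= k)%N -> (k < v - m + m.*2.+1)%N ->
        `|h * k%:R - h * v%:R| <= s.
      move=> mv k1 k2; rewrite ler_norml -mulrBr; apply/andP; split.
        have : (v%:R : R) <= k%:R + m%:R by rewrite -natrD ler_nat leq_addsub.
        rewrite -(ler_pM2l h0) mulrDr mulrBr; (clear -ms2; lra).
      have : (k%:R : R) <= v%:R + m%:R.
        by rewrite -natrD ler_nat; move: k2; rewrite window_end // addn1 ltnS.
      rewrite -(ler_pM2l h0) mulrDr mulrBr; (clear -ms2; lra).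
    have q1 := bnd v1 i mv1 i1 i2; have q2 := bnd v2 j mv2 j1 j2.
    have := dist_lip (pt i j) z P0; have := modulus_triangle (pt i j) zv z.
    have := modulus_le (pt i j - zv); rewrite Re1 Im1 (modulus_distC zv z); (clear -q2 q1 zzv dz hs se e0; lra).
  rewrite subr0; have [->|cn] := eqVneq (cutoff P e (pt i j)) 0.
    by rewrite mul0r modulus0.
  have dp := cutoff_neq0 e0 cn.
  have far : s' <= modulus (pt i j - z).
    have fv : h * m%:R + h <= modulus (pt i j - zv).
      have bnd (v k : nat) : (m <= v)%N -> ~~ (v - m <= k < v - m + m.*2.+1)%N ->
          h * m%:R + h <= `|h * k%:R - h * v%:R|.
        move=> mv; rewrite negb_and -ltnNge -leqNgt => /orP[kv|kv].
          have : (k%:R : R) + m%:R + 1 <= v%:R.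
            by rewrite -natrD natr1 ler_nat -addn1 ltn_addsub.
          rewrite -(ler_pM2l h0) !mulrDr mulr1 => k1.
          by rewrite distrC; apply: le_trans (ler_norm _); (clear -k1; lra).
        have : (v%:R : R) + m%:R + 1 <= k%:R.
          by rewrite -natrD natr1 ler_nat; move: kv; rewrite window_end // addn1.
        rewrite -(ler_pM2l h0) !mulrDr mulr1 => k1.
        by apply: le_trans (ler_norm _); (clear -k1; lra).
      move: nb; rewrite /box negb_and => /orP[nb|nb].
        apply: le_trans (bnd v1 i mv1 nb) _; rewrite -Re1; exact: normRe_le.
      apply: le_trans (bnd v2 j mv2 nb) _; rewrite -Im1; exact: normIm_le.
    have := modulus_triangle (pt i j) z zv.
    rewrite /s'; (clear -fv zzv ms1 hs h0; lra).
  rewrite modulusM; apply: le_trans (_ : 1 * modulus (Dh h g (pt i j)) <= _).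
    rewrite ler_wpM2r // /cutoff modulus_rC ger0_norm; by have /andP[] := clamp_bd (10 - 4 * dist P (pt i j) / e).
  rewrite mul1r; apply: (@taylor2_Dh R g (pt i j) (s' / 2)) => //; first by rewrite /s'; (clear -hs h0; lra).
  apply: taylor2_mul; [rewrite /s'; (clear -sr rho1 s0; lra)|rewrite /s'; (clear -sr rho1 s0; lra)| |].
    by apply: (taylor2_le _ (lexx B) (hT _ _)); [rewrite /s'; (clear -sr rho0 dp e0; lra)|(clear -sr rho0 dp e0; lra)].
  by apply: taylor2_inv => //; rewrite /s'; (clear -s0 sr rho1; lra).
have hII2 : modulus (\sum_(0 <= i < n) \sum_(0 <= j < n) cutoff P e (pt i j) * Dh h g (pt i j) - contour zv h m g)
     <= n%:R * (n%:R * E).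
  rewrite -boxsum -sumrB; apply: le_trans (modulus_sum _ _ _) _.
  apply: ler_sum_cst => i.
  rewrite -sumrB; apply: le_trans (modulus_sum _ _ _) _.
  exact: ler_sum_cst.
(* The summand [3 * B] is the Lipschitz bound for [(f w - f z) / (w - z)]; the other one is the cost
   of moving the pole from [z] to [zv]. *)
have hI : modulus (contour zv h m g - f z * contour 0 h m (fun z => z^-1)) <= 8 * m.*2.+1%:R * (3 * B + 16 * B * h / s ^+ 2).
  rewrite -(contour_inv_transl zv) -contourZ; apply: contour_dist => // w /andP[w1 w2].
  have wz1 : s / 4 <= modulus (w - z).
    have := modulus_triangle w z zv; (clear -w1 zzv ms1 hs h0; lra).
  have wz2 : modulus (w - z) < rho.
    have := modulus_triangle w zv z; rewrite (modulus_distC zv z).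
    move: w2; rewrite -natr1; (clear -zzv ms2 hs sr rho0; lra).
  have wz0 : w - z != 0 by rewrite -modulus_gt0; apply: lt_le_trans wz1; (clear -s0; lra).
  have wzv0 : w - zv != 0 by rewrite -modulus_gt0; apply: lt_le_trans w1; (clear -ms1 s0; lra).
  have tz : taylor2 f z rho B by apply: hT; (clear -dz e0; lra).
  have fl := taylor2_lip rho0 rho1 tz wz2; rewrite (addrC z) subrK in fl.
  have fz := taylor2_val rho0 tz.
  have -> : f w * (w - z)^-1 - f z * (w - zv)^-1 = (f w - f z) * (w - z)^-1 + f z * (z - zv) * ((w - z)^-1 * (w - zv)^-1).
    by field; rewrite wz0 wzv0.
  apply: le_trans (modulusD _ _) _; rewrite !modulusM !modulusV; apply: lerD.
    by rewrite ler_pdivrMr ?modulus_gt0.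
  rewrite -invfM; apply: (@le_trans _ _ (B * (2 * h) * (s / 4 * (s / 2))^-1)).
    apply: ler_pM; rewrite ?mulr_ge0 ?invr_ge0 ?mulr_ge0 //; first by apply: ler_pM.
    rewrite lef_pV2 ?posrE ?mulr_gt0 ?modulus_gt0 ?divr_gt0 //.
    by apply: ler_pM => //; rewrite ?divr_ge0 ?(ltW s0) //; exact: le_trans w1.
  by apply: eq_leR; field; rewrite gt_eqF.
have -> : rC h * cauchy_sum P e f p0 h n z + rC h * contour 0 h m (fun z => z^-1) * f z =
   - rC h * ((\sum_(0 <= i < n) \sum_(0 <= j < n) cutoff P e (pt i j) * Dh h g (pt i j) - contour zv h m g) +
   (contour zv h m g - f z * contour 0 h m (fun z => z^-1))).
  by rewrite Sparts; ring.
rewrite modulusM modulusN modulus_rC ger0_norm ?(ltW h0) //.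
apply: (@le_trans _ _ (h * (n%:R * (n%:R * E) + 8 * m.*2.+1%:R * (3 * B + 16 * B * h / s ^+ 2)))).
  rewrite ler_wpM2l ?(ltW h0) //; apply: le_trans (modulusD _ _) _; exact: lerD.
have -> : h * (n%:R * (n%:R * E) + 8 * m.*2.+1%:R * (3 * B + 16 * B * h / s ^+ 2)) =
   (h * n%:R) ^+ 2 * (E / h) + 8 * (h * m.*2.+1%:R) * (3 * B + 16 * B * h / s ^+ 2).
  by field; rewrite !gt_eqF.
have -> : (h * n%:R) ^+ 2 * (E / h) = 320 * (4 / s) ^+ 4 * Bd ^+ 2 * B * h ^+ 2.
  by rewrite hn /E /s' -/Bd; field; rewrite !gt_eqF.
rewrite addrC lerD2r.
have hm : h * m.*2.+1%:R <= 3 * s.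
  rewrite -addn1 natrD -muln2 natrM; (clear -ms2 hs h0; lra).
apply: (@le_trans _ _ (8 * (3 * s) * (3 * B + 16 * B * h / s ^+ 2))).
  rewrite ler_wpM2r ?ler_wpM2l // addr_ge0 ?mulr_ge0 ?invr_ge0 ?exprn_ge0 ?(ltW h0) ?(ltW s0) //; exact: le_trans B1.
by apply: eq_leR; field; rewrite gt_eqF.
Qed.

End Cauchy.

(** * Separation from a convex set and approximation by Cauchy kernels *)

Section Polya.
Variable R : realType.
Local Notation C := (Cx R).
Implicit Types (z w p c : C) (x y h s e B : R) (f g : C -> C) (P G : set C).

Lemma convexC P : is_convex P -> forall (x y : C) (t : R), P x -> P y -> 0 <= t -> t <= 1 ->
  P (rC t * x + rC (1 - t) * y).
Proof.
move=> cP x y t Px Py t0 t1.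
have h0 : (0 : C) <= rC t by rewrite Cx_leE /= eqxx.
have h1 : rC t <= (1 : C) by rewrite Cx_leE /= eqxx.
have := cP x y (Itv01 h0 h1); rewrite !inE => /(_ Px Py).
rewrite rCD rCN rC1; exact.
Qed.

Lemma compact_modulus_bd P : compact P -> exists2 B0, 0 <= B0 & forall p, P p -> modulus p <= B0.
Proof.
rewrite compact_near_coveringP => /(_ nat \oo (fun n z => modulus z <= n%:R) _)[].
  move=> z Pz; exists (disc z 1, [set n | (Num.truncn (modulus z) + 2 <= n)%N]).
    split; first exact: nbhs_disc.
    by exists (Num.truncn (modulus z) + 2)%N.
  move=> [w n] /= [wz nz]; apply: le_trans (_ : (Num.truncn (modulus z) + 2)%:R <= _); last by rewrite ler_nat.
  have := truncnS_gt (modulus z); rewrite natrD -natr1 => h.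
  have := modulusD (w - z) z; rewrite subrK; move: wz; rewrite /disc /=; lra.
by move=> N _ hN; exists N%:R => // p Pp; exact: (hN N (leqnn N)).
Qed.

Lemma modulus_dist_continuous P (q : C) : {within P, continuous (fun p => modulus (q - p))}.
Proof.
apply: continuous_subspaceT => p A /nbhs_ballP[e /= e0 eA]; apply/nbhs_discP; exists e => // w wp.
apply: eA; rewrite /ball /= ltr_norml; apply/andP.
have := modulus_triangle q w p; have := modulus_triangle q p w; rewrite (modulus_distC p w).
by move: wp; rewrite /disc /=; split; lra.
Qed.

Lemma modulus_sub_sqr (a b : C) (t : R) : modulus (a - rC t * b) ^+ 2 =
  modulus a ^+ 2 - 2 * t * Re (cconj a * b) + t ^+ 2 * modulus b ^+ 2.
Proof. by rewrite !modulus_sqr !ReImE /=; ring. Qed.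

(** With [p0] a nearest point of [P], the normal [u] is the normalised conjugate of [q - p0]. A
    point [p] on the wrong side would allow a step from [p0] towards [p] that comes closer to
    [q]. *)
Lemma separation P (q : C) (d : R) : compact P -> P !=set0 -> is_convex P -> 0 < d -> d <= dist P q ->
  exists2 u : C, modulus u = 1 & forall p, P p -> d <= Re (u * (q - p)).
Proof.
move=> cP P0 vP d0 dq.
have [p0 Pp0 hp0] := compact_EVT_min P0 cP (@modulus_dist_continuous P q).
rewrite inE in Pp0.
have m0 : d <= modulus (q - p0).
  apply: le_trans dq _; exact: dist_le.
set a := q - p0; have ma : 0 < modulus a by apply: lt_le_trans m0.
exists (rC (modulus a)^-1 * cconj a).
  by rewrite modulusM modulus_rC modulus_conj ger0_norm ?invr_ge0 // mulVf // gt_eqF.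
move=> p Pp; pose b := p - p0.
have key : Re (cconj a * b) <= 0.
  rewrite leNgt; apply/negP => r0; set r := Re _ in r0.
  have b0 : 0 < modulus b ^+ 2.
    rewrite exprn_gt0 // modulus_gt0; apply: contraTneq r0 => b0.
    by rewrite /r b0 mulr0 ltxx.
  (* The minimiser of the squared distance along the line from [p0] to [p], truncated to stay in
     [P]. *)
  pose t := Num.min 1 (r / modulus b ^+ 2).
  have t0 : 0 < t by rewrite lt_min ltr01 divr_gt0.
  have t1 : t <= 1 by rewrite ge_min lexx.
  have tr : t * modulus b ^+ 2 <= r by rewrite -ler_pdivlMr // ge_min lexx orbT.
  have Pt : P (rC t * p + rC (1 - t) * p0) by apply: convexC => //; exact: ltW.
  have := hp0 _ (mem_set Pt).
  have -> : q - (rC t * p + rC (1 - t) * p0) = a - rC t * b.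
    by rewrite /a /b rCD rCN rC1; ring.
  rewrite -(@ler_pXn2r _ 2) ?nnegrE // modulus_sub_sqr -/r => hh.
  have : t * (t * modulus b ^+ 2) <= t * r by rewrite ler_pM2l.
  have : 0 < t * r by rewrite mulr_gt0.
  lra.
rewrite -mulrA ReM RerC ImrC mul0r subr0.
have -> : q - p = a - b by rewrite /a /b; ring.
rewrite mulrBr [cconj a * a]mulrC mul_cconj ReD ReN RerC.
apply: le_trans m0 _; rewrite -/a mulrDr expr2 mulrA mulVf ?gt_eqF // mul1r lerDl.
by rewrite mulr_ge0 ?invr_ge0 // oppr_ge0.
Qed.

Lemma natr_gt (x : R) : exists n : nat, x < n%:R.
Proof. by exists (Num.truncn x).+1; exact: truncnS_gt. Qed.

(** The point is the order of quantifiers: the mass [M] is fixed before the accuracy [eta]. There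
    are [n ^ 2] coefficients of order [h ^+ 2], and [h * n] is fixed. *)
Lemma cauchy_approx P G e f : compact P -> P !=set0 -> 0 < e -> open G ->
  (forall p (x : C), P p -> modulus x < 4 * e -> G (p + x)) -> analytic_on G f ->
  exists2 M : R, 0 <= M & forall eta : R, 0 < eta -> exists s : seq (C * C),
    [/\ forall q, q \in s -> 2 * e <= dist P q.2,
        \sum_(q <- s) modulus q.1 <= M &
        forall z, dist P z <= e -> modulus (f z - \sum_(q <- s) q.1 * (q.2 - z)^-1) <= eta].
Proof.
move=> cP P0 e0 oG PG aG.
(* The half-side 27/10 exceeds 13/5, which makes room for the strict inequality of [dist_lt], while
   its diagonal is below 39/10, hence inside the radius [4 * e] where [f] is analytic. *)
pose Kc := [set latt q.1 q.2.1 q.2.2 | q in P `*` (`[- (27 / 10 * e), 27 / 10 * e]%classic `*` `[- (27 / 10 * e), 27 / 10 * e]%classic)].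
have cK : compact Kc by exact: thicken_compact.
have KG : Kc `<=` G.
  move=> _ [[p [x y]] /= [Pp [hx hy]] <-]; rewrite -(subrK p (latt _ _ _)) addrC; apply: PG => //.
  rewrite latt_sub; apply: (@le_lt_trans _ _ (39 / 10 * e)); last by lra.
  apply: modulus_le_sqr; first by rewrite mulr_ge0 ?divr_ge0 // ltW.
  rewrite Re_latt Im_latt Re0 Im0 !add0r; move: hx hy; rewrite /= !in_itv /= => /andP[x1 x2] /andP[y1 y2].
  have sq (t : R) : - (27 / 10 * e) <= t -> t <= 27 / 10 * e -> t ^+ 2 <= (27 / 10 * e) ^+ 2.
    move=> t1 t2; rewrite -real_normK ?num_real // lerXn2r ?nnegrE //; last by rewrite ler_norml t1.
    by rewrite mulr_ge0 ?divr_ge0 // ltW.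
  have := sq _ x1 x2; have := sq _ y1 y2; rewrite !exprMn.
  have : 0 <= e ^+ 2 by exact: sqr_ge0.
  lra.
have [rho [rho0 rho1] [B B1 hB]] := taylor2_uniform oG cK KG aG.
have hT w : dist P w <= 13 / 5 * e -> taylor2 f w rho B.
  move=> dw; apply: hB; have [p Pp pw] : exists2 p, P p & modulus (w - p) < 27 / 10 * e.
    by apply: dist_lt => //; lra.
  exists (p, (Re (w - p), Im (w - p))).
    split=> //=; rewrite !in_itv /=.
    have := normRe_le (w - p); have := normIm_le (w - p); rewrite !ler_norml => /andP[i1 i2] /andP[i3 i4].
    by split; apply/andP; split; (clear -i3 pw i4 i1 i2; lra).
  by rewrite /latt /= -addrA -complexRI addrC subrK.
have [B0 B00 hB0] := compact_modulus_bd cP.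
pose Bd := B0 + 3 * e.
have Bd0 : 0 < Bd by rewrite /Bd; lra.
have Bp : 0 < B by lra.
exists ((2 * Bd) ^+ 2 * (16 / e * B)).
  by pos.
move=> eta eta0.
(* The third entry makes the error [72 * B * s] at most [eta / 3]; the others are the requirements
   of [cauchy_error]. *)
pose s := Num.min (e / 2) (Num.min (rho / 8) (eta / (216 * B))).
have s0 : 0 < s by rewrite !lt_min; apply/and3P; split; pos.
have se : s <= e / 2 by rewrite ge_min lexx.
have sr : 8 * s <= rho.
  have : s <= rho / 8 by rewrite !ge_min lexx orbT.
  lra.
have sB : 72 * B * s <= eta / 3.
  have : s <= eta / (216 * B) by rewrite !ge_min lexx !orbT.
  rewrite ler_pdivlMr; [lra|pos].
clearbody s.
pose k1 := 1152 * B / s / eta.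
pose k2 := 3 * (320 * (4 / s) ^+ 4 * Bd ^+ 2 * B) / eta.
have k10 : 0 < k1 by rewrite /k1; pos.
have k20 : 0 < k2 by rewrite /k2; pos.
(* One inequality for [n] collects four smallness conditions on the mesh: [h] below [s / 16] and 1,
   and, through [k1] and [k2], the two errors involving [h] below [eta / 3]. *)
have [n hn0] := natr_gt (2 * Bd * (16 / s + 1 + k1 + k2)).
have n0 : 0 < (n%:R : R).
  by apply: lt_trans hn0; pos.
pose h := 2 * Bd / n%:R.
have h0 : 0 < h by rewrite /h; pos.
have hn : h * n%:R = 2 * (B0 + 3 * e) by rewrite divfK // gt_eqF.
have hk : h * (16 / s + 1 + k1 + k2) < 1.
  by rewrite /h mulrAC ltr_pdivrMr // mul1r.
clearbody h.
have s16 : 0 < 16 / s by rewrite divr_gt0.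
have split4 : h * (16 / s + 1 + k1 + k2) = h * (16 / s) + h + h * k1 + h * k2 by ring.
have p1 : 0 < h * (16 / s) by rewrite mulr_gt0.
have p2 : 0 < h * k1 by rewrite mulr_gt0.
have p3 : 0 < h * k2 by rewrite mulr_gt0.
have hs : 16 * h <= s.
  have : h * (16 / s) <= 1 by (clear -p3 p2 hk h0; lra).
  by rewrite mulrA ler_pdivrMr // mul1r mulrC.
have h1 : h <= 1 by (clear -p3 p2 p1 hk; lra).
have e2 : 384 * B * h / s <= eta / 3.
  have : h * k1 <= 1 by (clear -p3 p1 hk h0; lra).
  rewrite /k1 !mulrA ler_pdivrMr // mul1r => hh.
  have -> : 384 * B * h / s = h * 1152 * B / s / 3 by field; rewrite gt_eqF.
  (clear -hh; lra).
have e3 : 320 * (4 / s) ^+ 4 * Bd ^+ 2 * B * h ^+ 2 <= eta / 3.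
  have hk2 : h * k2 <= 1 by (clear -p2 p1 hk h0; lra).
  rewrite /k2 [h * _]mulrA ler_pdivrMr // mul1r in hk2.
  move: hk2.
  have q0 : 0 <= 320 * (4 / s) ^+ 4 * Bd ^+ 2 * B.
    by pos.
  move: q0; set q := 320 * _ * _ * _ => q0 hh.
  have : q * h ^+ 2 <= q * h.
    by rewrite ler_wpM2l // expr2 ler_piMr // ltW.
  (clear -hh; lra).
pose m := Num.truncn (s / h).
have ms2 : h * m%:R <= s.
  by have := truncn_le (s / h); rewrite divr_ge0 ?(ltW s0) ?(ltW h0) // ler_pdivlMr // mulrC.
have ms1 : s / 2 <= h * m%:R.
  have := truncnS_gt (s / h); rewrite -/m ltr_pdivrMr // mulrC -natr1 mulrDr mulr1; (clear -hs s0; lra).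
have m0 : (0 < m)%N by rewrite -(ltr_nat R) -(ltr_pM2l h0) mulr0; (clear -ms1 s0; lra).
set p0 := latt 0 (- Bd) (- Bd).
pose pt (i j : nat) := latt p0 (h * i%:R) (h * j%:R).
pose k := rC h * contour 0 h m (fun z : C => z^-1).
have k1le : 1 <= modulus k.
  apply: le_trans (Re_le _); have := contour_inv_ge1 0 h0 m0.
  by rewrite contour_inv_transl.
have kn0 : k != 0 by rewrite -modulus_gt0; exact: lt_le_trans k1le.
pose c (i j : nat) : C := - (rC h * Dh h (cutoff P e) (pt i j) * f (pt i j)) / k.
pose all := [seq (c i j, pt i j) | i <- index_iota 0 n, j <- index_iota 0 n].
have hall (F : C * C -> R) : \sum_(q <- all) F q = \sum_(0 <= i < n) \sum_(0 <= j < n) F (c i j, pt i j).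
  by rewrite big_allpairs_dep.
have he10 : h <= e / 10 by (clear -hs se e0; lra).
have cn i j : c i j != 0 -> 2 * e <= dist P (pt i j) <= 13 / 5 * e.
  move=> cij; apply: (@cutoff_Dh_neq0 R P e h) => //.
  by apply: contraNneq cij => d0; rewrite /c d0 mulr0 mul0r oppr0 mul0r.
have mh : modulus (rC h) = h by rewrite modulus_rC ger0_norm // ltW.
have cb i j : modulus (c i j) <= h * (16 / e * h) * B.
  have [->|cij] := eqVneq (c i j) 0.
    by rewrite modulus0; pos.
  have /andP[_ d2] := cn _ _ cij.
  rewrite /c modulusM modulusN modulusV ler_pdivrMr; last exact: lt_le_trans k1le.
  rewrite modulusM [modulus (rC h * _)]modulusM mh.
  apply: le_trans (_ : h * (16 / e * h) * B * 1 <= _); last first.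
    by rewrite ler_wpM2l //; pos.
  rewrite mulr1; apply: ler_pM; rewrite ?mulr_ge0 ?(ltW h0) //.
    by rewrite ler_wpM2l ?(ltW h0) //; exact: cutoff_Dh.
  exact: (taylor2_val rho0 (hT _ d2)).
(* Only nonzero coefficients are kept: for them alone the pole is known to lie at distance [2 * e]
   from [P]. *)
exists [seq q <- all | q.1 != 0]; split.
- move=> q; rewrite mem_filter => /andP[q0 /allpairsP[[i j] /= [_ _ qe]]].
  by move: q0; rewrite qe /= => /cn/andP[].
- rewrite big_filter; apply: le_trans (_ : \sum_(q <- all) modulus q.1 <= _).
    by rewrite [leRHS](bigID (fun q => q.1 != 0)) /= lerDl sumr_ge0.
  rewrite hall; apply: le_trans (_ : n%:R * (n%:R * (h * (16 / e * h) * B)) <= _).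
    by apply: ler_sum_cst => i; apply: ler_sum_cst => j; exact: cb.
  apply: eq_leR; rewrite /Bd -hn; ring.
move=> z dz.
have -> : \sum_(q <- [seq q <- all | q.1 != 0]) q.1 * (q.2 - z)^-1 = - (rC h / k * cauchy_sum P e f p0 h n z).
  rewrite big_filter big_mkcond /=.
  transitivity (\sum_(q <- all) q.1 * (q.2 - z)^-1).
    by apply: eq_bigr => q _; case: ifPn => //; rewrite negbK => /eqP ->; rewrite mul0r.
  rewrite big_allpairs_dep /cauchy_sum -mulNr mulr_sumr; apply: eq_bigr => i _.
  rewrite mulr_sumr; apply: eq_bigr => j _ /=; rewrite /c -/(pt i j); ring.
have := @cauchy_error R P e f rho B B0 h s n m z P0 e0 hB0 rho0 rho1 B1 hT h0 s0 se sr hs ms1 ms2 hn dz.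
rewrite -/Bd -/p0 -/k => hfin.
have -> : f z - - (rC h / k * cauchy_sum P e f p0 h n z) = k^-1 * (rC h * cauchy_sum P e f p0 h n z + k * f z).
  by field.
rewrite modulusM modulusV ler_pdivrMl; last exact: lt_le_trans k1le.
apply: le_trans hfin _; apply: le_trans (_ : 1 * eta <= _); last by rewrite ler_wpM2r // ltW.
(clear -e3 e2 sB; lra).
Qed.

End Polya.

(** * A Polya type bound for functionals on analytic functions *)

Section PolyaBound.
Variable R : realType.
Local Notation C := (Cx R).
Implicit Types (z w p c : C) (x y h s e B : R) (f g : C -> C) (P G : set C).

Lemma expRN_le x : 0 < x -> expR (- x) <= x^-1.
Proof.
move=> x0; rewrite expRN lef_pV2 ?posrE ?expR_gt0 //.
by apply: le_trans (expR_ge1Dx x); rewrite lerDr.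
Qed.

Lemma expR_le2 x : x <= 2^-1 -> expR x <= 2.
Proof.
move=> x2; rewrite -[x]opprK expRN -[leRHS]invrK lef_pV2 ?posrE ?expR_gt0 ?invr_gt0 //.
apply: le_trans (expR_ge1Dx (- x)); lra.
Qed.

(** A Riemann sum of the integral of [exp(- x t)] over the half-line: the first node contributes
    [h], the rest at most the integral. *)
Lemma geo_sum_le (x : R) (h : R) N : 0 < h -> 0 < x ->
  h * \sum_(0 <= n < N) expR (- (n%:R * (h * x))) <= h + x^-1.
Proof.
move=> h0 x0; have hx0 : 0 < h * x by pos.
have y0 : 0 < expR (- (h * x)) by exact: expR_gt0.
have -> : \sum_(0 <= n < N) expR (- (n%:R * (h * x))) = \sum_(0 <= n < N) expR (- (h * x)) ^+ n.
  by apply: eq_bigr => n _; rewrite -mulrN expRM_natl.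
have y1 : expR (- (h * x)) * (1 + h * x) <= 1.
  by rewrite expRN ler_pdivrMl ?expR_gt0 // mulr1; exact: expR_ge1Dx.
move: y0 y1; move: (expR _) => y y0 y1.
have yl : y < 1 by rewrite -[y]mulr1; apply: lt_le_trans y1; rewrite ltr_pM2l // ltrDl.
have e1 : (1 - y) * \sum_(0 <= n < N) y ^+ n <= 1.
  have -> : (1 - y) * \sum_(0 <= n < N) y ^+ n = 1 - y ^+ N.
    elim: N => [|N ih]; first by rewrite big_geq // mulr0 expr0 subrr.
    by rewrite big_nat_recr //= mulrDr ih exprS; ring.
  by rewrite lerBlDr lerDl exprn_ge0 // ltW.
have S0 : 0 <= \sum_(0 <= n < N) y ^+ n by apply: sumr_ge0 => n _; rewrite exprn_ge0 // ltW.
move: S0 e1; move: (\sum_(0 <= n < N) _) => S S0 e1.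
have e2 : S * (h * x) <= 1 + h * x.
  have : (1 + h * x) * ((1 - y) * S) <= (1 + h * x) * 1 by rewrite ler_wpM2l //; pos.
  have : S * (y * (1 + h * x)) <= S * 1 by rewrite ler_wpM2l.
  lra.
rewrite -(ler_pM2r x0) mulrDl mulVf ?gt_eqF //.
by move: e2; rewrite mulrCA mulrA [_ + 1]addrC.
Qed.

(** The left-hand sum is a truncated Riemann sum of the Laplace integral of [1 / v]. Summed as a
    geometric series, it leaves a mesh error, from [exp(- h v) = 1 - h v + O(h ^ 2)], and a tail
    error. *)
Lemma geo_kernel (v : C) (h e V : R) N : 0 < h -> 0 < e -> e <= Re v -> modulus v <= V -> 4 * h * V <= 1 ->
  (0 < N)%N ->
  modulus (rC h * \sum_(0 <= n < N) cexp (- (rC h * v)) ^+ n - v^-1) <= 4 * h + 2 / e * (h * e * N%:R)^-1.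
Proof.
move=> h0 e0 ev vV hV N0; set y := cexp _.
have mv0 : 0 < modulus v by apply: lt_le_trans (Re_le v); exact: lt_le_trans ev.
have v0 : v != 0 by rewrite -modulus_gt0.
have mh : modulus (rC h) = h by rewrite modulus_rC ger0_norm // ltW.
pose k := h * modulus v.
have k0 : 0 < k by rewrite /k; pos.
have k4 : 4 * k <= 1.
  apply: le_trans hV; rewrite /k -mulrA ler_wpM2l // ler_wpM2l // ltW //.
have ey : modulus (y - 1 + rC h * v) <= 2 * k ^+ 2.
  have := cexp_bound2 (- (rC h * v)); rewrite opprK -/y modulusN modulusM mh -/k => hh.
  apply: le_trans hh _; rewrite mulrC ler_wpM2r ?exprn_ge0 ?(ltW k0) //.
  by apply: expR_le2; lra.
have y1 : k / 2 <= modulus (1 - y).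
  have h1 := modulus_subl (rC h * v) (y - 1 + rC h * v).
  have e1 : rC h * v - (y - 1 + rC h * v) = 1 - y by ring.
  rewrite e1 modulusM mh -/k in h1.
  have : 2 * k ^+ 2 <= k / 2.
    have : k * (4 * k) <= k * 1 by rewrite ler_wpM2l // ltW.
    rewrite expr2; lra.
  lra.
have y10 : 1 - y != 0 by rewrite -modulus_gt0; apply: lt_le_trans y1; pos.
have geo : (1 - y) * \sum_(0 <= n < N) y ^+ n = 1 - y ^+ N.
  elim: (N) => [|M ih]; first by rewrite big_geq // mulr0 expr0 subrr.
  by rewrite big_nat_recr //= mulrDr ih exprS; ring.
have -> : rC h * \sum_(0 <= n < N) y ^+ n - v^-1 =
    (y - 1 + rC h * v) * ((1 - y)^-1 * v^-1) - rC h * (y ^+ N * (1 - y)^-1).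
  have -> : \sum_(0 <= n < N) y ^+ n = (1 - y ^+ N) * (1 - y)^-1.
    by rewrite -geo mulrC mulrA mulVf // mul1r.
  by field; rewrite v0 y10.
have iy : modulus (1 - y)^-1 <= 2 / k.
  rewrite modulusV -[2 / k]invrK lef_pV2 ?posrE ?modulus_gt0 //; last by pos.
  by rewrite invf_div.
apply: le_trans (modulusB _ _) _; rewrite !modulusM mh [modulus v^-1]modulusV; apply: lerD.
  apply: (@le_trans _ _ (2 * k ^+ 2 * (2 / k * (modulus v)^-1))).
    apply: ler_pM => //; first by pos.
    by rewrite ler_wpM2r // invr_ge0.
  apply: eq_leR; rewrite /k; field; rewrite !gt_eqF //.
apply: (@le_trans _ _ (h * ((h * e * N%:R)^-1 * (2 / k)))).
  rewrite ler_wpM2l ?(ltW h0) //; apply: ler_pM => //.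
  rewrite modulusX modulus_cexp ReN -expRM_natl ReM RerC ImrC mul0r subr0.
  apply: le_trans (_ : expR (- (h * e * N%:R)) <= _).
    rewrite ler_expR mulrN lerN2 mulrC ler_wpM2l //.
    by rewrite ler_wpM2l // ltW.
  by apply: expRN_le; rewrite mulr_gt0 ?ltr0n //; pos.
rewrite mulrCA mulrC ler_wpM2r //.
  by rewrite invr_ge0 mulr_ge0 //; pos.
rewrite /k.
have -> : h * (2 / (h * modulus v)) = 2 / modulus v by field; rewrite !gt_eqF.
rewrite ler_wpM2l // lef_pV2 ?posrE //.
by apply: le_trans ev (Re_le _).
Qed.

(** A Cauchy kernel with pole [q] is a superposition of the functions [exp(s u (z - q))], [s >= 0],
    with [u] the normal separating [q] from [P] by [2 * e]. The growth hypothesis loses [e] of this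
    margin, so [Phi] of each is at most [B * exp(- s e)], which is summable. The continuity constant
    [A] only multiplies approximation errors and is absent from the conclusion. *)
Lemma polya_bound P e (Phi : (C -> C) -> C) (A B : R) :
  compact P -> P !=set0 -> is_convex P -> 0 < e -> 0 <= A -> 0 <= B ->
  (forall c f g, analytic_on [set z | dist P z < 2 * e] f -> analytic_on [set z | dist P z < 2 * e] g ->
     Phi (fun z => c * f z + g z) = c * Phi f + Phi g) ->
  (forall f (eta : R), analytic_on [set z | dist P z < 2 * e] f -> 0 <= eta ->
     (forall z, dist P z <= e -> modulus (f z) <= eta) -> modulus (Phi f) <= A * eta) ->
  (forall w x, (forall p, P p -> Re (w * p) <= x) ->
     modulus (Phi (fun z => cexp (w * z))) <= B * expR (x + e * modulus w)) ->
  forall f (M : R), analytic_on [set z | dist P z < 2 * e] f ->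
   (forall eta : R, 0 < eta -> exists s : seq (C * C),
    [/\ forall q, q \in s -> 2 * e <= dist P q.2,
        \sum_(q <- s) modulus q.1 <= M &
        forall z, dist P z <= e -> modulus (f z - \sum_(q <- s) q.1 * (q.2 - z)^-1) <= eta]) ->
  modulus (Phi f) <= M * (B * (1 + e^-1)).
Proof.
move=> cP P0 vP e0 A0 B0 lin cont expb f M af approx.
set D := [set z | _] in lin cont af.
have Phi0 : Phi (fun=> 0) = 0.
  apply/eqP; rewrite -modulus_eq0; apply/eqP/le_anti; rewrite modulus_ge0 andbT.
  rewrite -(mulr0 A); apply: cont => //; first exact: analytic_cst.
  by move=> z _; rewrite modulus0.
have PhiS (I : eqType) (s : seq I) (c : I -> C) (F : I -> C -> C) :
    (forall i, i \in s -> analytic_on D (F i)) ->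
    analytic_on D (fun z => \sum_(i <- s) c i * F i z) /\
    Phi (fun z => \sum_(i <- s) c i * F i z) = \sum_(i <- s) c i * Phi (F i).
  elim: s => [|i s ih] hF.
    rewrite (_ : (fun z => _) = fun=> 0); last by apply/funext => z; rewrite big_nil.
    by rewrite big_nil Phi0; split=> //; exact: analytic_cst.
  have [a1 a2] := ih (fun j js => hF j (mem_behead (s := i :: s) js)).
  rewrite (_ : (fun z => \sum_(j <- i :: s) c j * F j z) = fun z => c i * F i z + \sum_(j <- s) c j * F j z); last first.
    by apply/funext => z; rewrite big_cons.
  have ai := hF i (mem_head _ _).
  by rewrite big_cons lin // a2; split=> //; exact: analytic_lin.
have PhiB f1 f2 (eta : R) : analytic_on D f1 -> analytic_on D f2 -> 0 <= eta ->
    (forall z, dist P z <= e -> modulus (f1 z - f2 z) <= eta) -> modulus (Phi f1) <= modulus (Phi f2) + A * eta.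
  move=> a1 a2 eta0 h.
  have e1 : Phi (fun z => (-1) * f2 z + f1 z) = Phi f1 - Phi f2.
    by rewrite lin // mulN1r addrC.
  have := cont (fun z => (-1) * f2 z + f1 z) eta; rewrite e1 => /(_ _ eta0 _) h2.
  have h3 : modulus (Phi f1 - Phi f2) <= A * eta.
    apply: h2; first exact: analytic_lin.
    by move=> z dz; rewrite mulN1r addrC; exact: h.
  by have := modulusD (Phi f1 - Phi f2) (Phi f2); rewrite subrK; lra.
have [B1 B10 hB1] := compact_modulus_bd cP.
have aexp w : analytic_on D (fun z => cexp (w * z)) by exact: analytic_cexp.
have aker q : 2 * e <= dist P q -> analytic_on D (fun z => (q - z)^-1).
  by move=> dq; apply: analytic_inv => z; apply: contraTneq => ->; rewrite -leNgt.
have ker q : 2 * e <= dist P q -> modulus (Phi (fun z => (q - z)^-1)) <= B * (1 + e^-1).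
  move=> dq; have e20 : 0 < 2 * e by pos.
  have [u u1 hu] := separation cP P0 vP e20 dq.
  have u0 : u != 0 by rewrite -modulus_gt0 u1.
  apply/ler_addgt0Pr => eps eps0.
  pose eta := eps / (A + 1); have A1 : 0 < A + 1 by rewrite ltr_wpDl.
  have eta0 : 0 < eta by rewrite divr_gt0.
  pose V := modulus q + B1 + 2 * e.
  have V0 : 0 < V by rewrite /V ltr_wpDl //; pos.
  (* The entries serve, in turn, the factor [1 + e^-1] of the conclusion, the hypothesis of
     [geo_kernel], and its mesh error; [N] below deals with its tail. *)
  pose h := Num.min 1 (Num.min (4 * V)^-1 (eta / 8)).
  have h0 : 0 < h by rewrite !lt_min; apply/and3P; split; pos.
  have h1 : h <= 1 by rewrite ge_min lexx.
  have hV : 4 * h * V <= 1.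
    have : h <= (4 * V)^-1 by rewrite !ge_min lexx orbT.
    rewrite -(ler_pM2r (_ : 0 < 4 * V)); last by pos.
    rewrite mulVf ?gt_eqF //; first by lra.
    by pos.
  have h8 : 4 * h <= eta / 2.
    have : h <= eta / 8 by rewrite !ge_min lexx !orbT.
    lra.
  clearbody h.
  have [N hN] := natr_gt (4 / e / (h * e) / eta).
  have N0 : 0 < (N%:R : R) by apply: lt_trans hN; pos.
  have Nn0 : (0 < N)%N by rewrite -(ltr_nat R).
  (* These weights complete the exponentials in [z] to [rC h * u] times powers of
     [exp(- h u (q - z))], the terms of [geo_kernel] at [v = u (q - z)]. *)
  pose cc n : C := rC h * u * cexp (- (n%:R * (rC h * (u * q)))).
  pose S z := \sum_(n <- index_iota 0 N) cc n * cexp (n%:R * (rC h * u) * z).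
  have [aS PS] := @PhiS nat (index_iota 0 N) cc (fun n z => cexp (n%:R * (rC h * u) * z)) (fun n _ => aexp _).
  have mh : modulus (rC h) = h by rewrite modulus_rC ger0_norm // ltW.
  have b1 : modulus (Phi S) <= B * (1 + e^-1).
    rewrite PS; apply: le_trans (modulus_sum _ _ _) _.
    apply: (@le_trans _ _ (B * (h * \sum_(0 <= n < N) expR (- (n%:R * (h * e)))))); last first.
      rewrite ler_wpM2l //; apply: le_trans (geo_sum_le N h0 e0) _.
      by rewrite lerD2r.
    rewrite mulr_sumr mulr_sumr; apply: ler_sum => n _.
    have nh0 : 0 <= n%:R * h by rewrite mulr_ge0 // ltW.
    have nh : modulus (n%:R * (rC h * u)) = n%:R * h.
      by rewrite -rC_nat mulrA -rCM modulusM u1 mulr1 modulus_rC ger0_norm.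
    have hx p : P p -> Re (n%:R * (rC h * u) * p) <= n%:R * h * (Re (u * q) - 2 * e).
      move=> Pp; rewrite -rC_nat mulrA -rCM -mulrA ReM RerC ImrC mul0r subr0 ler_wpM2l //.
      by have := hu p Pp; rewrite mulrBr ReD ReN; (clear -R; lra).
    rewrite modulusM; apply: le_trans (ler_wpM2l (modulus_ge0 _) (expb _ _ hx)) _.
    rewrite nh /cc !modulusM mh u1 mulr1 modulus_cexp.
    have -> : Re (- (n%:R * (rC h * (u * q)))) = - (n%:R * h * Re (u * q)).
      by rewrite ReN -rC_nat mulrA -rCM ReM RerC ImrC mul0r subr0.
    rewrite mulrCA -[h * _ * _]mulrA -expRD; apply: eq_leR; congr (_ * (_ * expR _)); ring.
  have b2 : modulus (Phi (fun z => (q - z)^-1)) <= modulus (Phi S) + A * eta.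
    apply: PhiB => //; [exact: aker|exact: ltW|].
    move=> z dz; pose v := u * (q - z).
    have [p Pp zp] : exists2 p, P p & modulus (z - p) < e + e by apply: dist_lt => //; (clear -dz e0; lra).
    have vV : modulus v <= V.
      rewrite modulusM u1 mul1r /V; have := modulusB q z; have := modulusD (z - p) p; rewrite subrK.
      have := hB1 p Pp; (clear -zp; lra).
    have ve : e <= Re v.
      apply/ler_addgt0Pr => t t0.
      have [p' Pp' zp'] : exists2 p, P p & modulus (z - p) < e + t by apply: dist_lt => //; (clear -t0 dz; lra).
      have := hu p' Pp'; have := Re_le (u * (z - p')); rewrite modulusM u1 mul1r.
      have -> : u * (q - p') = v + u * (z - p') by rewrite /v; ring.
      rewrite ReD; (clear -zp'; lra).
    have := geo_kernel h0 e0 ve vV hV Nn0.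
    have -> : (q - z)^-1 - S z = - (u * (rC h * \sum_(0 <= n < N) cexp (- (rC h * v)) ^+ n - v^-1)).
      rewrite mulrBr opprB; congr (_ - _).
        by rewrite /v invfM mulrA divff // mul1r.
      rewrite /S mulrA mulr_sumr; apply: eq_bigr => n _.
      symmetry; transitivity (rC h * u * (cexp (- (n%:R * (rC h * (u * q)))) * cexp (n%:R * (rC h * u) * z))); last exact: mulrA.
      rewrite -cexpD -cexp_natM (mulrC u); congr (_ * cexp _).
      by rewrite /v; ring.
    rewrite modulusN modulusM u1 mul1r => hh; apply: le_trans hh _.
    have : 2 / e * (h * e * N%:R)^-1 <= eta / 2.
      move: hN; rewrite ltr_pdivrMr // => hN.
      have -> : 2 / e * (h * e * N%:R)^-1 = 2^-1 * (4 / e / (h * e)) / N%:R by field; rewrite !gt_eqF.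
      rewrite ler_pdivrMr //; (clear -hN; lra).
    (clear -h8; lra).
  have : A * eta <= eps.
    rewrite /eta mulrA ler_pdivrMr // mulrC ler_wpM2l ?(ltW eps0) // lerDl //.
  (clear -b2 b1; lra).
have M0 : 0 <= M.
  have [s [_ hs _]] := approx 1 ltr01; apply: le_trans hs; exact: sumr_ge0.
apply/ler_addgt0Pr => eps eps0.
pose eta := eps / (A + 1); have A1 : 0 < A + 1 by rewrite ltr_wpDl.
have eta0 : 0 < eta by rewrite divr_gt0.
have [s [hs1 hs2 hs3]] := approx eta eta0.
have [aS PS] := @PhiS _ s (fun q => q.1) (fun q z => (q.2 - z)^-1) (fun q qs => aker _ (hs1 q qs)).
have := PhiB _ _ eta af aS (ltW eta0) hs3; rewrite PS => hh.
apply: le_trans hh _; apply: lerD.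
  apply: le_trans (modulus_sum _ _ _) _.
  apply: (@le_trans _ _ ((\sum_(q <- s) modulus q.1) * (B * (1 + e^-1)))).
    rewrite mulr_suml big_seq [leRHS]big_seq; apply: ler_sum => q qs.
    by rewrite modulusM ler_wpM2l //; exact: ker (hs1 q qs).
  by rewrite ler_wpM2r //; pos.
by rewrite /eta mulrA ler_pdivrMr // mulrC ler_wpM2l ?(ltW eps0) // lerDl.
Qed.

End PolyaBound.

(** * The geometry of [Q] in a direction of [R_Q] *)

Section Geometry.
Variable R : realType.
Local Notation C := (Cx R).
Implicit Types (z w p c b t : C) (x y h s e B : R) (Q U : set C) (u : C -> R).

Lemma near_open_shift_x U z : open U -> U z -> \forall s \near (0 : R^o), U (z + s%:C).
Proof.
move=> /open_discP oU /oU[r r0 rU]; apply/nbhs_ballP; exists r => // s; rewrite /ball /= sub0r normrN => sr.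
by apply: rU; rewrite /disc /= addrAC subrr add0r; have := modulus_rC s; rewrite /rC => ->.
Qed.

Lemma near_open_shift_y U z : open U -> U z -> \forall s \near (0 : R^o), U (z + s *i).
Proof.
move=> /open_discP oU /oU[r r0 rU]; apply/nbhs_ballP; exists r => // s; rewrite /ball /= sub0r normrN => sr.
apply: rU; rewrite /disc /= addrAC subrr add0r modulus_def /= expr0n add0r sqrtr_sqr //.
Qed.

Lemma affine_dxy U u (k a1 a2 : R) : open U -> (forall z, U z -> u z = k + a1 * Re z + a2 * Im z) ->
  [/\ C1_on U u, forall z, U z -> dx u z = a1 & forall z, U z -> dy u z = a2].
Proof.
move=> oU hu.
have lin (c d : R) : is_derive (0 : R^o) (1 : R^o) (fun s : R^o => (c + s * d : R^o)) d.
  have h1 : is_derive (0 : R) 1 (fun s : R => s * d) d := is_derive_scale d 0.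
  have := @is_deriveD _ _ _ (cst c) (fun s : R => s * d) 0 1 0 d (is_derive_cst _ _ _) h1.
  by rewrite add0r.
have hx z : U z -> is_derive (0 : R^o) (1 : R^o) (shift_x u z) a1.
  move=> Uz; apply: (near_eq_is_derive _ (lin (k + a1 * Re z + a2 * Im z) a1)).
  near=> s; rewrite /shift_x hu; last by near: s; exact: near_open_shift_x.
  by rewrite !(ReD, ImD) /=; ring.
have hy z : U z -> is_derive (0 : R^o) (1 : R^o) (shift_y u z) a2.
  move=> Uz; apply: (near_eq_is_derive _ (lin (k + a1 * Re z + a2 * Im z) a2)).
  near=> s; rewrite /shift_y hu; last by near: s; exact: near_open_shift_y.
  by rewrite !(ReD, ImD) /=; ring.
have ex z : U z -> dx u z = a1.
  by move=> /hx[h1 h2]; rewrite /dx derive1E.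
have ey z : U z -> dy u z = a2.
  by move=> /hy[h1 h2]; rewrite /dy derive1E.
have cc (v : C -> R) (a : R) z : U z -> (forall w, U w -> v w = a) -> {for z, continuous v}.
  move=> Uz hv.
  have h : v @ z --> a.
    move=> A Aa; have /open_nbhs_nbhs : open_nbhs z U by split.
    apply: filterS => w Uw; rewrite /= hv //; exact: nbhs_singleton.
  by rewrite -(hv z Uz) in h.
split => // z Uz; split.
- by have [] := hx z Uz.
- by have [] := hy z Uz.
- exact: cc Uz ex.
- exact: cc Uz ey.
Unshelve. all: by end_near. Qed.

Lemma harmonic_linear U u (a1 a2 : R) : open U ->
  (forall z, U z -> u z = a1 * Re z + a2 * Im z) -> harmonic_on U u.
Proof.
move=> oU hu.
have [c1 dx1 dy1] := @affine_dxy U u 0 a1 a2 oU ltac:(by move=> z Uz; rewrite hu // add0r).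
have [c2 dx2 dy2] := @affine_dxy U (dx u) a1 0 0 oU ltac:(by move=> z Uz; rewrite dx1 // !mul0r !addr0).
have [c3 dx3 dy3] := @affine_dxy U (dy u) a2 0 0 oU ltac:(by move=> z Uz; rewrite dy1 // !mul0r !addr0).
by split=> // z Uz; rewrite dx2 // dy3 // addr0.
Qed.

Lemma support_fun_finite Q b : Q !=set0 -> (support_fun Q b < +oo)%E ->
  exists2 H : R, (forall t, Q t -> Re (b * t) <= H) &
    forall e : R, 0 < e -> exists2 t, Q t & H - e < Re (b * t).
Proof.
move=> [t0 Qt0] hb; rewrite /support_fun in hb *.
set S := [set _ | _ in _] in hb.
have S0 : S (Re (b * t0))%:E by exists t0.
have lb : ((Re (b * t0))%:E <= ereal_sup S)%E by exact: ereal_sup_ubound.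
have fn : ereal_sup S \is a fin_num.
  by rewrite fin_numE -ltey hb andbT gt_eqF // (lt_le_trans _ lb) // ltNyr.
exists (fine (ereal_sup S)).
  move=> t Qt; rewrite -lee_fin fineK //; apply: ereal_sup_ubound; by exists t.
move=> e e0; have : ((fine (ereal_sup S) - e)%:E < ereal_sup S)%E.
  by rewrite -[ltRHS]fineK // lte_fin ltrBlDr ltrDl.
by move=> /ereal_sup_gt[_ [t Qt <-]]; rewrite lte_fin; exists t.
Qed.

(* If no such pair existed, the supremum [g] of [Im (b t) - def t / eta] would make
   the support function linear in a sector around [b]. *)
Lemma near_optimal_pair Q b (H : R) : N_set Q b -> Q !=set0 ->
  (forall t, Q t -> Re (b * t) <= H) ->
  (forall e : R, 0 < e -> exists2 t, Q t & H - e < Re (b * t)) ->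
  forall eta : R, 0 < eta -> exists t1 t2, [/\ Q t1, Q t2 &
    (H - Re (b * t1)) + (H - Re (b * t2)) < eta * `|Im (b * t1) - Im (b * t2)|].
Proof.
move=> [ub nb] [t0 Qt0] HQ HQe eta eta0; apply: contrapT => hn.
pose def t := H - Re (b * t).
have def0 t : Q t -> 0 <= def t by move=> /HQ; rewrite /def subr_ge0.
have hle t1 t2 : Q t1 -> Q t2 -> Im (b * t1) - def t1 / eta <= Im (b * t2) + def t2 / eta.
  move=> Q1 Q2; have : eta * `|Im (b * t1) - Im (b * t2)| <= def t1 + def t2.
    by rewrite leNgt; apply/negP => hlt; apply: hn; exists t1, t2.
  rewrite mulrC -ler_pdivlMr // mulrDl => h1.
  by have := le_trans (ler_norm _) h1; lra.
pose S := [set Im (b * t) - def t / eta | t in Q].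
have hS : has_sup S.
  split; first by exists (Im (b * t0) - def t0 / eta), t0.
  by exists (Im (b * t0) + def t0 / eta) => _ [t Qt <-]; exact: hle.
pose g := sup S.
have g1 t : Q t -> Im (b * t) - def t / eta <= g by move=> Qt; apply: sup_upper_bound => //; exists t.
have g2 t : Q t -> g <= Im (b * t) + def t / eta.
  by move=> Qt; apply: ge_sup; [by case: hS|move=> _ [t' Qt' <-]; exact: hle].
(* [X z] and [Y z] are the real and imaginary parts of [z / b]. In the sector where [Y z] is below
   [eta * X z] in absolute value, the defect [def] dominates the deviation of [Im (b * t)] from [g],
   so the support function is [H * X - g * Y]. *)
apply: nb; pose X z := Re z * Re b + Im z * Im b; pose Y z := Im z * Re b - Re z * Im b.
have b2 : Re b ^+ 2 + Im b ^+ 2 = 1 by rewrite -modulus_sqr ub expr1n.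
have dec z t : Re (z * t) = X z * Re (b * t) - Y z * Im (b * t).
  rewrite !ReM !ImM /X /Y -[LHS]mul1r -b2; ring.
have sup z : `|Y z| < eta * X z -> support_fun Q z = (H * X z - g * Y z)%:E.
  move=> hz; have X0 : 0 < X z by rewrite -(pmulr_rgt0 _ eta0); apply: le_lt_trans hz.
  apply/eqP; rewrite eq_le; apply/andP; split.
    apply: ge_ereal_sup => _ [t Qt <-]; rewrite lee_fin dec.
    have : `|Im (b * t) - g| <= def t / eta.
      by rewrite ler_norml; apply/andP; split; have := g1 t Qt; have := g2 t Qt; lra.
    move=> hg; have : - (Y z * (Im (b * t) - g)) <= eta * X z * (def t / eta).
      apply: le_trans (ler_norm _) _; rewrite normrN normrM; apply: ler_pM => //; exact: ltW.
    rewrite (_ : eta * X z * (def t / eta) = X z * def t); last by field; rewrite gt_eqF.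
    rewrite /def; lra.
  apply/lee_addgt0Pr => eps eps0.
  have e3 : 0 < eps / (2 * X z) by pos.
  have [t Qt ht] := HQe _ e3.
  apply: (@le_trans _ _ ((Re (z * t))%:E + eps%:E)%E); last first.
    by apply: leeD2r; apply: ereal_sup_ubound; exists t.
  rewrite -EFinD lee_fin dec.
  have : `|Im (b * t) - g| <= def t / eta.
    by rewrite ler_norml; apply/andP; split; have := g1 t Qt; have := g2 t Qt; lra.
  move=> hg; have : Y z * (Im (b * t) - g) <= eta * X z * (def t / eta).
    apply: le_trans (ler_norm _) _; rewrite normrM; apply: ler_pM => //; exact: ltW.
  rewrite (_ : eta * X z * (def t / eta) = X z * def t); last by field; rewrite gt_eqF.
  have : X z * def t <= X z * (eps / (2 * X z)) by rewrite ler_wpM2l ?(ltW X0) // /def; lra.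
  rewrite (_ : X z * (eps / (2 * X z)) = eps / 2); last by field; rewrite gt_eqF.
  rewrite /def; lra.
pose U : set C := [set z | `|Y z| < eta * X z].
have XB z w : `|X z - X w| <= modulus (z - w) * 2.
  have := normRe_le (z - w); have := normIm_le (z - w); rewrite ReD ImD ReN ImN => h1 h2.
  have := normRe_le b; have := normIm_le b; rewrite ub => h3 h4.
  rewrite (_ : X z - X w = (Re z - Re w) * Re b + (Im z - Im w) * Im b); last by rewrite /X; ring.
  apply: le_trans (ler_normD _ _) _; rewrite !normrM mulr_natr mulr2n; apply: lerD;
    by rewrite -[leRHS]mulr1; apply: ler_pM.
have YB z w : `|Y z - Y w| <= modulus (z - w) * 2.
  have := normRe_le (z - w); have := normIm_le (z - w); rewrite ReD ImD ReN ImN => h1 h2.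
  have := normRe_le b; have := normIm_le b; rewrite ub => h3 h4.
  rewrite (_ : Y z - Y w = (Im z - Im w) * Re b - (Re z - Re w) * Im b); last by rewrite /Y; ring.
  apply: le_trans (ler_normB _ _) _; rewrite !normrM mulr_natr mulr2n; apply: lerD;
    by rewrite -[leRHS]mulr1; apply: ler_pM.
have oU : open U.
  apply/open_discP => z; rewrite /U /= => hz.
  pose r := (eta * X z - `|Y z|) / (2 * (eta + 1)).
  have r0 : 0 < r by rewrite /r divr_gt0 ?subr_gt0 //; pos.
  exists r => // w; rewrite /disc /= => wz.
  have e1 : r * (2 * (eta + 1)) = eta * X z - `|Y z| by rewrite /r divfK // gt_eqF //; pos.
  have x1 := XB w z; have y1 := YB w z.
  have : `|Y w| <= `|Y w - Y z| + `|Y z| by rewrite -{1}(subrK (Y z) (Y w)) ler_normD.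
  have : eta * (X z - X w) <= eta * (r * 2).
    rewrite ler_wpM2l ?(ltW eta0) //; apply: le_trans (ler_norm _) _; rewrite distrC; apply: le_trans x1 _.
    by rewrite ler_wpM2r // ltW.
  have : modulus (w - z) * 2 < r * 2 by rewrite ltr_pM2r.
  lra.
exists U; split => //.
- have -> : U b = (`|Y b| < eta * X b) by [].
  rewrite /Y /X [Im b * Re b]mulrC subrr normr0 -!expr2 b2 mulr1 //.
- by move=> z Uz; rewrite sup.
apply: (@harmonic_linear _ _ (H * Re b + g * Im b) (H * Im b - g * Re b)) => // z Uz.
by rewrite sup //= /X /Y; ring.
Qed.

Let convex_segment_split (sg tau : R) (q x t1 t2 : C) :
  rC sg * q + x + rC (1 - sg) * (rC ((1 + tau) / 2) * t1 + rC (1 - (1 + tau) / 2) * t2) =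
  rC ((1 - sg) / 2) * (t1 + t2) + rC sg * q + rC tau * (rC ((1 - sg) / 2) * (t1 - t2)) + x.
Proof.
set k := (1 - sg) / 2.
have h1 : rC (1 - sg) * rC ((1 + tau) / 2) = rC k + rC tau * rC k.
  by rewrite -!rCM -rCD; congr rC; rewrite /k; field.
have h2 : rC (1 - sg) * rC (1 - (1 + tau) / 2) = rC k - rC tau * rC k.
  by rewrite -!rCM -rCN -rCD; congr rC; rewrite /k; field.
rewrite [rC (1 - sg) * _]mulrDr !(mulrA (rC (1 - sg))) h1 h2; ring.
Qed.

(** The ratio [kap] depends on [Q] and [b] only, and is given before [eta]. A nearly optimal segment
    is contracted towards an interior point by a factor [1 - sg] with [sg] proportional to
    [eta * D]: this costs a defect of that order and wins a neighbourhood of that order. *)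
Lemma geometry Q b : is_convex Q -> interior Q !=set0 -> R_set Q b ->
  exists2 H : R, forall t, Q t -> Re (b * t) <= H &
  exists2 kap : R, 0 < kap /\ kap <= 2^-1 &
  forall eta : R, 0 < eta -> eta <= 2^-1 -> exists t0 d : C, exists D : R,
    [/\ 0 < D /\ D <= 1, D / 4 <= modulus d /\ modulus d <= D, `|Re (b * d)| <= eta * D,
        H - 2 * (eta * D) <= Re (b * t0) &
        forall (tau : R) (x : C), -1 <= tau -> tau <= 1 -> modulus x < 4 * (kap * eta * D) ->
          Q (t0 + rC tau * d + x)].
Proof.
move=> vQ [q iq] [[ub Eb] Nb].
have [rho0 rho00 hrho0] := (nbhs_discP q Q).1 iq.
pose rho := Num.min 1 rho0.
have rhop : 0 < rho by rewrite lt_min ltr01.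
have rho1 : rho <= 1 by rewrite ge_min lexx.
have hrho (x : C) : modulus (x - q) < rho -> Q x.
  by move=> hx; apply: hrho0; apply: lt_le_trans hx _; rewrite ge_min lexx orbT.
have Qq : Q q by apply: hrho; rewrite subrr modulus0.
have Q0 : Q !=set0 by exists q.
have [H HQ HQe] := support_fun_finite Q0 Eb.
exists H => //.
pose Dq := H - Re (b * q) + 1.
have Dq1 : 1 <= Dq by rewrite /Dq lerDr subr_ge0; exact: HQ.
exists (rho / (8 * Dq)).
  split; first by apply: divr_gt0 => //; lra.
  by rewrite ler_pdivrMr; lra.
move=> eta eta0 eta2.
have pair : exists t1 t2, [/\ Q t1, Q t2, 0 < `|Im (b * t1) - Im (b * t2)|, `|Im (b * t1) - Im (b * t2)| <= 1 &
   (H - Re (b * t1)) + (H - Re (b * t2)) <= eta * `|Im (b * t1) - Im (b * t2)| ].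
  have e4 : 0 < eta / 4 by pos.
  have [t1 [t2 [Q1 Q2 h12]]] := near_optimal_pair Nb Q0 HQ HQe e4.
  have d1 := HQ _ Q1; have d2 := HQ _ Q2.
  have n0 : 0 < `|Im (b * t1) - Im (b * t2)|.
    by rewrite -(pmulr_rgt0 _ e4); apply: le_lt_trans h12; lra.
  have [n1|n1] := lerP `|Im (b * t1) - Im (b * t2)| 1.
    exists t1, t2; split => //; have : 0 < eta * `|Im (b * t1) - Im (b * t2)| by pos.
    lra.
  (* A separation above 1 is reduced to 1/2. From a nearly optimal [x] one goes part of the way to
     whichever of [t1], [t2] is farther from it in the imaginary coordinate; the defect of that
     endpoint shrinks in proportion. *)
  have e8 : 0 < eta / 8 by pos.
  have [x Qx hx] := HQe _ e8.
  have [y [Qy hy1 hy2]] : exists y : C, [/\ Q y, `|Im (b * t1) - Im (b * t2)| <= 2 * `|Im (b * y) - Im (b * x)| &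
     H - Re (b * y) <= eta / 4 * `|Im (b * t1) - Im (b * t2)|].
    have tri : `|Im (b * t1) - Im (b * t2)| <= `|Im (b * t1) - Im (b * x)| + `|Im (b * t2) - Im (b * x)|.
      by rewrite (distrC (Im (b * t2))); exact: ler_distD.
    have [hh|hh] := lerP `|Im (b * t1) - Im (b * x)| `|Im (b * t2) - Im (b * x)|.
      by exists t2; split => //; (clear -hh tri d1 h12; lra).
    by exists t1; split => //; (clear -hh tri d2 h12; lra).
  set g := `|Im (b * y) - Im (b * x)| in hy1.
  have g0 : 0 < g by lra.
  pose tau := (2 * g)^-1.
  have tau0 : 0 < tau by rewrite /tau; pos.
  have tau1 : tau <= 1 by rewrite /tau invf_le1; [lra|pos].
  pose z := rC tau * y + rC (1 - tau) * x.
  have Qz : Q z by apply: convexC => //; exact: ltW.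
  have rz : Re (b * z) = tau * Re (b * y) + (1 - tau) * Re (b * x).
    by rewrite /z !(ReM, ImM, ReD, ImD, RerC, ImrC); ring.
  have iz : Im (b * z) - Im (b * x) = tau * (Im (b * y) - Im (b * x)).
    by rewrite /z !(ReM, ImM, ReD, ImD, RerC, ImrC); ring.
  have nz : `|Im (b * z) - Im (b * x)| = 2^-1.
    by rewrite iz normrM -/g (ger0_norm (ltW tau0)) /tau; field; rewrite gt_eqF.
  exists z, x; rewrite nz; split => //; first by rewrite invf_le1 // ler1n.
  have ty : tau * (H - Re (b * y)) <= eta / 4.
    apply: (@le_trans _ _ (tau * (eta / 4 * (2 * g)))).
      rewrite ler_wpM2l ?(ltW tau0) //; apply: le_trans hy2 _.
      by rewrite ler_wpM2l // ltW.
    by apply: eq_leR; rewrite /tau; field; rewrite gt_eqF.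
  have : (1 - tau) * (H - Re (b * x)) <= 1 * (eta / 8).
    have hQx := HQ _ Qx; apply: ler_pM; (clear -hQx hx tau0 tau1 e8; lra).
  rewrite rz; (clear -ty hx; lra).
have [t1 [t2 [Q1 Q2 D0 D1 hD]]] := pair.
set D := `|Im (b * t1) - Im (b * t2)| in D0 D1 hD.
have d1 := HQ _ Q1; have d2 := HQ _ Q2.
(* With [kap = rho / (8 * Dq)] the product [sg * rho] is exactly [4 * (kap * eta * D)], and the
   defect added by [q] is at most [eta * D / 2]. *)
pose sg := eta * D / (2 * Dq).
have Dq0 : 0 < Dq by lra.
have etaD : 0 < eta * D by pos.
have sg0 : 0 < sg by rewrite /sg; apply: divr_gt0 => //; lra.
have sgD : sg * (2 * Dq) = eta * D by rewrite /sg divfK // gt_eqF //; lra.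
have etaD2 : eta * D <= 2^-1 * 1 by apply: ler_pM => //; exact: ltW.
have sg4 : sg <= 4^-1.
  by rewrite /sg ler_pdivrMr; (clear -etaD2 Dq1; lra).
pose d := rC ((1 - sg) / 2) * (t1 - t2).
pose t0 := rC ((1 - sg) / 2) * (t1 + t2) + rC sg * q.
exists t0, d, D.
have rd : Re (b * d) = (1 - sg) / 2 * (Re (b * t1) - Re (b * t2)).
  by rewrite /d !(ReM, ImM, ReD, ImD, ReN, ImN, RerC, ImrC); ring.
have id : Im (b * d) = (1 - sg) / 2 * (Im (b * t1) - Im (b * t2)).
  by rewrite /d !(ReM, ImM, ReD, ImD, ReN, ImN, RerC, ImrC); ring.
have md : modulus d = modulus (b * d) by rewrite modulusM ub mul1r.
have nid : `|Im (b * d)| = (1 - sg) / 2 * D by rewrite id normrM -/D ger0_norm //; (clear -sg4; lra).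
have sD : sg * D <= 4^-1 * D by rewrite ler_wpM2r // ltW.
have sD0 : 0 < sg * D by pos.
have nrd : `|Re (b * d)| <= eta * D / 2.
  rewrite rd normrM ger0_norm; last by (clear -sg4; lra).
  have : `|Re (b * t1) - Re (b * t2)| <= eta * D.
    by rewrite ler_norml; apply/andP; split; (clear -d2 hD d1; lra).
  move=> hh; have : (1 - sg) / 2 * `|Re (b * t1) - Re (b * t2)| <= 2^-1 * (eta * D).
    by apply: ler_pM => //; (clear -sg4 sg0; lra).
  (clear -R; lra).
have eD : eta * D <= 2^-1 * D by rewrite ler_wpM2r // ltW.
split.
- by [].
- rewrite md; split.
    apply: le_trans (normIm_le _); rewrite nid; (clear -sD D0; lra).
  apply: le_trans (modulus_le _) _; rewrite nid; (clear -eD nrd sD0 D0; lra).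
- (clear -nrd d2 d1 hD; lra).
- have -> : Re (b * t0) = (1 - sg) / 2 * (Re (b * t1) + Re (b * t2)) + sg * Re (b * q).
    by rewrite /t0 !(ReM, ImM, ReD, ImD, ReN, ImN, RerC, ImrC); ring.
  have : sg * (H - Re (b * q)) <= sg * Dq by rewrite ler_wpM2l ?(ltW sg0) // /Dq; (clear -R; lra).
  have : (1 - sg) / 2 * ((H - Re (b * t1)) + (H - Re (b * t2))) <= 1 * (eta * D).
    by apply: ler_pM => //; (clear -sg4 d2 d1 sg0; lra).
  (clear -sgD d2 d1 hD; lra).
move=> tau x tau1 tau2 hx.
(* The perturbation [x] is carried entirely by the interior point: [y2] is [q] moved by [x / sg],
   which stays in the disc of radius [rho]. *)
pose y1 := rC ((1 + tau) / 2) * t1 + rC (1 - (1 + tau) / 2) * t2.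
pose y2 := q + rC sg^-1 * x.
have Qy1 : Q y1 by apply: convexC => //; (clear -tau1 tau2; lra).
have Qy2 : Q y2.
  apply: hrho; rewrite /y2 addrAC subrr add0r modulusM modulus_rC ger0_norm ?invr_ge0 ?(ltW sg0) //.
  rewrite mulrC ltr_pdivrMr // mulrC; apply: lt_le_trans hx _.
  by apply: eq_leR; rewrite /sg; field; rewrite gt_eqF.
have sg1 : sg <= 1 by (clear -sg4; lra).
have := convexC vQ Qy2 Qy1 (ltW sg0) sg1.
have -> : rC sg * y2 + rC (1 - sg) * y1 = t0 + rC tau * d + x.
  have e1 : rC sg * (rC sg^-1 * x) = x.
    by rewrite mulrA -rCM divff ?gt_eqF // rC1 mul1r.
  rewrite /y2 /y1 /t0 /d mulrDr e1.
  exact: convex_segment_split.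
by [].
Qed.

End Geometry.

(** * Exponential sums from powers of the hyperbolic cosine *)

Section CoshPower.
Variable R : realType.
Local Notation C := (Cx R).
Implicit Types (z w v b d t : C) (x y r s q kap dl c D H : R).

Lemma expR1_le4 : expR 1 <= 4 :> R.
Proof.
have h : expR 2^-1 <= 2 :> R by exact: expR_le2.
have -> : (1 : R) = 2^-1 + 2^-1 by lra.
by rewrite expRD; have := expR_gt0 (2^-1 : R); nra.
Qed.

(** The remainder of order four of the exponential at [i y] is at most [4 * y ^ 4 / 24], hence at
    most [y ^ 2 / 6]. *)
Lemma cos_le_sqr y : `|y| <= 1 -> 0 <= cos y /\ cos y <= 1 - y ^+ 2 / 4.
Proof.
move=> y1; have y2 : y ^+ 2 <= 1 by rewrite -[y ^+ 2]ger0_norm ?sqr_ge0 // normrX exprn_ile1.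
have := cexp_sum_bound 4 (iC R * rC y); rewrite modulusM modulus_iC mul1r modulus_rC.
have -> : `|y| ^+ 4 = (y ^+ 2) ^+ 2 by rewrite -exprM -normrX ger0_norm // (exprM y 2 2) sqr_ge0.
move=> h; have {h} := le_trans (normRe_le _) h.
have -> : Re (cexp (iC R * rC y) - cexp_sum 4 (iC R * rC y)) = cos y - (1 - y ^+ 2 / 2).
  rewrite /cexp_sum !big_nat_recr //= big_geq // add0r.
  rewrite !factE -(rC_nat R 2) -(rC_nat R 6) -!rCV !exprS ?expr0 ?invr1 ?mulr1.
  rewrite !(ReM, ImM, ReD, ImD, ReN, ImN, RerC, ImrC, ReiC, ImiC, Re_cexp, Im_cexp, Re1, Im1).
  rewrite !mul0r !mul1r !subr0 !add0r expR0; by field.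
have e4 : expR `|y| <= 4 by apply: le_trans expR1_le4; rewrite ler_expR.
have -> : (4`!)%:R = 24 :> R by rewrite !factE.
move=> h; have {h} : `|cos y - (1 - y ^+ 2 / 2)| <= y ^+ 2 / 6.
  apply: le_trans h _; have yy := sqr_ge0 y.
  have : (y ^+ 2) ^+ 2 <= y ^+ 2 by rewrite [leLHS]expr2; move: yy y2; move: (y ^+ 2) => a; nra.
  have := expR_ge0 `|y|; nra.
by rewrite ler_norml => /andP[]; split; lra.
Qed.

Definition coshc v : C := (cexp v + cexp (- v)) * rC 2^-1.

Let coshc_sqr_le x y q : 0 <= y -> y <= x -> 0 <= q -> q <= 1 ->
  ((x + y) / 2) ^+ 2 * q ^+ 2 + ((x - y) / 2) ^+ 2 * (1 - q ^+ 2) <= ((x - y) / 2 + y * q) ^+ 2.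
Proof.
move=> y0 xy q0 q1; rewrite -subr_ge0.
rewrite (_ : _ - _ = (x - y) * y * (q * (1 - q))); last by field.
by apply: mulr_ge0; apply: mulr_ge0 => //; lra.
Qed.

(** With [x = |Re v|], the right side interpolates linearly in [|cos (Im v)|] between [sinh x] at 0
    and [cosh x] at 1, the exact values there. *)
Lemma modulus_coshc v :
  modulus (coshc v) <= (expR `|Re v| - expR (- `|Re v|)) / 2 + expR (- `|Re v|) * `|cos (Im v)|.
Proof.
have E0 := expR_gt0 (- `|Re v|).
have EF : expR (- `|Re v|) <= expR `|Re v| by rewrite ler_expR; have := normr_ge0 (Re v); lra.
apply: modulus_le_sqr.
  have := normr_ge0 (cos (Im v)); move: E0 EF; nra.
have -> : Re (coshc v) ^+ 2 + Im (coshc v) ^+ 2 =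
   ((expR (Re v) + expR (- Re v)) / 2) ^+ 2 * cos (Im v) ^+ 2 +
   ((expR (Re v) - expR (- Re v)) / 2) ^+ 2 * sin (Im v) ^+ 2.
  rewrite /coshc !(ReM, ImM, ReD, ImD, RerC, ImrC, Re_cexp, Im_cexp, ReN, ImN) cosN sinN; by field.
have -> : sin (Im v) ^+ 2 = 1 - `|cos (Im v)| ^+ 2.
  by rewrite real_normK ?num_real // -(cos2Dsin2 (Im v)) addrC addKr.
rewrite -[cos (Im v) ^+ 2]real_normK ?num_real //.
have c0 := normr_ge0 (cos (Im v)).
have c1 : `|cos (Im v)| <= 1 by rewrite ler_norml cos_geN1 cos_le1.
have [x0|x0] := leP 0 (Re v).
  rewrite (ger0_norm x0) in E0 EF *; exact: coshc_sqr_le (ltW E0) EF c0 c1.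
rewrite (ltr0_norm x0) opprK in E0 EF *.
rewrite [_ + expR (- _)]addrC -[X in (X / 2) ^+ 2 * (1 - _)]opprB mulNr sqrrN.
exact: coshc_sqr_le (ltW E0) EF c0 c1.
Qed.

Lemma modulus_coshc_le v : modulus (coshc v) <= expR `|Re v|.
Proof.
apply: le_trans (modulus_coshc v) _.
have E0 := expR_gt0 (- `|Re v|).
have EF : expR (- `|Re v|) <= expR `|Re v| by rewrite ler_expR; have := normr_ge0 (Re v); lra.
have c0 := normr_ge0 (cos (Im v)).
have c1 : `|cos (Im v)| <= 1 by rewrite ler_norml cos_geN1 cos_le1.
nra.
Qed.

(** If [Im v] is large, the cosine has dropped below [1 - q ^+ 2]; if [Re v] is large,
    [exp(- |Re v|)] is small against [exp |Re v|]. The bound on [Im v] excludes the neighbourhoods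
    of the nonzero multiples of [i pi], where the modulus of the cosine returns to 1. *)
Lemma coshc_contract q v : 0 < q -> q <= 2^-1 -> `|Im v| <= 1 ->
  2 * q <= `|Im v| \/ 2 * q ^+ 2 <= `|Re v| ->
  (1 + q ^+ 2) * modulus (coshc v) <= expR `|Re v|.
Proof.
move=> q0 q2 v1 hv; set c := q ^+ 2.
have c0 : 0 < c by rewrite /c; pos.
have c4 : c <= 4^-1 by rewrite /c; nra.
have [cy0 cy1] := cos_le_sqr v1.
have := modulus_coshc v; rewrite (ger0_norm cy0).
have E0 := expR_gt0 (- `|Re v|).
have EF : expR (- `|Re v|) <= expR `|Re v| by rewrite ler_expR; have := normr_ge0 (Re v); lra.
case: hv => hv.
  have qy : c <= Im v ^+ 2 / 4 by rewrite -[Im v ^+ 2]real_normK ?num_real // /c; nra.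
  have : cos (Im v) <= 1 - c by lra.
  move: (modulus _) (cos (Im v)) cy0 => m a a0 ha hm.
  move: (expR _) (expR _) E0 EF hm => E F *.
  have : F * a <= F * (1 - c) by rewrite ler_wpM2l // ltW.
  nra.
have : cos (Im v) <= 1 by exact: cos_le1.
have h4 : expR `|Re v| * (1 - c) >= expR (- `|Re v|) * (1 + c).
  have : 1 + 2 * `|Re v| <= expR (2 * `|Re v|) by exact: expR_ge1Dx.
  have -> : expR `|Re v| = expR (- `|Re v|) * expR (2 * `|Re v|) by rewrite -expRD; congr expR; ring.
  move: (expR (2 * _)) (expR (- _)) E0 => E2 F F0 hE.
  by rewrite -mulrA ler_wpM2l ?(ltW F0) //; move: hE hv; rewrite -/c; nra.
move: (modulus _) (cos (Im v)) cy0 => m a a0 ha hm.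
move: (expR _) (expR _) E0 EF hm h4 => E F *.
have : (1 + c) * m <= (1 + c) * ((E + F) / 2) by rewrite ler_wpM2l //; nra.
lra.
Qed.

Lemma coshc_expn N v :
  coshc v ^+ N = \sum_(0 <= k < N.+1) (rC 2^-1 ^+ N * 'C(N, k)%:R) * cexp (rC (N%:R - 2 * k%:R) * v).
Proof.
rewrite /coshc exprMn exprDn mulrC mulr_sumr big_mkord; apply: eq_bigr => i _.
rewrite -(mulr_natl _ 'C(N, i)) -[RHS]mulrA; congr (_ * (_ * _)).
rewrite -!cexp_natM -cexpD; congr cexp.
have iN : (i <= N)%N by rewrite -ltnS.
rewrite natrB // mulrN -mulNr -mulrDl rCD rCN rCM !rC_nat; congr (_ * _); ring.
Qed.

(* The factor [1 + c] makes [F (r b)] large where the argument of [coshc] is nearly [0];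
   elsewhere [coshc_contract] absorbs it. *)
Definition test_fun (N : nat) c t d s w : C :=
  cexp (w * t) * (rC (1 + c) * coshc ((w * d - iC R * rC s) * rC N%:R^-1)) ^+ N.

Lemma test_fun_sum N c t d s : (0 < N)%N -> exists a : nat -> C, exists tau : nat -> R,
  (forall k, (k < N.+1)%N -> -1 <= tau k /\ tau k <= 1) /\
  forall w, test_fun N c t d s w = \sum_(0 <= k < N.+1) a k * cexp (w * (t + rC (tau k) * d)).
Proof.
move=> N0; have NR : 0 < N%:R :> R by rewrite ltr0n.
pose tau k := (N%:R - 2 * k%:R) / N%:R : R.
exists (fun k => rC (1 + c) ^+ N * (rC 2^-1 ^+ N * 'C(N, k)%:R) * cexp (- (iC R * rC (tau k * s)))), tau.
split.
  move=> k kN; have : k%:R <= N%:R :> R by rewrite ler_nat -ltnS.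
  by rewrite /tau ler_pdivlMr // ler_pdivrMr //; have := ler0n R k; lra.
move=> w; rewrite /test_fun exprMn coshc_expn mulrA mulr_sumr; apply: eq_bigr => k _.
rewrite -!mulrA mulrCA; congr (_ * _); rewrite mulrCA; congr (_ * _); rewrite mulrCA; congr (_ * _).
rewrite -!cexpD; congr cexp; rewrite /tau !rCM.
rewrite (_ : rC (N%:R - 2 * k%:R) * ((w * d - iC R * rC s) * rC N%:R^-1) =
  rC (N%:R - 2 * k%:R) * rC N%:R^-1 * (w * d - iC R * rC s)); ring.
Qed.

Lemma modulus_test_fun N c t d s w : 0 <= c -> modulus (test_fun N c t d s w) =
  expR (Re (w * t)) * ((1 + c) * modulus (coshc ((w * d - iC R * rC s) * rC N%:R^-1))) ^+ N.
Proof.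
move=> c0; rewrite /test_fun modulusM modulus_cexp modulusX modulusM modulus_rC ger0_norm //.
by rewrite addr_ge0.
Qed.

Let ReV N d s w : (0 < N)%N ->
  expR `|Re ((w * d - iC R * rC s) * rC N%:R^-1)| ^+ N = expR `|Re (w * d)|.
Proof.
move=> N0; have NR : 0 < N%:R :> R by rewrite ltr0n.
rewrite -expRM_natl; congr expR.
rewrite [Re (_ * rC _)]ReM [Re (_ - _)]ReD ReN [Re (iC R * _)]ReM RerC !ImrC ReiC ImiC.
rewrite mul0r mul1r !subr0 mulr0 subr0 normrM [ `|N%:R^-1| ]ger0_norm ?invr_ge0 ?ler0n //.
by rewrite mulrCA divff ?mulr1 // gt_eqF.
Qed.

Let ImV N d s w :
  Im ((w * d - iC R * rC s) * rC N%:R^-1) = (Im (w * d) - s) / N%:R.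
Proof.
by move: (w * d) => e; rewrite !(ImM, ReM, ImD, ReD, ImN, ReN, ImrC, RerC, ReiC, ImiC); ring.
Qed.

Lemma test_fun_le N c t d s w : (0 < N)%N -> 0 <= c ->
  modulus (test_fun N c t d s w) <= expR (c * N%:R + Re (w * t) + `|Re (w * d)|).
Proof.
move=> N0 c0; rewrite modulus_test_fun // -addrA addrCA expRD.
apply: ler_wpM2l; first exact: expR_ge0.
rewrite expRD -(ReV _ s _ N0) [c * _]mulrC expRM_natl -exprMn; apply: lerXn2r; rewrite ?nnegrE.
- by pos.
- by pos.
apply: ler_pM; [by pos|by []|exact: expR_ge1Dx|exact: modulus_coshc_le].
Qed.

Lemma test_fun_le_contract N c t d s w : (0 < N)%N -> 0 <= c ->
  (1 + c) * modulus (coshc ((w * d - iC R * rC s) * rC N%:R^-1)) <=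
    expR `|Re ((w * d - iC R * rC s) * rC N%:R^-1)| ->
  modulus (test_fun N c t d s w) <= expR (Re (w * t) + `|Re (w * d)|).
Proof.
move=> N0 c0 h; rewrite modulus_test_fun // expRD.
apply: ler_wpM2l; first exact: expR_ge0.
rewrite -(ReV _ s _ N0); apply: lerXn2r; rewrite ?nnegrE; by pos.
Qed.

Lemma expR_half_le1D c : 0 <= c -> c <= 1 -> expR (c / 2) <= 1 + c.
Proof.
move=> c0 c1; have h : 1 - c / 2 <= expR (- (c / 2)) by apply: expR_ge1Dx.
rewrite -[expR _]invrK -expRN -[leRHS]invrK lef_pV2 ?posrE ?expR_gt0 ?invr_gt0; last by lra.
apply: le_trans h; rewrite -div1r ler_pdivrMr; first nra.
  lra.
by [].
Qed.

(** The shift [s] is the imaginary part of [r b d], so at [r b] the argument of [coshc] is real and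
    its value at least 1; what remains is [1 + c >= exp(c / 2)]. *)
Lemma test_fun_ge N c t d r b : (0 < N)%N -> 0 <= c -> c <= 1 ->
  expR (c / 2 * N%:R + r * Re (b * t)) <=
  modulus (test_fun N c t d (Im (rC r * b * d)) (rC r * b)).
Proof.
move=> N0 c0 c1; rewrite modulus_test_fun // addrC expRD.
have -> : Re (rC r * b * t) = r * Re (b * t) by rewrite -mulrA [LHS]ReM RerC ImrC mul0r subr0.
apply: ler_wpM2l; first exact: expR_ge0.
rewrite [c / 2 * _]mulrC expRM_natl; apply: lerXn2r; rewrite ?nnegrE; [by pos|by pos|].
apply: le_trans (expR_half_le1D c0 c1) _; rewrite ler_peMr ?addr_ge0 //.
apply: le_trans (Re_le _).
set v := (_ * rC N%:R^-1).
have Iv : Im v = 0.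
  rewrite /v [Im (_ * rC _)]ImM [Im (_ - _)]ImD ImN [Im (iC R * _)]ImM ImrC RerC ReiC ImiC RerC.
  by rewrite mul1r mul0r add0r subrr mul0r mulr0 addr0.
rewrite /coshc [Re (_ * rC _)]ReM ReD !Re_cexp !ReN !ImN Iv oppr0 cos0 ImrC RerC !mulr1 mulr0 subr0.
have := expR_ge1Dx (Re v); have := expR_ge1Dx (- Re v); lra.
Qed.

(** If the last two alternatives fail, then [modulus v] is at most [4 * q]. Multiplied by [N], this
    bounds the distance from [w d] to [i s], and that of [r b d] to [i s] is at most [eta * X];
    division by [modulus d] puts [w] in the disc. *)
Lemma coshc_dichotomy N q t d b w r dl D X eta : (0 < N)%N -> 0 < q -> q <= 2^-1 ->
  0 < r -> 0 < D -> modulus b = 1 -> D / 4 <= modulus d -> X = r * D ->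
  `|Re (b * d)| <= eta * D -> 4 * q * N%:R + eta * X <= dl * X / 4 ->
  let v := (w * d - iC R * rC (Im (rC r * b * d))) * rC N%:R^-1 in
  [\/ modulus (w - rC r * b) <= dl * r, 1 < `|Im v| | (1 + q ^+ 2) * modulus (coshc v) <= expR `|Re v|].
Proof.
move=> N0 q0 q2 r0 D0 ub dD eX hbd hN v; have NR : 0 < N%:R :> R by rewrite ltr0n.
have [v1|v1] := ltP 1 `|Im v|; first by constructor 2.
have [v2|v2] := leP (2 * q) `|Im v|; first by constructor 3; apply: coshc_contract => //; left.
have [v3|v3] := leP (2 * q ^+ 2) `|Re v|; first by constructor 3; apply: coshc_contract => //; right.
constructor 1.
set u := w * d - iC R * rC (Im (rC r * b * d)).
have mv : modulus v <= 4 * q by apply: le_trans (modulus_le _) _; nra.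
have mu : modulus u <= 4 * q * N%:R.
  by move: mv; rewrite /v modulusM modulus_rC ger0_norm ?invr_ge0 ?ler0n // ler_pdivrMr.
have mr : modulus (rC r * b * d - iC R * rC (Im (rC r * b * d))) <= eta * X.
  have -> : rC r * b * d - iC R * rC (Im (rC r * b * d)) = rC r * rC (Re (b * d)).
    rewrite -[rC r * b * d]mulrA; move: (b * d) => e.
    by apply: CxP; rewrite !(ReM, ImM, ReD, ImD, ReN, ImN, RerC, ImrC, ReiC, ImiC); ring.
  rewrite modulusM !modulus_rC gtr0_norm // eX mulrCA; apply: ler_wpM2l => //; exact: ltW.
have h : modulus (w - rC r * b) * modulus d <= dl * X / 4.
  rewrite -modulusM mulrBl; apply: le_trans hN.
  apply: le_trans (modulus_triangle _ (iC R * rC (Im (rC r * b * d))) _) _.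
  by apply: lerD => //; rewrite modulus_distC.
have : modulus (w - rC r * b) * (D / 4) <= dl * X / 4.
  by apply: le_trans h; rewrite ler_wpM2l.
by rewrite eX !mulrA ler_pM2r ?invr_gt0 // ler_pM2r.
Qed.

(* [F] is [test_fun] with [1 + c = 1 + (kap * (dl * p)) ^+ 2]: large at [r b], and outside
   the disc of radius [dl r] around it hardly larger than the support function of the
   segment [t - d, t + d] of its frequencies allows. *)
Lemma test_functional kap dl (p : R) b d t D H eta :
  0 < kap -> kap <= 2^-1 -> 0 < dl -> dl <= 2^-1 -> 0 < p -> 16 * (16 * (8 * p)) <= 1 ->
  modulus b = 1 -> 0 < D -> D <= 1 -> D / 4 <= modulus d -> modulus d <= D ->
  eta = 4 * (kap * (dl * p) ^+ 2) ->
  `|Re (b * d)| <= eta * D -> H - 2 * (eta * D) <= Re (b * t) ->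
  forall r, kap <= 32 * (r * D) ->
  exists n : nat, exists a : nat -> C, exists tau : nat -> R,
    let F w := \sum_(0 <= k < n) a k * cexp (w * (t + rC (tau k) * d)) in
    [/\ forall k, (k < n)%N -> -1 <= tau k /\ tau k <= 1,
        expR (r * (H + 2 * (eta * D))) <= modulus (F (rC r * b)),
        forall w, dl * r < modulus (w - rC r * b) ->
          modulus (F w) <= expR (Re (w * t) + `|Re (w * d)| + kap * eta * D / 2 * modulus w) &
        forall w, modulus (w - rC r * b) <= dl * r ->
          modulus (F w) <= expR (dl * modulus w + Re (w * t) + `|Re (w * d)|)].
Proof.
move=> kap0 kap2 dl0 dl2 p0 p1 ub D0 D1 dD1 dD2 eeta hbd ht r hr.
have X0 : 0 < r * D by lra.
have r0 : 0 < r by rewrite -(pmulr_lgt0 _ D0).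
(* Thus [N * kap] lies between [32 r D] and [64 r D]. As [eta * kap = 4 * q ^+ 2], the product
   [q ^+ 2 * N] lies between [8] and [16] times [eta * r * D]: half of it covers the defect
   [2 * eta * D] and leaves the same amount as gain. *)
pose N := Num.truncn (64 * (r * D) / kap).
have LX0 : 0 <= 64 * (r * D) / kap by apply: divr_ge0; lra.
have /andP[N1 N2] : (N%:R <= 64 * (r * D) / kap) && (64 * (r * D) / kap < N.+1%:R) by exact: truncn_itv.
have N0 : (0 < N)%N.
  rewrite lt0n; apply/eqP => N00; move: N2; rewrite N00 ltr_pdivrMr //; lra.
clearbody N.
move: N1 N2; rewrite ler_pdivlMr // ltr_pdivrMr // -[N.+1%:R](natr1 N) => N1 N2.
have NR : 1 <= N%:R :> R by rewrite ler1n.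
have N3 : 32 * (r * D) <= N%:R * kap by nra.
pose q := kap * (dl * p).
have dp : 0 < dl * p by pos.
have dp1 : 16 * (16 * (8 * (dl * p))) <= dl by rewrite !(mulrCA _ dl) ger_pMr.
have q0 : 0 < q by rewrite /q; pos.
have qdp : q <= 2^-1 * (dl * p) by rewrite /q ler_pM2r.
have q2 : q <= 2^-1 by (clear -qdp dp1 dl2; lra).
have c0 : 0 < q ^+ 2 by pos.
have c1 : q ^+ 2 <= 1 by apply: exprn_ile1; (clear -q0 qdp dp1 dl2; lra).
have eta0 : 0 < eta by rewrite eeta; pos.
have eta1 : eta * kap = 4 * q ^+ 2 by rewrite eeta /q; ring.
have eta2 : 32 * eta <= dl.
  have : kap * (dl * p) ^+ 2 <= 2^-1 * (dl * p) by move: (dl * p) dp dp1 => e *; nra.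
  (clear -dp1 eeta dl0; lra).
have cN2 : q ^+ 2 * N%:R <= 16 * (eta * (r * D)).
  have : eta * (N%:R * kap) <= eta * (64 * (r * D)) by rewrite ler_pM2l.
  rewrite [eta * (N%:R * kap)]mulrCA eta1; (clear -R; lra).
have cN1 : 4 * (eta * (r * D)) <= q ^+ 2 / 2 * N%:R.
  have : eta * (32 * (r * D)) <= eta * (N%:R * kap) by rewrite ler_pM2l.
  rewrite [eta * (N%:R * kap)]mulrCA eta1; (clear -R; lra).
have qN : 4 * q * N%:R + eta * (r * D) <= dl * (r * D) / 4.
  have : dl * p * (N%:R * kap) <= dl * p * (64 * (r * D)) by rewrite ler_pM2l // ltW.
  have : 16 * (16 * (8 * (dl * p))) * (r * D) <= dl * (r * D) by rewrite ler_pM2r.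
  have : 32 * eta * (r * D) <= dl * (r * D) by rewrite ler_pM2r.
  rewrite (_ : 4 * q * N%:R = 4 * (dl * p * (N%:R * kap))); [(clear -cN1 cN2; lra)|by rewrite /q; ring].
clearbody q.
pose s := Im (rC r * b * d).
have [a [tau [htau hF]]] := test_fun_sum (q ^+ 2) t d s N0.
exists N.+1, a, tau => F; split => //.
- rewrite /F -hF; apply: le_trans (test_fun_ge t d r b N0 (ltW c0) c1); rewrite ler_expR.
  have : r * (H - 2 * (eta * D)) <= r * Re (b * t) by rewrite ler_pM2l.
  (clear -cN1; lra).
- move=> w hw; rewrite /F -hF.
  have := coshc_dichotomy t w N0 q0 q2 r0 D0 ub dD1 erefl hbd qN.
  case=> [|hv|hv]; first by rewrite leNgt hw.
    apply: le_trans (test_fun_le t d s w N0 (ltW c0)) _; rewrite ler_expR.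
    suff : q ^+ 2 * N%:R <= kap * eta * D / 2 * modulus w by (clear -R; lra).
    (* Only a large [w] can push the imaginary part beyond 1: [N <= modulus w * D + r * D], where
       [r * D] is small against [N], so [N] is at most [2 * modulus w * D] and the excess fits in
       the tolerance. *)
    have hN : N%:R <= modulus w * D + r * D.
      have : `|Im (w * d)| <= modulus w * D.
        by apply: le_trans (normIm_le _) _; rewrite modulusM ler_wpM2l.
      have : `|s| <= r * D.
        apply: le_trans (normIm_le _) _; rewrite !modulusM ub modulus_rC gtr0_norm // mulr1.
        by rewrite ler_pM2l.
      move: hv; rewrite ImV normrM [ `|N%:R^-1| ]ger0_norm ?invr_ge0 ?ler0n //.
      rewrite ltr_pdivlMr ?ltr0n // mul1r => h *.
      by have := ler_normB (Im (w * d)) s; lra.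
    have : N%:R * kap <= N%:R * 2^-1 by rewrite ler_wpM2l.
    move=> hN3; have hN2 : N%:R <= 2 * (modulus w * D) by (clear -hN3 hN N2 hr kap0; lra).
    have : q ^+ 2 * N%:R <= q ^+ 2 * (2 * (modulus w * D)) by rewrite ler_pM2l.
    have : kap * eta * D / 2 * modulus w = eta * kap * (modulus w * D) / 2 by ring.
    rewrite eta1; (clear -R; lra).
  apply: le_trans (test_fun_le_contract t N0 (ltW c0) hv) _; rewrite ler_expR lerDl.
  by pos.
move=> w hw; rewrite /F -hF; apply: le_trans (test_fun_le t d s w N0 (ltW c0)) _; rewrite ler_expR.
suff : q ^+ 2 * N%:R <= dl * modulus w by (clear -R; lra).
have hr2 : dl * r <= r / 2 by nra.
have : r <= 2 * modulus w.
  have := modulus_triangle (rC r * b) w 0; rewrite !subr0 modulus_distC modulusM ub modulus_rC gtr0_norm // mulr1.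
  (clear -hr2 hw; lra).
have : eta * (r * D) <= eta * r by rewrite ler_pM2l // ger_pMr.
have : 32 * eta * modulus w <= dl * modulus w by rewrite ler_wpM2r.
move=> h1 h2 h3; have : eta * r <= eta * (2 * modulus w) by rewrite ler_pM2l.
(clear -h2 h1 cN2; lra).
Qed.

End CoshPower.

(** * Germs, the inductive limit topology, and bounds for [mu] *)

Section Germs.
Variable R : realType.
Local Notation C := (Cx R).
Local Notation mink := (@Defs.minkowski R).
Implicit Types (M G K Q : set C) (f g u : C -> C) (z w t c : C) (x y r e eta : R).

Lemma near_analyticP M f : reflect (exists G, [/\ open G, M `<=` G & analytic_on G f]) (f \in near_analytic M).
Proof. exact: asboolP. Qed.

Lemma val_germ_fun M f : f \in near_analytic M -> nearfun_val (insubd (0 : nearfun M) f) = f.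
Proof. exact: insubdK. Qed.

Lemma nearfun_inj M (h k : nearfun M) : nearfun_val h = nearfun_val k -> h = k.
Proof. exact: val_inj. Qed.

Lemma near_analytic0 M : (fun=> 0) \in near_analytic M.
Proof. by have [h _] := near_analytic_submod M; exact: h. Qed.

Lemma germ_of0 M : germ_of M (fun=> 0) = 0.
Proof.
have -> : germ_of M (fun=> 0) = germ_pi 0.
  by rewrite /germ_of; congr germ_pi; apply: nearfun_inj; rewrite val_germ_fun //; exact: near_analytic0.
by apply: (@addrI _ (germ_pi 0)); rewrite -germ_piD !addr0.
Qed.

Lemma germ_of_lin M f g c : f \in near_analytic M -> g \in near_analytic M ->
  germ_of M (fun z => c * f z + g z) = c *: germ_of M f + germ_of M g.
Proof.
move=> hf hg.
have hfg : (fun z => c * f z + g z) \in near_analytic M.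
  have [_ h] := near_analytic_submod M; exact: (h c f g hf hg).
rewrite /germ_of; transitivity (germ_pi (c *: insubd (0 : nearfun M) f + insubd 0 g)).
  congr germ_pi; apply: nearfun_inj; rewrite val_germ_fun //.
  by apply/funext => z; rewrite /= val_germ_fun // val_germ_fun.
by rewrite germ_piD germ_pi_scale.
Qed.

Lemma germ_of_eq M f g : f \in near_analytic M -> g \in near_analytic M ->
  germ_of M f = germ_of M g -> forall z, M z -> f z = g z.
Proof.
move=> hf hg /germ_pi_eq/asboolP h z Mz.
have /nbhs_singleton := h z Mz; rewrite /= => h0; apply/eqP; rewrite -subr_eq0; apply/eqP.
by rewrite -[RHS]h0 /= !val_germ_fun.
Qed.

(** A function that is not analytic near [M] is sent to the zero germ. This treats the default
    branch of [germ_of] inside [conv_op]. *)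
Lemma germ_of_default M f g : f \notin near_analytic M -> g \in near_analytic M ->
  germ_of M f = germ_of M g -> forall z, M z -> g z = 0.
Proof.
move=> hf hg; have -> : germ_of M f = germ_of M (fun=> 0).
  rewrite /germ_of; congr germ_pi; rewrite /insubd insubN //=; apply: nearfun_inj.
  rewrite val_germ_fun //; exact: near_analytic0.
have h0 : (fun=> 0) \in near_analytic M by exact: near_analytic0.
by move=> /(germ_of_eq h0 hg) h z /h.
Qed.

Lemma germ_set0 (a b : germ set0) : a = b :> germ (set0 : set C).
Proof.
rewrite -[a]germ_reprK -[b]germ_reprK; apply/germ_pi_eq/asboolP => z [].
Qed.

Lemma mink_disc_open M r : open (mink M (disc 0 r)).
Proof.
apply/open_discP => _ [p Mp [v + <-]]; rewrite /disc /= subr0 => vr.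
exists (r - modulus v); first by rewrite subr_gt0.
move=> w; rewrite /disc /= => hw; exists p => //; exists (w - p); last by rewrite addrC subrK.
rewrite /disc /= subr0 (_ : w - p = w - (p + v) + v); last by rewrite opprD !addrA subrK.
by apply: le_lt_trans (modulusD _ _) _; lra.
Qed.

Lemma mink_disc_sub M r : 0 < r -> M `<=` mink M (disc 0 r).
Proof. by move=> r0 z Mz; exists z => //; exists 0; rewrite ?addr0 // /disc /= subr0 modulus0. Qed.

Lemma near_analytic_mink M f r : 0 < r -> analytic_on (mink M (disc 0 r)) f -> f \in near_analytic M.
Proof.
move=> r0 af; apply/near_analyticP; exists (mink M (disc 0 r)).
by split => //; [exact: mink_disc_open|exact: mink_disc_sub].
Qed.

(** The sup-norm balls over all of [G] generate a filter that converges to 0 uniformly on compact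
    subsets, so every zero neighbourhood contains the analytic functions of such a ball. *)
Lemma nbhs0_A_bound G (S : set (C -> C)) : nbhs0_A G S ->
  exists2 e : R, 0 < e & forall f, analytic_on G f -> (forall z, G z -> modulus (f z) <= e) -> S f.
Proof.
pose F : set_system (C -> C) := [set A | exists2 e : R, 0 < e &
  forall f, (forall z, G z -> modulus (f z) <= e) -> A f].
have FF : Filter F.
  split; first by exists 1.
    move=> A B [e1 e10 hA] [e2 e20 hB]; exists (Num.min e1 e2); first by rewrite lt_min e10.
    move=> f hf; split; [apply: hA|apply: hB] => z /hf h; apply: le_trans h _;
      by rewrite ge_min lexx ?orbT.
  by move=> A B AB [e e0 hA]; exists e => // f /hA /AB.
have : {family [set L | compact L /\ L `<=` G], F --> ((fun=> 0) : C -> C)}.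
  apply/fam_cvgP => L [_ LG] A /uniform_nbhs[E [entE EA]].
  move: entE; rewrite -entourage_ballE => -[e /= e0 eE].
  move: (e0); rewrite Cx_ltE => /andP[/eqP ei er].
  have ee : e = rC (Re e) by apply: CxP => //; rewrite ImrC; exact: ei.
  exists (Re e / 2); first by rewrite divr_gt0.
  move=> f hf; apply: EA => y /LG /hf hy; apply: eE => /=.
  rewrite -ball_normE /= sub0r normrN norm_modulus ee Cx_ltE !ImrC eqxx /=.
  by apply: le_lt_trans hy _; rewrite ltr_pdivrMr // ltr_pMr // ltr1n.
move=> h /h[e e0 he]; exists e => // f af hf; exact: he.
Qed.

Section Functional.
Variables (K : set C) (mu : {linear A_K K -> C}).
Hypothesis mu_cont : continuous mu.

(** Continuity at 0 in the inductive limit bounds [mu] on a sup-norm ball of each step; homogeneity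
    turns this into a linear estimate. *)
Lemma mu_bound (n : nat) : exists2 c : R, 0 <= c & forall f eta,
  analytic_on (mink K (disc 0 n.+1%:R^-1)) f -> 0 <= eta ->
  (forall z, mink K (disc 0 n.+1%:R^-1) z -> modulus (f z) <= eta) ->
  modulus (mu (germ_of K f)) <= c * eta.
Proof.
have h : nbhs (0 : A_K K) (mu @^-1` disc 0 1).
  apply: mu_cont; rewrite linear0; exact: nbhs_disc.
move: h; rewrite nbhsE => -[W [oW W0] Wmu].
have [U [cU nU] UW] := oW _ W0.
have [e e0 he] := nbhs0_A_bound (nU n).
set G := mink _ _ in he *.
have unit f : analytic_on G f -> (forall z, G z -> modulus (f z) <= e) -> modulus (mu (germ_of K f)) <= 1.
  move=> af hf; have /UW := he f af hf; rewrite add0r => /Wmu /=.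
  by rewrite /disc /= subr0 => /ltW.
have n0 : 0 < n.+1%:R^-1 :> R by rewrite invr_gt0 ltr0n.
have pos_bound f eta : analytic_on G f -> 0 < eta -> (forall z, G z -> modulus (f z) <= eta) ->
    modulus (mu (germ_of K f)) <= e^-1 * eta.
  move=> af eta0 hf.
  have nf : f \in near_analytic K by exact: near_analytic_mink af.
  have := unit (fun z => rC (e / eta) * f z + 0).
  rewrite (germ_of_lin _ nf (near_analytic0 K)) germ_of0 linearD linearZ linear0 addr0 /=.
  rewrite modulusM modulus_rC ger0_norm; last by apply: divr_ge0; exact: ltW.
  move=> hu; have : e / eta * modulus (mu (germ_of K f)) <= 1.
    apply: hu; first by apply: analytic_lin => //; exact: analytic_cst.
    move=> z Gz; rewrite addr0 modulusM modulus_rC ger0_norm; last by apply: divr_ge0; exact: ltW.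
    by rewrite mulrAC ler_pdivrMr // ler_pM2l //; exact: hf.
  by rewrite mulrAC ler_pdivrMr // mul1r => h; rewrite [e^-1 * _]mulrC ler_pdivlMr // mulrC.
exists e^-1; first by rewrite invr_ge0 ltW.
(* The value [eta = 0] does not allow rescaling and is reached by letting [x] tend to 0. *)
move=> f eta af eta0 hf; apply/ler_addgt0Pr => x x0.
have xe : 0 < x * e by rewrite mulr_gt0.
have -> : e^-1 * eta + x = e^-1 * (eta + x * e) by field; rewrite gt_eqF.
apply: pos_bound => //; first by rewrite ltr_wpDl.
by move=> z /hf h; apply: le_trans h _; rewrite lerDl ltW.
Qed.

(** All germs on the empty set coincide, so a nonzero functional requires a point in [K]. *)
Lemma mu_neq0_set : (exists f : A_K K, mu f <> 0) -> K !=set0.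
Proof.
move=> [f hf]; apply/set0P/eqP => K0; apply: hf.
have : forall a b : germ K, a = b by rewrite K0; exact: germ_set0.
by move=> /(_ f 0) ->; exact: linear0.
Qed.

Lemma laplace_bound e : 0 < e -> exists2 c : R, 0 <= c & forall w x,
  (forall k, K k -> Re (w * k) <= x) -> modulus (laplace mu w) <= c * expR (x + e * modulus w).
Proof.
move=> e0; have [n n0] := natr_gt e^-1; have [c c0 hc] := mu_bound n.
exists c => // w x hx; apply: hc; [exact: analytic_cexp|exact: expR_ge0|].
move=> _ [k Kk [v + <-]]; rewrite /disc /= subr0 => hv.
rewrite modulus_cexp ler_expR mulrDr ReD; apply: lerD; first exact: hx.
apply: le_trans (Re_le _) _; rewrite modulusM mulrC ler_wpM2r //; apply: (le_trans (ltW hv)).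
rewrite invf_ple ?posrE ?ltr0n //; apply: le_trans (ltW n0) _; by rewrite ler_nat.
Qed.

End Functional.

End Germs.

(** * Lacunary exponential series on a half-plane *)

Section Lacunary.
Variable R : realType.
Local Notation C := (Cx R).
Implicit Types (z w b h : C) (x y s H : R) (r : nat -> R).

Definition lac_term r H b (l : nat) z : C := rC (expR (- (r l * H))) * cexp (rC (r l) * b * z).

Lemma modulus_lac_term r H b l z : modulus (lac_term r H b l z) = expR (r l * (Re (b * z) - H)).
Proof.
rewrite /lac_term modulusM modulus_rC modulus_cexp ger0_norm ?expR_ge0 // -expRD; congr expR.
by rewrite -[_ * _ * z]mulrA [Re (rC _ * _)]ReM RerC ImrC mul0r subr0; ring.
Qed.

Lemma expRN_lac r l s : (forall l, 2 ^+ l <= r l) -> 0 < s -> expR (- (r l * s)) <= s^-1 * 2^-1 ^+ l.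
Proof.
move=> hr s0; have r0 : 0 < r l by apply: lt_le_trans (hr l); rewrite exprn_gt0.
apply: le_trans (expRN_le _) _; first by rewrite mulr_gt0.
rewrite invfM mulrC ler_wpM2l ?invr_ge0 ?(ltW s0) // exprVn lef_pV2 ?posrE ?exprn_gt0 //.
Qed.

Lemma pow_fact_le x s n : 0 <= x -> 0 < s -> x ^+ n / (n`!)%:R <= s^-1 ^+ n * expR (x * s).
Proof.
move=> x0 s0; have := @expn_fact_le_exp R (x * s) n (mulr_ge0 x0 (ltW s0)).
rewrite exprMn mulrAC -ler_pdivlMr ?exprn_gt0 // => h; apply: le_trans h _.
by rewrite exprVn mulrC.
Qed.

Lemma cvgC_ext (u v : nat -> C) (l : C) : (forall n, u n = v n) -> u @ \oo --> l -> v @ \oo --> l.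
Proof. by move=> /funext ->. Qed.

Lemma cvgC_sum N (u : nat -> nat -> C) (a c : nat -> C) : (forall n, u n @ \oo --> a n) ->
  (fun m => \sum_(0 <= n < N) u n m * c n) @ \oo --> \sum_(0 <= n < N) a n * c n.
Proof.
move=> hu; elim: N => [|N ih].
  have -> : (fun m => \sum_(0 <= n < 0) u n m * c n) = fun=> 0 by apply/funext => m; rewrite big_geq.
  by rewrite big_geq //; exact: cvgC_cst.
have -> : (fun m => \sum_(0 <= n < N.+1) u n m * c n) =
    fun m => \sum_(0 <= n < N) u n m * c n + u N m * c N by apply/funext => m; rewrite big_nat_recr.
have -> : \sum_(0 <= n < N.+1) a n * c n = \sum_(0 <= n < N) a n * c n + a N * c N by rewrite big_nat_recr.
exact: (cvgCD ih (cvgCZ (c := c N) (hu N))).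
Qed.

(** Each exponential is expanded at [z] and the sum over [l] taken first. Only finitely many
    coefficients at a time are exchanged with that sum; by [cexp_sum_bound2] the remainders add up
    to [2^-1 ^+ N] times a convergent series. *)
Lemma lacunary_analytic r H b : modulus b = 1 -> (forall l, 2 ^+ l <= r l) ->
  exists2 g : C -> C, analytic_on [set z | Re (b * z) < H] g &
    forall z, Re (b * z) < H -> psum (fun l => lac_term r H b l z) @ \oo --> g z.
Proof.
move=> ub hr; have r0 l : 0 < r l by apply: lt_le_trans (hr l); rewrite exprn_gt0.
have conv z : exists g : C, Re (b * z) < H -> psum (fun l => lac_term r H b l z) @ \oo --> g.
  have [hz|hz] := ltP (Re (b * z)) H; last by exists 0.
  have s0 : 0 < H - Re (b * z) by rewrite subr_gt0.
  have [|g hg _] := @psum_half_cvg R (fun l => lac_term r H b l z) (H - Re (b * z))^-1; last by exists g.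
  move=> l; rewrite modulus_lac_term -opprB mulrN; exact: expRN_lac.
have [g hg] := choice conv; exists g => //.
apply/analytic_onP => z /= hz; set s := H - Re (b * z).
have s0 : 0 < s by rewrite subr_gt0.
have s2 : 0 < s / 2 by pos.
pose v l := lac_term r H b l z.
have mv l : modulus (v l) = expR (- (r l * s)) by rewrite /v modulus_lac_term -mulrN opprB.
(* The decay [exp(- r l * s)] is split into halves: one absorbs [r l ^+ n / n!], the other makes the
   series in [l] converge. *)
have coef n : exists a : C, psum (fun l => v l * ((rC (r l) * b) ^+ n / (n`!)%:R)) @ \oo --> a.
  have [|a ha _] := @psum_half_cvg R (fun l => v l * ((rC (r l) * b) ^+ n / (n`!)%:R)) ((s / 2)^-1 ^+ n * (s / 2)^-1); last by exists a.
  move=> l; rewrite modulusM mv modulusM modulusX modulusM ub mulr1 modulusV.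
  rewrite -rC_nat !modulus_rC (ger0_norm (ler0n _ _)) (ger0_norm (ltW (r0 l))).
  have h1 := pow_fact_le n (ltW (r0 l)) s2; have h2 := expRN_lac l hr s2.
  rewrite [leRHS](_ : _ = (s / 2)^-1 ^+ n * ((s / 2)^-1 * 2^-1 ^+ l)); last by rewrite mulrA.
  apply: (@le_trans _ _ ((s / 2)^-1 ^+ n * expR (- (r l * (s / 2))))); last first.
    by rewrite ler_wpM2l // exprn_ge0 // invr_ge0 ltW.
  rewrite (_ : - (r l * s) = - (r l * (s / 2)) + - (r l * (s / 2))); last by lra.
  rewrite expRD -mulrA [leRHS]mulrC ler_wpM2l ?expR_ge0 //.
  by rewrite expRN ler_pdivrMl ?expR_gt0 // [leRHS]mulrC.
(* The radius [s / 8] keeps the growth [exp(3 * r l * modulus h)] of the remainders below half of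
   the decay. *)
have [a ha] := choice coef; exists a, (s / 8); first by pos.
move=> h hh.
have hzh : Re (b * (z + h)) < H.
  rewrite mulrDr ReD; have := Re_le (b * h); rewrite modulusM ub mul1r; move: s0 hh; rewrite /s; lra.
apply: (@cvgC_squeeze _ _ _ (fun N => 2 * (s / 2)^-1 * 2^-1 ^+ N)); last exact: half_exp_cvg.
move=> N; rewrite modulus_distC.
pose q l := v l * (cexp (rC (r l) * b * h) - cexp_sum N (rC (r l) * b * h)).
have [|L hL mL] := @psum_half_cvg R q ((s / 2)^-1 * 2^-1 ^+ N).
  move=> l; rewrite /q modulusM mv.
  have := cexp_sum_bound2 N (rC (r l) * b * h).
  rewrite modulusM modulusM ub mulr1 modulus_rC (ger0_norm (ltW (r0 l))) => hb.
  have h2 := expRN_lac l hr s2.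
  have h3 : expR (- (r l * s)) * expR (3 * (r l * modulus h)) <= expR (- (r l * (s / 2))).
    rewrite -expRD ler_expR; have : r l * modulus h <= r l * (s / 8) by rewrite ler_wpM2l // ltW.
    by have := mulr_gt0 (r0 l) s0; lra.
  apply: (@le_trans _ _ (2^-1 ^+ N * (expR (- (r l * s)) * expR (3 * (r l * modulus h))))).
    by rewrite mulrCA ler_wpM2l // expR_ge0.
  apply: (@le_trans _ _ (2^-1 ^+ N * ((s / 2)^-1 * 2^-1 ^+ l))); last by apply: eq_leR; ring.
  by rewrite ler_wpM2l ?exprn_ge0 ?invr_ge0 //; apply: le_trans h2.
have -> : g (z + h) - pow_series a h N = L.
  apply: cvgC_unique hL.
  have hs : forall N, (fun m => \sum_(0 <= n < N) psum (fun l => v l * ((rC (r l) * b) ^+ n / (n`!)%:R)) m * h ^+ n) @ \oo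
     --> pow_series a h N.
    by move=> M; exact: cvgC_sum.
  have -> : g (z + h) - pow_series a h N = -1 * pow_series a h N + g (z + h) by rewrite mulN1r addrC.
  apply: (cvgC_ext _ (cvgC_lin (c := -1) (hs N) (hg _ hzh))) => m.
  rewrite mulN1r addrC /psum.
  rewrite [X in _ - X](eq_bigr (fun n => \sum_(0 <= l < m) v l * ((rC (r l) * b) ^+ n / (n`!)%:R) * h ^+ n)); last first.
    by move=> n _; rewrite mulr_suml.
  rewrite exchange_big /= -sumrB; apply: eq_bigr => l _.
  rewrite /q mulrBr /v /lac_term mulrDr cexpD mulrA; congr (_ - _).
  by rewrite /cexp_sum mulr_sumr; apply: eq_bigr => n _; rewrite -mulrA; congr (_ * _); rewrite [(_ * h) ^+ n]exprMn mulrAC.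
by apply: le_trans mL _; rewrite mulrA.
Qed.

End Lacunary.

(** * The functionals given by exponential sums and translates of [mu] *)

Section TestFunctional.
Variable R : realType.
Local Notation C := (Cx R).
Local Notation mink := (@Defs.minkowski R).
Implicit Types (z w t d b : C) (x y e B : R) (K P : set C) (f u : C -> C).

Lemma convexC_intro P : (forall (x y : C) (t : R), P x -> P y -> 0 <= t -> t <= 1 ->
  P (rC t * x + rC (1 - t) * y)) -> is_convex P.
Proof.
move=> hP x y t; rewrite !inE => Px Py.
have : (0 : C) <= t%:num by []. 
have : t%:num <= (1 : C) by [].
rewrite !Cx_leE /= => /andP[/eqP i1 t1] /andP[_ t0].
have := hP x y (Re (t%:num : C)) Px Py t0 t1; rewrite rCD rCN rC1.
have <- : t%:num = rC (Re (t%:num : C)) :> C; last exact.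
by apply: CxP => //; rewrite -i1.
Qed.

(** The Minkowski sum of [K] and the segment from [t - d] to [t + d], written as an image of a
    product so that its compactness is that of a continuous image. *)
Definition seg_sum t d K : set C :=
  [set t + rC q.2 * d + q.1 | q in K `*` `[-1, 1]%classic].

Lemma seg_sum_mem t d K (x : R) (k : C) : -1 <= x -> x <= 1 -> K k -> seg_sum t d K (t + rC x * d + k).
Proof. by move=> x1 x2 Kk; exists (k, x) => //; split => //=; rewrite in_itv /= x1 x2. Qed.

Lemma seg_sum_compact t d K : compact K -> compact (seg_sum t d K).
Proof.
move=> cK; apply: continuous_compact; last by apply: compact_setX => //; exact: segment_compact.
apply: continuous_subspaceT => -[p x] A /nbhs_discP[e e0 eA].
have d1 : 0 < modulus d + 1 by rewrite ltr_wpDl.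
have e2 : 0 < e / 2 / (modulus d + 1) by rewrite divr_gt0 // divr_gt0.
exists (disc p (e / 2), [set u | `|x - u| < e / 2 / (modulus d + 1)]).
  by split; [apply: nbhs_disc; rewrite divr_gt0|exact: (@nbhsx_ballx R R _ _ e2)].
move=> [q u] /= [pq xu]; apply: eA; rewrite /disc /=.
have -> : t + rC u * d + q - (t + rC x * d + p) = (q - p) + rC (u - x) * d.
  by rewrite rCD rCN; ring.
apply: le_lt_trans (modulusD _ _) _; rewrite modulusM modulus_rC distrC.
have : `|x - u| * modulus d <= e / 2.
  apply: (@le_trans _ _ (e / 2 / (modulus d + 1) * (modulus d + 1))).
    by apply: ler_pM => //; [exact: ltW|rewrite lerDl].
  by rewrite divfK // gt_eqF.
by move: pq; rewrite /disc /=; lra.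
Qed.

Lemma seg_sum_convex t d K : is_convex K -> is_convex (seg_sum t d K).
Proof.
move=> vK; apply: convexC_intro => _ _ s [[k x] [/= Kk +] <-] [[k' x'] [/= Kk' +] <-] s0 s1.
rewrite !in_itv /= => /andP[x1 x2] /andP[y1 y2].
have -> : rC s * (t + rC x * d + k) + rC (1 - s) * (t + rC x' * d + k') =
  t + rC (s * x + (1 - s) * x') * d + (rC s * k + rC (1 - s) * k').
  by rewrite !rCD !rCM !rCD !rCN rC1; ring.
apply: seg_sum_mem; [nra|nra|exact: convexC].
Qed.

(* The bound does not involve the coefficients [a] beyond the growth of the exponential sum. *)
Lemma test_functional_bound K (mu : {linear A_K K -> C}) t d (n : nat) (a : nat -> C) (tau : nat -> R) e B :
  continuous mu -> compact K -> is_convex K -> K !=set0 -> 0 < e -> 0 <= B ->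
  (forall k, (k < n)%N -> -1 <= tau k /\ tau k <= 1) ->
  (forall w y, (forall k, K k -> Re (w * k) <= y) ->
    modulus (\sum_(0 <= k < n) a k * cexp (w * (t + rC (tau k) * d))) * modulus (laplace mu w) <=
    B * expR (y + Re (w * t) + `|Re (w * d)| + e * modulus w)) ->
  forall f (M : R), analytic_on [set z | dist (seg_sum t d K) z < 2 * e] f ->
   (forall eta : R, 0 < eta -> exists s : seq (C * C),
    [/\ forall q, q \in s -> 2 * e <= dist (seg_sum t d K) q.2,
        \sum_(q <- s) modulus q.1 <= M &
        forall z, dist (seg_sum t d K) z <= e -> modulus (f z - \sum_(q <- s) q.1 * (q.2 - z)^-1) <= eta]) ->
  modulus (\sum_(0 <= k < n) a k * mu (germ_of K (fun z => f (z + (t + rC (tau k) * d))))) <= M * (B * (1 + e^-1)).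
Proof.
move=> cmu cK vK [k0 Kk0] e0 B0 htau growth.
set P := seg_sum t d K; set G := [set z | dist P z < 2 * e].
pose T k := t + rC (tau k) * d.
pose Phi f := \sum_(0 <= k < n) a k * mu (germ_of K (fun z => f (z + T k))).
have PT k x (v : C) : (k < n)%N -> mink K (disc 0 x) v -> dist P (v + T k) < x.
  move=> kn [p Kp [h + <-]]; rewrite /disc /= subr0 => hx; have [t1 t2] := htau k kn.
  apply: le_lt_trans (dist_le _ (seg_sum_mem t d t1 t2 Kp)) _.
  by rewrite (_ : p + h + T k - _ = h) // /T; ring.
have antr k f x : (k < n)%N -> x <= 2 * e -> analytic_on G f ->
    analytic_on (mink K (disc 0 x)) (fun z => f (z + T k)).
  move=> kn xe /(analytic_translate (T k)); apply: analytic_sub => z /(PT k x z kn) h /=.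
  exact: lt_le_trans xe.
have near k f : (k < n)%N -> analytic_on G f -> (fun z => f (z + T k)) \in near_analytic K.
  by move=> kn /(antr k f _ kn (lexx _)); apply: near_analytic_mink; rewrite mulr_gt0.
have [m hm] := natr_gt e^-1; have [c c0 hc] := mu_bound cmu m.
have me : m.+1%:R^-1 <= e.
  by rewrite invf_ple ?posrE ?ltr0n //; apply: le_trans (ltW hm) _; rewrite ler_nat.
(* The continuity constant involves the coefficients [a], which grow with the scale; [polya_bound]
   removes it. *)
move=> f M; apply: (@polya_bound R P e Phi (c * \sum_(0 <= k < n) modulus (a k)) B) => //.
- exact: seg_sum_compact.
- by exists (t + rC 0 * d + k0); apply: seg_sum_mem; rewrite // lerN10 ler01.
- exact: seg_sum_convex.
- by apply: mulr_ge0 => //; apply: sumr_ge0 => k _; exact: modulus_ge0.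
- move=> c' f' g' af ag; rewrite /Phi mulr_sumr -big_split /=.
  apply: eq_big_nat => k /andP[_ kn].
  rewrite (germ_of_lin c' (near k f' kn af) (near k g' kn ag)) linearD linearZ /= mulrDr mulrCA //.
- move=> f' eta af eta0 hf; apply: le_trans (modulus_sum _ _ _) _.
  rewrite [c * _]mulrC -mulrA mulr_suml; apply: ler_sum_nat => k /andP[_ kn].
  rewrite modulusM ler_wpM2l //; apply: hc => //.
    by apply: antr => //; apply: (le_trans me); lra.
  by move=> z /(PT k _ z kn) h; apply: hf; apply: le_trans me; exact: ltW.
move=> w x hw.
(* Translation multiplies an exponential by a constant, so on exponentials the functional is the
   exponential sum times the Laplace transform. *)
have -> : Phi (fun z => cexp (w * z)) = (\sum_(0 <= k < n) a k * cexp (w * T k)) * laplace mu w.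
  rewrite /Phi mulr_suml; apply: eq_big_nat => k _; rewrite -mulrA; congr (_ * _).
  have nw : (fun z => cexp (w * z)) \in near_analytic K.
    by apply: (near_analytic_mink ltr01); exact: analytic_cexp.
  have := germ_of_lin (cexp (w * T k)) nw (near_analytic0 K); rewrite germ_of0 addr0.
  rewrite (_ : (fun z => _ + 0) = fun z => cexp (w * (z + T k))); last first.
    by apply/funext => z; rewrite addr0 [w * (z + _)]mulrDr cexpD; exact: mulrC.
  by move=> ->; rewrite linearZ.
(* A bound on [seg_sum] used at the two endpoints of the segment gives a bound on [K] smaller by
   [Re (w * t) + |Re (w * d)|], exactly what [growth] puts back. *)
rewrite modulusM; apply: le_trans (growth w (x - Re (w * t) - `|Re (w * d)|) _) _; last first.
  by rewrite ler_wpM2l // ler_expR; lra.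
move=> k Kk; have h1 : -1 <= (1 : R) by lra.
have := hw _ (seg_sum_mem t d (lexx (-1)) h1 Kk); have := hw _ (seg_sum_mem t d h1 (lexx 1) Kk).
rewrite rCN rC1 mulN1r mul1r !mulrDr mulrN !ReD ReN.
have [h|h] := leP 0 (Re (w * d)); [rewrite ger0_norm //|rewrite ltr0_norm //]; lra.
Qed.

End TestFunctional.

(** * The contradiction with surjectivity *)

Section Core.
Variable R : realType.
Local Notation C := (Cx R).
Local Notation mink := (@Defs.minkowski R).
Implicit Types (z w t d b : C) (x y e B H D kap eta dl : R) (K P Q : set C) (f u g : C -> C) (r : nat -> R).

(** The growth [2 ^+ l] makes the series converge; the ratio 3 keeps the other points [r l * b] out
    of the disc of radius [r j / 2] about [r j * b]. *)
Lemma lacunary_sequence (bad : R -> Prop) (x0 : R) : (forall x, exists2 s : R, x <= s & bad s) ->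
  exists r : nat -> R, [/\ forall l, bad (r l), forall l, x0 <= r l, forall l, 2 ^+ l <= r l &
    forall l j, (l < j)%N -> 3 * r l <= r j].
Proof.
move=> h; have h' (x : R) : exists s : R, x <= s /\ bad s by have [s] := h x; exists s.
have [nx hnx] := choice h'.
pose r := fix r l := if l is l'.+1 then nx (3 * r l') else nx (1 + `|x0|).
have rS l : 3 * r l <= r l.+1 by have [] := hnx (3 * r l).
have rpow l : 2 ^+ l <= r l.
  elim: l => [|l ih]; first by have [h1 _] := hnx (1 + `|x0|); apply: le_trans h1; rewrite expr0 lerDl.
  apply: le_trans (rS l); rewrite exprS; have : 0 < 2 ^+ l :> R by rewrite exprn_gt0.
  lra.
have r0 l : 0 < r l by apply: lt_le_trans (rpow l); rewrite exprn_gt0.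
have rlt l j : (l < j)%N -> 3 * r l <= r j.
  elim: j => // j ih; rewrite ltnS leq_eqVlt => /orP[/eqP ->//|/ih h3].
  by apply: le_trans (rS j); have := r0 j; lra.
exists r; split => // [[|l]|[|l]].
- by have [] := hnx (1 + `|x0|).
- by have [] := hnx (3 * r l).
- by have [h1 _] := hnx (1 + `|x0|); have := ler_norm x0; rewrite /=; lra.
have := rlt 0%N l.+1 isT; have [h1 _] := hnx (1 + `|x0|); have := ler_norm x0.
by rewrite [r 0%N]/=; have := r0 l.+1; have := normr_ge0 x0; lra.
Qed.

Lemma cvg_psum_single (j : nat) (c : C) : psum (fun l => if l == j then c else 0) @ \oo --> c.
Proof.
apply/cvgCP => e e0; exists j.+1 => n jn.
by rewrite /psum -big_mkcond /= big_nat1_eq jn subrr modulus0.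
Qed.

Lemma psum_isolated_term (u : nat -> C) (j : nat) (l : C) (M : R) : psum u @ \oo --> l ->
  (forall i, i != j -> modulus (u i) <= M * 2^-1 ^+ i) -> 0 <= M -> modulus (u j) <= modulus l + 2 * M.
Proof.
move=> hu hM M0; pose v' (i : nat) : C := if i == j then 0 else u i.
have [|l' hl' ml'] := @psum_half_cvg R v' M.
  move=> i; rewrite /v'; case: eqP => [_|/eqP /hM //].
  by rewrite modulus0 mulr_ge0 // exprn_ge0 // invr_ge0.
have e1 : l = l' + u j.
  have h n : psum v' n + psum (fun i => if i == j then u j else 0) n = psum u n; last first.
    exact: (cvgC_unique hu (cvgC_ext h (cvgCD hl' (@cvg_psum_single j (u j))))).
  rewrite /psum -big_split /=; apply: eq_bigr => i _; rewrite /v'.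
  by case: eqP => [->|_]; rewrite ?add0r ?addr0.
by have := modulus_addl (u j) l'; rewrite [u j + l']addrC -e1; lra.
Qed.

Lemma half_plane_open b x : modulus b = 1 -> open [set z : C | Re (b * z) < x].
Proof.
move=> ub; apply/open_discP => z /= hz; exists (x - Re (b * z)); first by rewrite subr_gt0.
move=> w; rewrite /disc /= => wz; have := Re_le (b * (w - z)).
by rewrite modulusM ub mul1r mulrBr ReD ReN; lra.
Qed.

(** Inserting the series turns the sum into a series over [l] of
    [exp(- r l * (H + eta * D)) * F (r l * b)]. The term [l = j] is at least [exp(r j * eta * D)].
    At the others [F] obeys its bound off the disc, so they are at most [exp(- r l * eta * D / 2)],
    with a sum independent of [j]. *)
Lemma lac_lower_bound r H b t d D kap eta dl (j n : nat) (a : nat -> C) (tau : nat -> R) (g : C -> C) :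
  modulus b = 1 -> 0 < D -> 0 < eta -> kap <= 2^-1 -> dl <= 2^-1 ->
  (forall l, 2 ^+ l <= r l) -> (forall l i, (l < i)%N -> 3 * r l <= r i) ->
  Re (b * t) + `|Re (b * d)| <= H ->
  (forall k, (k < n)%N -> psum (fun l => lac_term r (H + eta * D) b l (t + rC (tau k) * d)) @ \oo --> g (t + rC (tau k) * d)) ->
  let F w := \sum_(0 <= k < n) a k * cexp (w * (t + rC (tau k) * d)) in
  expR (r j * (H + 2 * (eta * D))) <= modulus (F (rC (r j) * b)) ->
  (forall w, dl * r j < modulus (w - rC (r j) * b) ->
    modulus (F w) <= expR (Re (w * t) + `|Re (w * d)| + kap * eta * D / 2 * modulus w)) ->
  expR (r j * (eta * D)) <= modulus (\sum_(0 <= k < n) a k * g (t + rC (tau k) * d)) + 2 * (eta * D / 2)^-1.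
Proof.
move=> ub D0 eta0 kap2 dl2 rpow rlt hH hg F hj hF.
have eD : 0 < eta * D by pos.
have r0 l : 0 < r l by apply: lt_le_trans (rpow l); rewrite exprn_gt0.
pose u (l : nat) : C := rC (expR (- (r l * (H + eta * D)))) * F (rC (r l) * b).
have mu_ l : modulus (u l) = expR (- (r l * (H + eta * D))) * modulus (F (rC (r l) * b)).
  by rewrite /u modulusM modulus_rC ger0_norm // expR_ge0.
have hu : psum u @ \oo --> \sum_(0 <= k < n) a k * g (t + rC (tau k) * d).
  pose T (k : nat) : C := t + rC (tau k) * d.
  pose V (k m : nat) : C := if (k < n)%N then psum (fun l => lac_term r (H + eta * D) b l (T k)) m else 0.
  have hV k : V k @ \oo --> (if (k < n)%N then g (T k) else 0).
    rewrite /V; case: ifP => kn; [exact: hg|exact: cvgC_cst].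
  rewrite (_ : \sum_(0 <= k < n) _ = \sum_(0 <= k < n) (if (k < n)%N then g (T k) else 0) * a k); last first.
    by apply: eq_big_nat => k /andP[_ ->]; rewrite mulrC.
  have h m : \sum_(0 <= k < n) V k m * a k = psum u m; last exact: (cvgC_ext h (@cvgC_sum R n V _ a hV)).
  transitivity (\sum_(0 <= k < n) \sum_(0 <= l < m) lac_term r (H + eta * D) b l (T k) * a k).
    by apply: eq_big_nat => k /andP[_ kn]; rewrite /V kn /psum mulr_suml.
  rewrite exchange_big /=; apply: eq_bigr => l _; rewrite /u /F mulr_sumr; apply: eq_bigr => k _.
  by rewrite /lac_term -mulrA; congr (_ * _); exact: mulrC.
apply: (@le_trans _ _ (modulus (u j))).
  rewrite mu_; apply: (@le_trans _ _ (expR (- (r j * (H + eta * D))) * expR (r j * (H + 2 * (eta * D))))).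
    by rewrite -expRD ler_expR; lra.
  by rewrite ler_wpM2l // expR_ge0.
apply: (psum_isolated_term hu); last by pos.
move=> l lj; rewrite mu_.
have mw : modulus (rC (r l) * b) = r l by rewrite modulusM ub mulr1 modulus_rC gtr0_norm.
have Rw v : Re (rC (r l) * b * v) = r l * Re (b * v).
  by rewrite -mulrA [Re (rC _ * _)]ReM RerC ImrC mul0r subr0.
have far : dl * r j < modulus (rC (r l) * b - rC (r j) * b).
  rewrite -mulrBl modulusM ub mulr1 -rCN -rCD modulus_rC.
  have : dl * r j <= 2^-1 * r j by rewrite ler_wpM2r // ltW.
  have := r0 j; have := r0 l; have := ler_norm (r l - r j); have := ler_norm (r j - r l); rewrite distrC.
  by move: lj; rewrite neq_ltn => /orP[/rlt|/rlt]; lra.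
apply: le_trans (expRN_lac l rpow _); last by pos.
have := hF _ far; rewrite mw !Rw normrM (gtr0_norm (r0 l)) => h.
apply: (@le_trans _ _ (expR (- (r l * (H + eta * D))) *
   expR (r l * Re (b * t) + r l * `|Re (b * d)| + kap * eta * D / 2 * r l))).
  by rewrite ler_wpM2l // expR_ge0.
rewrite -expRD ler_expR.
have h1 : kap * (eta * D) <= 2^-1 * (eta * D) by rewrite ler_wpM2r // ltW.
have : r l * (Re (b * t) + `|Re (b * d)| + kap * (eta * D) / 2) <= r l * (H + eta * D / 2).
  by rewrite ler_wpM2l ?(ltW (r0 l)) //; lra.
lra.
Qed.

(** The second alternative is the default branch: if the convolution were not analytic near [Q], its
    germ would be zero and [g] would vanish on [Q]. *)
Lemma conv_op_val Q K (mu : {linear A_K K -> C}) (v : A_QK Q K) g :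
  g \in near_analytic Q -> conv_op mu v = germ_of Q g ->
  (forall z, Q z -> mu (germ_of K (fun t => germ_repr v (t + z))) = g z) \/ (forall z, Q z -> g z = 0).
Proof.
move=> hg; rewrite /conv_op => e.
have [hh|hh] := boolP ((fun z => mu (germ_of K (fun t => germ_repr v (t + z)))) \in near_analytic Q).
  by left; exact: (germ_of_eq hh hg e).
by right; exact: (germ_of_default hh hg e).
Qed.

Lemma exp_lt_contra (x e M : R) (r : nat -> R) : 0 < e -> (forall l, 2 ^+ l <= r l) ->
  (forall j, expR (r j * e) <= M) -> False.
Proof.
move=> e0 hr hM; have [j hj] := natr_gt (M / e).
have jr : j%:R <= r j by apply: le_trans (hr j); rewrite -natrX ler_nat ltnW // ltn_expl.
have := hM j; have := expR_ge1Dx (r j * e); move: hj; rewrite ltr_pdivrMr // => hj.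
have : j%:R * e <= r j * e by rewrite ler_pM2r.
lra.
Qed.

Lemma seg_bound Q b t d H : (forall z, Q z -> Re (b * z) <= H) ->
  (forall tau : R, -1 <= tau -> tau <= 1 -> Q (t + rC tau * d)) -> Re (b * t) + `|Re (b * d)| <= H.
Proof.
move=> hQ hs; have h1 : -1 <= (1 : R) by lra.
have := hQ _ (hs _ (lexx _) h1); have := hQ _ (hs _ h1 (lexx _)).
rewrite rCN rC1 mulN1r mul1r !mulrDr mulrN !ReD ReN => *.
by have [h|h] := leP 0 (Re (b * d)); [rewrite ger0_norm //|rewrite ltr0_norm //]; lra.
Qed.

(** Failure of the lower bound on a whole disc. The variable [y] ranges over the upper bounds of
    [Re (w * k)] on [K], which stands for the support function without extended reals. *)
Definition bad_scale K (mu : {linear A_K K -> C}) b dl (s : R) : Prop :=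
  forall w, modulus (w - rC s * b) <= dl * s -> forall y, (forall k, K k -> Re (w * k) <= y) ->
    modulus (laplace mu w) <= expR (y - dl * modulus w).

(** In the disc the smallness of the Laplace transform cancels the factor [exp(dl * modulus w)]
    allowed to [F]; outside, each factor uses half of the tolerance [e]. *)
Lemma bad_growth K (mu : {linear A_K K -> C}) b dl (s c e : R) t d (F : C -> C) :
  bad_scale mu b dl s -> 0 <= c ->
  (forall w x, (forall k, K k -> Re (w * k) <= x) -> modulus (laplace mu w) <= c * expR (x + e / 2 * modulus w)) ->
  (forall w, dl * s < modulus (w - rC s * b) ->
    modulus (F w) <= expR (Re (w * t) + `|Re (w * d)| + e / 2 * modulus w)) ->
  (forall w, modulus (w - rC s * b) <= dl * s ->
    modulus (F w) <= expR (dl * modulus w + Re (w * t) + `|Re (w * d)|)) -> 0 <= e ->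
  forall w y, (forall k, K k -> Re (w * k) <= y) ->
    modulus (F w) * modulus (laplace mu w) <= (c + 1) * expR (y + Re (w * t) + `|Re (w * d)| + e * modulus w).
Proof.
move=> hbad c0 hL hfar hnear e0 w y hy.
have [hw|hw] := leP (modulus (w - rC s * b)) (dl * s).
  apply: (@le_trans _ _ (expR (dl * modulus w + Re (w * t) + `|Re (w * d)|) * expR (y - dl * modulus w))).
    by apply: ler_pM => //; [exact: hnear|exact: hbad].
  rewrite -expRD -[leLHS]mul1r; apply: ler_pM; rewrite ?expR_ge0 //; first by rewrite lerDr.
  by rewrite ler_expR; have : 0 <= e * modulus w by [apply: mulr_ge0]; lra.
apply: (@le_trans _ _ (expR (Re (w * t) + `|Re (w * d)| + e / 2 * modulus w) * (c * expR (y + e / 2 * modulus w)))).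
  by apply: ler_pM => //; [exact: hfar|exact: hL].
rewrite mulrCA -expRD; apply: ler_pM; rewrite ?expR_ge0 //; first by rewrite lerDl.
by rewrite ler_expR; lra.
Qed.

(** For a fixed solution, the sums over the frequencies are bounded through the growth estimate with
    constants [M] and [c] independent of [j], while the lacunary right-hand side makes them at least
    [exp(r j * eta * D)] up to a constant. *)
Lemma no_bad_scales Q K (mu : {linear A_K K -> C}) b dl :
  is_convex Q -> interior Q !=set0 -> is_convex K -> compact K -> K !=set0 -> continuous mu ->
  (forall g : A_Q Q, exists f : A_QK Q K, conv_op mu f = g) ->
  R_set Q b -> 0 < dl -> dl <= 2^-1 ->
  ~ (forall x : R, exists2 s : R, x <= s & bad_scale mu b dl s).
Proof.
move=> vQ iQ vK cK K0 cmu surj Rb dl0 dl2 hbad.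
have ub : modulus b = 1 by case: Rb => -[].
have [H HQ [kap [kap0 kap2] geo]] := geometry vQ iQ Rb.
have [p p0 p1] : exists2 p : R, 0 < p & 16 * (16 * (8 * p)) <= 1.
  by exists (16^-1 * (16^-1 * 8^-1)); lra.
(* The value required by [test_functional]; it can be chosen now because [kap] is already known. *)
pose eta := 4 * (kap * (dl * p) ^+ 2).
have dp0 : 0 < dl * p by pos.
have dp1 : dl * p <= 2^-1 * 2^-1 by apply: ler_pM; lra.
have eta0 : 0 < eta by rewrite /eta; pos.
have eta2 : eta <= 2^-1.
  have : (dl * p) ^+ 2 <= 4^-1 by rewrite expr2; move: (dl * p) dp0 dp1 => q *; nra.
  have := sqr_ge0 (dl * p); rewrite /eta; move: ((dl * p) ^+ 2) => q *; nra.
have [t [d [D [[D0 D1] [dD1 dD2] hbd ht hQt]]]] := geo eta eta0 eta2.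
have e0 : 0 < kap * eta * D by pos.
have eD : 0 < eta * D by pos.
(* The lower bound [kap / (32 * D)] for the scales ensures that the power in the test sum is at
   least 1. *)
have [r [rbad rx rpow rlt]] := lacunary_sequence (kap / (32 * D)) hbad.
have rkap j : kap <= 32 * (r j * D).
  by have := rx j; rewrite ler_pdivrMr ?mulr_gt0 // mulrCA.
have [g ag hg] := lacunary_analytic (H + eta * D) ub rpow.
have QH z : Q z -> Re (b * z) < H + eta * D by move=> /HQ; lra.
have ng : g \in near_analytic Q.
  by apply/near_analyticP; exists [set z | Re (b * z) < H + eta * D]; split => //; exact: half_plane_open.
have [v hv] := surj (germ_of Q g).
have alt := conv_op_val ng hv.
have QT (x : R) : -1 <= x -> x <= 1 -> Q (t + rC x * d).
  by move=> x1 x2; rewrite -[_ + _]addr0; apply: hQt => //; rewrite modulus0; lra.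
have /near_analyticP[G [oG QG aG]] := nearfunP (germ_repr v).
have cP := seg_sum_compact (t := t) (d := d) cK.
have P0 : seg_sum t d K !=set0.
  by case: K0 => k Kk; exists (t + rC 0 * d + k); apply: seg_sum_mem; rewrite ?lerN10 ?ler01.
have PG q (x : C) : seg_sum t d K q -> modulus x < 4 * (kap * eta * D) -> G (q + x).
  move=> [[k y] [/= Kk]]; rewrite in_itv /= => /andP[y1 y2] <- hx; apply: QG.
  exists (t + rC y * d + x); first exact: hQt.
  by exists k => //; rewrite addrAC.
have [M M0 hM] := cauchy_approx cP P0 e0 oG PG aG.
have aF : analytic_on [set z | dist (seg_sum t d K) z < 2 * (kap * eta * D)] (germ_repr v).
  apply: analytic_sub aG => z /(dist_lt P0)[q Pq zq].
  by rewrite -(subrK q z) addrC; apply: PG => //; lra.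
have e2 : 0 < kap * eta * D / 2 by pos.
have [c c0 hL] := laplace_bound cmu e2.
apply: (@exp_lt_contra 0 (eta * D) (M * ((c + 1) * (1 + (kap * eta * D)^-1)) + 2 * (eta * D / 2)^-1) r) => // j.
have [n [a [tau [htau hF1 hF2 hF3]]]] :=
  test_functional kap0 kap2 dl0 dl2 p0 p1 ub D0 D1 dD1 dD2 erefl hbd ht (rkap j).
have hconv k : (k < n)%N -> psum (fun l => lac_term r (H + eta * D) b l (t + rC (tau k) * d)) @ \oo -->
    g (t + rC (tau k) * d).
  by move=> /htau[t1 t2]; apply: hg; apply: QH; exact: QT.
have low := lac_lower_bound ub D0 eta0 kap2 dl2 rpow rlt (seg_bound HQ QT) hconv hF1 hF2.
apply: le_trans low _; rewrite lerD2r.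
have B0 : 0 <= c + 1 by rewrite addr_ge0.
have gr := bad_growth (rbad j) c0 hL hF2 hF3 (ltW e0).
have up := test_functional_bound cmu cK vK K0 e0 B0 htau gr aF hM.
(* If [g] vanishes on [Q], the sum over the frequencies is 0 and the upper bound holds trivially, so
   both alternatives meet the same contradiction. *)
case: alt => alt.
  apply: le_trans up; apply: eq_leR; congr modulus; apply: eq_big_nat.
  by move=> k /andP[_ /htau[t1 t2]]; rewrite alt //; exact: QT.
rewrite big_nat big1 ?modulus0; last first.
  by move=> k /andP[_ /htau[t1 t2]]; rewrite alt ?mulr0 //; exact: QT.
by pos.
Qed.

Lemma support_fun_le K w y : (forall k, K k -> Re (w * k) <= y) -> (support_fun K w <= y%:E)%E.
Proof. by move=> h; apply: ge_ereal_sup => _ [k Kk <-]; rewrite lee_fin; exact: h. Qed.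

End Core.

Theorem mainTheorem2 (R : realType) (Q K : set (Cx R))
    (Q_convex : is_convex Q)
    (Q_int : interior Q !=set0)
    (Q_basis : has_countable_convex_basis Q)
    (Q_omega : omega Q !=set0)
    (K_convex : is_convex K)
    (K_compact : compact K)
    (mu : {linear A_K K -> Cx R})
    (mu_continuous : continuous mu)
    (mu_neq0 : exists f : A_K K, mu f <> 0)
    (surj : forall g : A_Q Q, exists f : A_QK Q K, conv_op mu f = g) :
  forall A : set (Cx R), compact A -> A `<=` R_set Q ->
    slowly_decreasing K (laplace mu) (cone A).
Proof.
move=> A cA AR k k0.
have K0 := mu_neq0_set mu_neq0.
have kR : 0 < k%:R :> R by rewrite ltr0n.
pose good (z : Cx R) := exists w, modulus (w - z) <= modulus z / k%:R /\
  (expeR (support_fun K w - (modulus w / k%:R)%:E) <= (modulus (laplace mu w))%:E)%E.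
(* Points of the cone are [l * b] with [b] of modulus 1, so a threshold uniform in [b] is what slow
   decrease asks for; compactness of [A] reduces it to neighbourhoods of single directions. *)
suff [N hN] : exists N : nat, forall b, A b -> forall l : R, N%:R <= l -> good (rC l * b).
  exists (N%:R + 1); first by rewrite ltr_wpDl.
  move=> _ [l l0 [b Ab ->]]; have ub : modulus b = 1 by have [[]] := AR b Ab.
  rewrite modulusM ub mulr1 modulus_rC ger0_norm // => hl.
  have := hN b Ab l; rewrite /good modulusM ub mulr1 modulus_rC ger0_norm //; apply.
  by apply: le_trans hl; rewrite lerDl.
have [N _ hN] : \forall N \near \oo, A `<=` (fun b => A b -> forall l : R, N%:R <= l -> good (rC l * b)).
  move: cA; rewrite compact_near_coveringP => /(_ nat \oo (fun N b => A b -> forall l : R, N%:R <= l -> good (rC l * b)) _); apply.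
  move=> b Ab; apply: contrapT => hn.
  pose dl : R := 2^-1 / k%:R.
  have dl0 : 0 < dl by rewrite /dl divr_gt0.
  have dl2 : dl <= 2^-1 by rewrite /dl ler_pdivrMr // ler_peMr // ler1n.
  apply: (no_bad_scales Q_convex Q_int K_convex K_compact K0 mu_continuous surj (AR b Ab) dl0 dl2).
  move=> x; apply: contrapT => hx; apply: hn.
  (* The maximum with 0 makes the scale [l] positive as well as larger than [x]. A failure at
     [l * b'] then shows that [l] is a bad scale for [b]. *)
  have [N hN] := natr_gt (Num.max x 0).
  exists (disc b dl, [set n | (N <= n)%N]).
    by split; [exact: nbhs_disc|exists N].
  move=> [b' n] /= [bb nN] Ab' l nl; apply: contrapT => hg; apply: hx.
  have Nl : Num.max x 0 < l by apply: lt_le_trans hN _; apply: le_trans nl; rewrite ler_nat.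
  have l0 : 0 < l by apply: le_lt_trans Nl; rewrite le_max lexx orbT.
  exists l; first by apply: le_trans (ltW Nl); rewrite le_max lexx.
  move=> w hw y hy; rewrite leNgt; apply/negP => hlt; apply: hg; exists w.
  have ub' : modulus b' = 1 by have [[]] := AR b' Ab'.
  rewrite modulusM ub' mulr1 modulus_rC gtr0_norm //; split.
    apply: le_trans (modulus_triangle w (rC l * b) _) _.
    have : modulus (rC l * b - rC l * b') <= l * dl.
      rewrite -mulrBr modulusM modulus_rC gtr0_norm // ler_pM2l // modulus_distC; exact: ltW.
    rewrite (_ : l / k%:R = dl * l + l * dl); first exact: lerD.
    by rewrite /dl; field; rewrite gt_eqF.
  apply: (@le_trans _ _ (expR (y - dl * modulus w))%:E); last by rewrite lee_fin ltW.
  rewrite -[(expR _)%:E]/(expeR (_%:E)) lee_expeR EFinB; apply: leeB; first exact: support_fun_le.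
  rewrite lee_fin mulrC ler_wpM2l // /dl ler_piMl // ?invr_ge0 ?ler0n //; lra.
exists N => b Ab; exact: (hN N (leqnn N) b Ab Ab).
Qed.
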